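(* Let $E$ be a metrizable locally convex space over $\mathbb{K}$ of infinite countable algebraic dimension. Then the following three conditions are equivalent: (i) $E$ is orbital; (ii) $E$ is strongly orbital; (iii) $E\notin\mathcal{M}_2$.
   Context: $\mathbb{K}$ is either $\mathbb{R}$ or $\mathbb{C}$; all topological spaces are Hausdorff; $\mathbb{Z}_+=\{0,1,2,\dots\}$, $\mathbb{N}=\{1,2,\dots\}$. For a topological vector space $X$, $L(X)$ is the algebra of continuous linear operators on $X$; for $T\in L(X)$ and $x\in X$, $O(T,x)=\{T^nx:n\in\mathbb{Z}_+\}$. The vector $x$ is hypercyclic for $T$ if $O(T,x)$ is dense in $X$. $X$ is orbital if there exist $T\in L(X)$ and $x\in X$ such that $X$ is the (algebraic) linear span of $O(T,x)$; $X$ is strongly orbital if there exist $T\in L(X)$ and $x\in X$ such that $x$ is hypercyclic for $T$ and $X$ is the linear span of $O(T,x)$. An infinite dimensional metrizable locally convex space $X$ belongs to $\mathcal{M}_2$ if for some increasing sequence $\{p_n\}_{n\in\mathbb{N}}$ of seminorms on $X$ defining the topology of $X$, the space $X/\ker p_1$ is infinite dimensional, and $\ker p_n/\ker p_{n+1}$ is finite dimensional for each $n\in\mathbb{N}$ and is non-zero for infinitely many $n\in\mathbb{N}$. Here $\ker p=\{x:p(x)=0\}$. *)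

(* Defs.v *)
From HB Require Import structures.
From mathcomp Require Import all_boot all_order all_algebra.
From mathcomp Require Import generic_quotient ring_quotient complex.
From mathcomp Require Import all_classical all_reals all_analysis.

Set Implicit Arguments.
Unset Strict Implicit.
Unset Printing Implicit Defensive.

Import Order.TTheory GRing.Theory Num.Theory.
Import numFieldNormedType.Exports.

Local Open Scope classical_set_scope.
Local Open Scope card_scope.
Local Open Scope quotient_scope.
Local Open Scope ring_scope.

Section LinearAlgebra.
Context (K : numFieldType) (V : lmodType K).
Implicit Type A : set V.

Definition lspan A : set V :=
  [set x | exists (n : nat) (a : 'I_n -> K) (v : 'I_n -> V),
    (forall i, A (v i)) /\ x = \sum_(i < n) a i *: v i].

Definition linearly_independent A : Prop :=
  forall (n : nat) (a : 'I_n -> K) (v : 'I_n -> V),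
    injective v -> (forall i, A (v i)) ->
    \sum_(i < n) a i *: v i = 0 -> forall i, a i = 0.

Definition hamel_basis A : Prop :=
  linearly_independent A /\ lspan A = [set: V].

Definition countably_infinite_dimensional : Prop :=
  exists B : set V, hamel_basis B /\ B #= [set: nat].

Definition finite_dimensional : Prop :=
  exists B : set V, finite_set B /\ lspan B = [set: V].

End LinearAlgebra.

Arguments countably_infinite_dimensional {K} V.
Arguments finite_dimensional {K} V.

(** As for the norms of the library, the values are taken in [K] itself; for
    [K = R[i]] a nonnegative element is a nonnegative real. *)

Record seminorm (K : numFieldType) (V : lmodType K) := Seminorm {
  seminorm_fun :> V -> K ;
  seminorm_ge0 : forall x, 0 <= seminorm_fun x ;
  seminormD : forall x y,
    seminorm_fun (x + y) <= seminorm_fun x + seminorm_fun y ;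
  seminormZ : forall a x, seminorm_fun (a *: x) = `|a| * seminorm_fun x }.

Section SeminormKernel.
Context (K : numFieldType) (V : lmodType K).
Implicit Types p q : seminorm V.

Definition ker p : {pred V} := fun x => p x == 0.

Fact ker_submod_closed p : submod_closed (ker p).
Proof.
split=> [|a x y]; rewrite !unfold_in.
  by rewrite -(scale0r 0) seminormZ normr0 mul0r.
move=> /eqP px /eqP py; rewrite eq_le seminorm_ge0 andbT.
by rewrite (le_trans (seminormD _ _ _))// seminormZ px py mulr0 addr0.
Qed.

HB.instance Definition _ p :=
  GRing.isSubmodClosed.Build K V (ker p) (ker_submod_closed p).

Definition kerT p : Type := {x : V | x \in ker p}.

HB.instance Definition _ p := SubChoice.on (kerT p).
HB.instance Definition _ p :=
  [SubChoice_isSubLmodule of kerT p by <:].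

Definition ker_restr p q : seminorm (kerT p) :=
  @Seminorm K (kerT p) (fun x => q (val x)) (fun x => seminorm_ge0 q (val x))
    (fun x y => seminormD q (val x) (val y))
    (fun a x => seminormZ q a (val x)).

End SeminormKernel.

Section QuotKer.
Context (K : numFieldType) (V : lmodType K) (p : seminorm V).

(** [V / ker p]: the library's quotient of additive groups, equipped with the
    scaling induced by that of [V]. *)
Definition quot_ker : Type := Quotient.quot (ker p).

HB.instance Definition _ := GRing.Zmodule.on quot_ker.

Definition quot_ker_pi (x : V) : quot_ker := \pi_(Quotient.quot (ker p)) x.

Definition quot_ker_scale (a : K) (u : quot_ker) : quot_ker :=
  quot_ker_pi (a *: repr (u : Quotient.quot (ker p))).

Lemma quot_ker_piP x y :
  (quot_ker_pi x == quot_ker_pi y) = (x - y \in ker p).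
Proof. by rewrite Quotient.idealrBE. Qed.

Lemma quot_ker_piD x y : quot_ker_pi (x + y) = quot_ker_pi x + quot_ker_pi y.
Proof. exact: (raddfD (\pi_(Quotient.quot (ker p)))). Qed.

Lemma quot_ker_pi_surj (u : quot_ker) : exists x, u = quot_ker_pi x.
Proof.
by exists (repr (u : Quotient.quot (ker p))); rewrite /quot_ker_pi reprK.
Qed.

Lemma quot_ker_piZ a x :
  quot_ker_pi (a *: x) = quot_ker_scale a (quot_ker_pi x).
Proof.
apply/eqP; rewrite quot_ker_piP -scalerBr rpredZ// -quot_ker_piP.
by rewrite /quot_ker_pi reprK.
Qed.

Fact quot_ker_scalerA a b u :
  quot_ker_scale a (quot_ker_scale b u) = quot_ker_scale (a * b) u.
Proof. by have [x ->] := quot_ker_pi_surj u; rewrite -!quot_ker_piZ scalerA. Qed.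

Fact quot_ker_scale1r : left_id 1 quot_ker_scale.
Proof.
by move=> u; have [x ->] := quot_ker_pi_surj u; rewrite -quot_ker_piZ scale1r.
Qed.

Fact quot_ker_scalerDr : right_distributive quot_ker_scale +%R.
Proof.
move=> a u w; have [x ->] := quot_ker_pi_surj u.
have [y ->] := quot_ker_pi_surj w.
by rewrite -quot_ker_piD -!quot_ker_piZ -quot_ker_piD scalerDr.
Qed.

Fact quot_ker_scalerDl u : {morph quot_ker_scale^~ u : a b / a + b}.
Proof.
move=> a b; have [x ->] := quot_ker_pi_surj u.
by rewrite -!quot_ker_piZ -quot_ker_piD scalerDl.
Qed.

HB.instance Definition _ := GRing.Zmodule_isLmodule.Build K quot_ker
  quot_ker_scalerA quot_ker_scale1r quot_ker_scalerDr quot_ker_scalerDl.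

End QuotKer.

(** [ker p / ker q] when [ker q] is contained in [ker p]: [ker q] is then the
    kernel of the restriction of [q] to [ker p]. *)
Notation ker_quot_ker p q := (quot_ker (ker_restr p q)).

Definition metrizable (R : realType) (T : topologicalType) : Prop :=
  exists (M : metricType R) (f : T -> M) (g : M -> T),
    [/\ cancel f g, cancel g f, continuous f & continuous g].

(** The topology of [E] is the one defined by the family [p]: the finite
    intersections of open [p i]-balls centered at [x] form a basis of
    neighborhoods of [x]. *)
Definition seminorms_define_topology (K : numFieldType) (E : tvsType K)
    (p : nat -> seminorm E) : Prop :=
  forall (x : E) (A : set E), nbhs x A <->
    exists (s : seq nat) (e : K), 0 < e /\
      [set y | forall i, i \in s -> p i (y - x) < e] `<=` A.

(** The sequence [p_1, p_2, ...] indexed by the positive integers is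
    [p 0, p 1, ...]. *)
Definition M2 (R : realType) (K : numFieldType) (E : tvsType K) : Prop :=
  [/\ ~ finite_dimensional E, metrizable R E &
    exists p : nat -> seminorm E,
      [/\ forall n x, p n x <= p n.+1 x,
          seminorms_define_topology p,
          ~ finite_dimensional (quot_ker (p 0)),
          forall n, finite_dimensional (ker_quot_ker (p n) (p n.+1)) &
          forall N : nat, exists2 n, (N <= n)%N &
            exists u : ker_quot_ker (p n) (p n.+1), u != 0]].

Section Orbital.
Context (K : numFieldType) (E : tvsType K).

Definition op_orbit (T : E -> E) (x : E) : set E :=
  [set iter n T x | n in [set: nat]].

Definition hypercyclic_vector (T : E -> E) (x : E) : Prop :=
  dense (op_orbit T x).

Definition orbital : Prop :=
  exists (T : {linear E -> E}) (x : E),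
    continuous T /\ lspan (op_orbit T x) = [set: E].

Definition strongly_orbital : Prop :=
  exists (T : {linear E -> E}) (x : E),
    [/\ continuous T, hypercyclic_vector T x &
        lspan (op_orbit T x) = [set: E]].

End Orbital.

Arguments orbital {K} E.
Arguments strongly_orbital {K} E.

(* Main.v *)
(** A space [E] of countable dimension with seminorms [p n] has an algebraic
    basis [e k] for which the level [l k], the least [n] with [p n (e k) != 0],
    controls the coordinates: [|f k| <= C k * p (l k)]. Then [ker (p n)] is
    spanned by the [e k] with [n < l k], and [E] belongs to M2 as soon as some
    level is attained infinitely often, only finitely many levels are, and the
    levels are unbounded. In each remaining case [e k |-> 'X^k] reduces the
    problem to [{poly K}].

    If every level is finite, all such spaces are isomorphic, and in one of them
    multiplication by ['X] is hypercyclic: its seminorms come from the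
    functionals ['X^k |-> s (i + k)], where [s] is a sequence in which every
    finite word is approximated. If the levels are bounded, or if infinitely
    many levels are infinite, the operator is a limit of nilpotent operators on
    coordinate subspaces [<X^k, k in s>] having [1] as a cyclic vector. One step
    appends a fresh chain of basis vectors to [s] and perturbs the operator
    slightly, keeping the part of the orbit of [1] already built, so that a
    later point of the orbit is close to a prescribed target. When the levels
    are infinite the orbit is that of the limit [N] itself; when they are
    bounded it is that of [1 + N], and the target is reached by choosing the
    exponent large.

    Conversely let [p] be as in the definition of M2 and let the orbit of [x]
    under [T] span [E]. As [T] maps some [ker (p m)] into [ker (p 0)] and the
    chain of kernels has finite steps, [ker (p 0)] plus the span of finitely
    many [T^i x] is [T]-invariant, hence is [E], and [E / ker (p 0)] is finite
    dimensional. *)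

Require Import Defs.
From HB Require Import structures.
From mathcomp Require Import all_boot all_order all_algebra.
From mathcomp Require Import complex.
From mathcomp Require Import ring lra zify.
From mathcomp Require Import all_classical all_reals all_analysis.

Set Implicit Arguments.
Unset Strict Implicit.
Unset Printing Implicit Defensive.

Import Order.TTheory GRing.Theory Num.Theory.
Import numFieldNormedType.Exports.

Local Open Scope ring_scope.

(** * Binomial steering *)

(** The span must be all of [E] algebraically, so each stage keeps [1] cyclic on a finite coordinate
    subspace and freezes the points of its nilpotent orbit already built. As [1] itself cannot move,
    the freedom sits in the operator: it is changed so that [1] splits into a tilted copy of itself
    and a combination, with coefficients [b], of the far end of the fresh chain. Both parts
    compensate during the first [size s] steps; afterwards the second one descends to the old
    vectors, where the [b] prescribe a later orbit point. A nonzero last [b] keeps [1] cyclic.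
    Continuity wants that combination small, while the target has ordinary size. If every level
    occurs infinitely often, the chain climbs one level per link: its far end is killed by the
    relevant seminorms and the [b] may be large. If there is one level only, nothing is killed; the
    [b] are small and the binomial coefficients in the powers of [1 + N] amplify them. If each level
    holds finitely many basis vectors, neither device has fresh vectors to work with, hence the
    detour through one explicit model. *)

Lemma dvd_XsubCn_nderivn (K : fieldType) (p : {poly K}) (a : K) n :
  (forall i, (i < n)%N -> (p^`N(i)).[a] = 0) -> ('X - a%:P) ^+ n %| p.
Proof.
move=> h.
have -> : p = \sum_(i < size p) (p^`N(i)).[a] *: ('X - a%:P) ^+ i.
  rewrite -[LHS]comp_polyXr /comp_poly -[X in _.[X]](subrKC a%:P).
  rewrite (nderiv_taylor _ (mulrC _ _)).
  rewrite size_map_polyC; apply: eq_bigr => i _.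
  by rewrite nderivn_map horner_map /= mul_polyC.
apply: (big_ind (fun q => _ %| q)) => [|u v|i _]; [exact: dvdp0|exact: dvdp_add|].
have [lin|nin] := ltnP i n; first by rewrite h // scale0r dvdp0.
by rewrite -mul_polyC dvdp_mull // dvdp_exp2l.
Qed.

Section HermiteMatrix.
Variable K : numFieldType.
Implicit Types r n : nat.

(** The limit, as [n] grows, of the matrices [binq (r + j - i) n] behind [binomial_steering];
    [r + j - i] is positive for [i, j < r], so the truncated subtraction is an honest one. *)
Definition hermite_mx r : 'M[K]_r :=
  \matrix_(i < r, j < r) ((r + j - i)`!%:R)^-1.

Lemma factK_neq0 n : n`!%:R != 0 :> K.
Proof. by rewrite pnatr_eq0 -lt0n fact_gt0. Qed.

(* A kernel vector [u] gives the polynomial [sum_j u_j X^(r+j) / (r+j)!], which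
   vanishes to order [r] both at 0 and at 1 and has degree less than [2r]. *)
Lemma hermite_mx_unit r : hermite_mx r \in unitmx.
Proof.
rewrite -unitmx_tr -row_free_unit; apply/row_freeP.
suff h : forall v : 'rV[K]_r, v *m (hermite_mx r)^T = 0 -> v = 0.
  have : row_free (hermite_mx r)^T.
    rewrite -kermx_eq0; apply/eqP/row_matrixP => i; rewrite row0.
    by apply: h; apply/sub_kermxP; exact: row_sub.
  by move/row_freeP.
move=> v vM.
pose U : {poly K} := \sum_(j < r) (v 0 j / (r + j)`!%:R) *: 'X^(r + j).
have dU i : (i < r)%N -> (U^`N(i)).[1] = 0.
  move=> ir.
  have := congr1 (fun A : 'rV_r => A 0 (Ordinal ir)) vM; rewrite mxE [RHS]mxE.
  under eq_bigr => j _ do rewrite !mxE /=.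
  move=> sv; apply: (mulfI (factK_neq0 i)); rewrite mulr0 -[RHS]sv.
  rewrite linear_sum horner_sum mulr_sumr; apply: eq_bigr => j _.
  have ij : (i <= r + j)%N by rewrite (leq_trans (ltnW ir)) ?leq_addr.
  rewrite linearZ /= nderivnXn hornerZ hornerMn hornerXn expr1n.
  rewrite -(bin_fact ij) !natrM.
  have := factK_neq0 i; have := factK_neq0 (r + j - i).
  have : 'C(r + j, i)%:R != 0 :> K by rewrite pnatr_eq0 -lt0n bin_gt0.
  by move=> *; field; apply/and3P.
have Xr : 'X^r %| U.
  apply: (big_ind (fun q => _ %| q)) => [|u w|j _]; [exact: dvdp0|exact: dvdp_add|].
  by rewrite -mul_polyC dvdp_mull // dvdp_exp2l ?leq_addr.
have sU : (size U <= r + r)%N.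
  apply: (leq_trans (size_sum _ _ _)); apply/bigmax_leqP => j _.
  by rewrite (leq_trans (size_scale_leq _ _)) // size_polyXn ltn_add2l.
have U0 : U = 0.
  apply/eqP; apply: contraTT sU => U0; rewrite -ltnNge.
  have cop : coprimep ('X^r : {poly K}) (('X - 1%:P) ^+ r).
    apply/coprimep_expl/coprimep_expr.
    by rewrite coprimep_XsubC rootX oner_eq0.
  have : 'X^r * ('X - 1%:P) ^+ r %| U.
    by rewrite Gauss_dvdp // Xr dvd_XsubCn_nderivn.
  move=> /dvdp_leq -/(_ U0); apply: leq_trans.
  rewrite size_Mmonic ?monic_exp ?monicXsubC ?monic_neq0 ?monicXn //.
  by rewrite size_polyXn size_exp_XsubC addnS.
apply/rowP => j; rewrite mxE.
have : U`_(r + j) = 0 by rewrite U0 coef0.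
rewrite coef_sum (bigD1 j) //= big1 ?addr0 => [|i ij].
  rewrite coefZ coefXn eqxx mulr1 => /eqP.
  by rewrite mulf_eq0 invr_eq0 (negPf (factK_neq0 _)) orbF => /eqP.
by rewrite coefZ coefXn eqn_add2l val_eqE eq_sym (negPf ij) mulr0.
Qed.

(** Divided by [n ^ k] the binomial coefficients stay at most [1] and tend to [1 / k!], which turns
    a system growing with [n] into a convergent one. *)
Definition binq k n : K := 'C(n, k)%:R / n%:R ^+ k.

Lemma binq_ge0 k n : 0 <= binq k n.
Proof. by rewrite divr_ge0 ?exprn_ge0 ?ler0n. Qed.

Lemma binq_le1 k n : binq k n <= 1.
Proof.
case: n => [|n]; last first.
  rewrite ler_pdivrMr ?exprn_gt0 ?ltr0n // mul1r -natrX ler_nat.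
  elim: k => [|k IHk]; first by rewrite bin0.
  rewrite -(leq_pmul2l (ltn0Sn k)) mul_bin_left expnS mulnA.
  by rewrite leq_mul // (leq_trans (leq_subr _ _)) // leq_pmull.
rewrite /binq; case: k => [|k]; first by rewrite bin0 expr0 divr1.
by rewrite bin0n mul0r.
Qed.

(** [binq k.+1 n] is [binq k n * (1 - k / n) / k.+1], so each step adds at most [k / n] to the error
    before dividing it by [k.+1]. *)
Lemma binq_fact k n : (0 < n)%N ->
  `|binq k n - k`!%:R^-1| <= (k ^ 2)%:R / n%:R.
Proof.
move=> n0; have n0K : n%:R != 0 :> K by rewrite pnatr_eq0 -lt0n.
elim: k => [|k IHk].
  by rewrite /binq bin0 expr0 fact0 divr1 invr1 subrr normr0 divr_ge0 ?ler0n.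
have k0 : k.+1%:R != 0 :> K by rewrite pnatr_eq0.
have fk := factK_neq0 k.
have fS : (k.+1)`!%:R = k.+1%:R * k`!%:R :> K by rewrite factS natrM.
have E : binq k.+1 n - (k.+1)`!%:R^-1 =
    ((binq k n - k`!%:R^-1) - binq k n * (k%:R / n%:R)) / k.+1%:R.
  rewrite fS; have [kn|nk] := leqP k n.
    have := congr1 (fun m => m%:R : K) (mul_bin_left n k).
    rewrite [LHS]natrM [RHS]natrM natrB // /binq => /(canRL (mulKf k0)) ->.
    by rewrite exprS; field; rewrite n0K fk expf_neq0 // nat1r k0.
  have := congr1 (fun m => m%:R : K) (mul_bin_left n k).
  rewrite /binq !bin_small // ?(ltn_trans nk) // !mul0r !subr0 !sub0r.
  by move=> _; field; rewrite fk nat1r k0.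
rewrite E normrM [`|_^-1|]gtr0_norm ?invr_gt0 ?ltr0n // ler_pdivrMr ?ltr0n //.
apply: (le_trans (ler_normB _ _)).
apply: (le_trans (lerD IHk (_ : _ <= k%:R / n%:R))).
  rewrite ger0_norm; last by rewrite mulr_ge0 ?binq_ge0 // divr_ge0 ?ler0n.
  by rewrite ler_piMl ?binq_le1 // divr_ge0 ?ler0n.
rewrite -mulrDl mulrAC ler_wpM2r ?invr_ge0 ?ler0n // -natrD -natrM ler_nat.
by rewrite !expnS !expn0; nia.
Qed.

Definition l1norm m (u : 'cV[K]_m) : K := \sum_i `|u i 0|.

Lemma l1norm_ge0 m (u : 'cV[K]_m) : 0 <= l1norm u.
Proof. by rewrite sumr_ge0. Qed.

Lemma l1normD m (u v : 'cV[K]_m) : l1norm (u + v) <= l1norm u + l1norm v.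
Proof.
by rewrite /l1norm -big_split ler_sum // => i _; rewrite mxE ler_normD.
Qed.

Lemma l1norm_mulmx m (A : 'M[K]_m) (u : 'cV[K]_m) :
  l1norm (A *m u) <= (\sum_i \sum_j `|A i j|) * l1norm u.
Proof.
rewrite mulr_suml ler_sum // => i _; rewrite mxE mulr_suml.
apply: (le_trans (ler_norm_sum _ _ _)); apply: ler_sum => j _.
rewrite normrM ler_wpM2l // /l1norm (bigD1 j) //= lerDl sumr_ge0 //.
Qed.

(** Perturbation of the invertible limit: a matrix close to [hermite_mx r] is invertible, with
    inverse bounded independently of [n]. The constant [c] is both the threshold for [n] and that
    bound. *)
Lemma binq_system_solvable r : exists2 c : K, 0 <= c & forall n,
  c <= n.+1%:R -> forall w : 'cV[K]_r, exists2 u : 'cV[K]_r,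
    forall i : 'I_r, \sum_(j < r) binq (r + j - i) n.+1 * u j 0 = w i 0 &
    l1norm u <= c * l1norm w.
Proof.
pose Mi := invmx (hermite_mx r); pose B := \sum_i \sum_j `|Mi i j|.
have B0 : 0 <= B by rewrite sumr_ge0 // => i _; rewrite sumr_ge0.
pose s : K := ((r + r) ^ 2)%:R *+ r *+ r.
have s0 : 0 <= s by rewrite !mulrn_wge0 ?ler0n.
(* [s / n.+1] bounds the entrywise distance of [Mn] to its limit, so [n.+1 >= 2 * B * s] makes its
   product with [B] at most one half; the summand [1] lets the same constant dominate [2 * B]. *)
exists (B * 2 * (s + 1)) => [|n cn w]; first by rewrite !mulr_ge0 ?addr_ge0 ?ler0n ?ler01.
have n0 : 0 < n.+1%:R :> K by rewrite ltr0n.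
pose Mn : 'M[K]_r := \matrix_(i, j) binq (r + j - i) n.+1.
have EB : B * (\sum_i \sum_j `|(Mn - hermite_mx r) i j|) <= 2^-1.
  apply: (@le_trans _ _ (B * (s / n.+1%:R))).
    rewrite ler_wpM2l //.
    apply: (@le_trans _ _ (\sum_(i < r) \sum_(j < r) ((r + r) ^ 2)%:R / n.+1%:R)).
      apply: ler_sum => i _; apply: ler_sum => j _; rewrite !mxE.
      apply: (le_trans (binq_fact _ _)) => //.
      rewrite ler_wpM2r ?invr_ge0 ?ler0n // ler_nat leq_sqr.
      by rewrite (leq_trans (leq_subr _ _)) // leq_add2l ltnW.
    by rewrite !sumr_const !card_ord -!mulrnAl.
  rewrite mulrA ler_pdivrMr // ler_pdivlMl ?ltr0n //.
  apply: le_trans cn; rewrite mulrA [2 * B]mulrC ler_wpM2l ?mulr_ge0 ?ler0n //.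
  by rewrite lerDl ler01.
have key u : l1norm u <= B * 2 * l1norm (Mn *m u).
  have : l1norm u <= B * l1norm (Mn *m u) + 2^-1 * l1norm u.
    have {1}-> : u = Mi *m (Mn *m u) + (Mi *m - (Mn - hermite_mx r)) *m u.
      by rewrite -mulmxA -mulmxDr -mulmxDl opprB subrKC mulKmx ?hermite_mx_unit.
    apply: (le_trans (l1normD _ _)); rewrite lerD ?l1norm_mulmx //.
    rewrite -mulmxA; apply: (le_trans (l1norm_mulmx _ _)).
    apply: (le_trans (ler_wpM2l B0 (l1norm_mulmx _ _))).
    rewrite mulrA ler_wpM2r ?l1norm_ge0 //.
    by under eq_bigr => i _ do under eq_bigr => j _ do rewrite mxE normrN.
  rewrite -lerBlDr -{1}[l1norm u]mul1r -mulrBl => h.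
  have -> : l1norm u = 2 * ((1 - 2^-1) * l1norm u) by field.
  by rewrite -mulrA [B * _]mulrCA ler_wpM2l ?ler0n.
have Mnu : Mn \in unitmx.
  rewrite -unitmx_tr -row_free_unit -kermx_eq0; apply/eqP/row_matrixP => i.
  rewrite row0; set v := row _ _.
  have vM : Mn *m v^T = 0.
    apply: trmx_inj; rewrite trmx_mul trmxK trmx0; apply/sub_kermxP.
    exact: row_sub.
  have := key v^T; rewrite vM [l1norm 0]big1 => [|k _]; last by rewrite mxE normr0.
  rewrite mulr0 => le0; have : l1norm v^T == 0 by rewrite eq_le le0 l1norm_ge0.
  rewrite psumr_eq0 // => /allP v0; apply/rowP => k; rewrite [RHS]mxE.
  have := v0 k (mem_index_enum _); rewrite normr_eq0 mxE => /eqP.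
  by rewrite !mxE.
exists (invmx Mn *m w).
  move=> i; rewrite -[in RHS](mulKVmx Mnu w) [RHS]mxE.
  by apply: eq_bigr => j _; rewrite [in RHS]mxE.
have := key (invmx Mn *m w); rewrite mulKVmx // => /le_trans; apply.
rewrite ler_wpM2r ?l1norm_ge0 // ler_peMr ?mulr_ge0 ?ler0n //.
by rewrite lerDr.
Qed.

Lemma bin_le_exp k n : ('C(n.+1, k)%:R : K) <= n.+1%:R ^+ k.
Proof.
by have := binq_le1 k n.+1; rewrite ler_pdivrMr ?exprn_gt0 ?ltr0n // mul1r.
Qed.

(* In the basis of Newton polynomials, [sum_j C(n, j - i) f_j] are the
   coefficients of the translate of [f] by [n]: a small perturbation of [x] in
   degrees [r <= j < 2r] steers it close to any prescribed [z] of degree less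
   than [r]. *)
Lemma binomial_steering (archi : forall a : K, 0 <= a -> exists n, a <= n%:R)
    r (x z : nat -> K) (e : K) : (0 < r)%N -> 0 < e ->
  exists n (b : nat -> K), [/\ forall j, `|b j| <= e, b (r + r).-1 != 0 &
    forall i, (i < r + r)%N ->
      `|\sum_(j < r + r | (i <= j)%N)
          'C(n, j - i)%:R * (if (j < r)%N then x j else b j)
        - (if (i < r)%N then z i else 0)| <= e].
Proof.
move=> r0 e0; have rr : (r + r.-1 = (r + r).-1)%N by rewrite -!subn1 addnBA.
have [c c0 solve] := binq_system_solvable r.
pose X : K := \sum_(i < r) `|z i| + \sum_(j < r) `|x j|.
have X0 : 0 <= X by rewrite addr_ge0 ?sumr_ge0.
pose Y := c * (X *+ r); have Y0 : 0 <= Y by rewrite mulr_ge0 ?mulrn_wge0.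
have e20 : 0 < e / 2 by rewrite divr_gt0 ?ltr0n.
have [n hn] : exists n, c + Y / (e / 2) <= n%:R.
  by apply: archi; rewrite addr_ge0 // divr_ge0 // ltW.
have {}hn : c + Y / (e / 2) <= n.+1%:R by rewrite (le_trans hn) // ler_nat.
have cn : c <= n.+1%:R.
  by rewrite (le_trans _ hn) // lerDl divr_ge0 // ltW.
have n0 : 0 < n.+1%:R :> K by rewrite ltr0n.
have nX k : 0 < n.+1%:R ^+ k :> K by rewrite exprn_gt0.
have n1 : 1 <= n.+1%:R :> K by rewrite ler1n.
have Yn : Y / n.+1%:R <= e / 2.
  rewrite ler_pdivrMr // mulrC -ler_pdivrMr // (le_trans _ hn) // lerDr //.
(* Write [n] for [n.+1]. With [b (r + j) = u j / n ^ (r + j)], equation [i < r] multiplied by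
   [n ^ i] is row [i] of the [binq] system with right-hand side [w]. As [w] is of order [n ^ r.-1],
   one power less than [n ^ r], the [b] are of order [1 / n]. *)
pose w : 'cV[K]_r := \col_i (n.+1%:R ^+ i *
  (z i - \sum_(j < r | (i <= j)%N) 'C(n.+1, j - i)%:R * x j)).
have wX : l1norm w <= n.+1%:R ^+ r.-1 * (X *+ r).
  rewrite -[X *+ r](_ : \sum_(i < r) X = _); last by rewrite sumr_const card_ord.
  rewrite mulr_sumr ler_sum // => i _.
  rewrite mxE normrM (ger0_norm (ltW (nX _))) /X.
  have ir (j : 'I_r) : (j <= r.-1)%N by rewrite -ltnS prednK.
  have zi : `|z i| <= \sum_(i < r) `|z i| by rewrite (bigD1 i) //= lerDl sumr_ge0.
  apply: (le_trans (ler_wpM2l (ltW (nX _)) (ler_normB _ _))).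
  rewrite !mulrDr lerD //.
    by apply: ler_pM => //; rewrite ?ler_weXn2l // ltW.
  apply: (le_trans (ler_wpM2l (ltW (nX _)) (ler_norm_sum _ _ _))).
  rewrite !mulr_sumr [leLHS]big_mkcond /= ler_sum // => j _; case: ifP => ij; last first.
    by rewrite mulr_ge0 // ltW.
  rewrite normrM mulrA ler_wpM2r // normr_nat.
  apply: (@le_trans _ _ (n.+1%:R ^+ j)); last by rewrite ler_weXn2l.
  rewrite -[in leRHS](subnKC ij) exprD ler_wpM2l ?bin_le_exp //; exact: ltW.
have [u uw uX] := solve n cn w.
have uY : l1norm u <= Y * n.+1%:R ^+ r.-1.
  by rewrite (le_trans uX) // /Y -mulrA ler_wpM2l // mulrC.
pose b0 k := \sum_(j < r | (r + j == k)%N) u j 0 / n.+1%:R ^+ k.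
have b0E (j : 'I_r) : b0 (r + j)%N = u j 0 / n.+1%:R ^+ (r + j).
  by rewrite /b0 (big_pred1 j) // => k; rewrite eqn_add2l.
have ub0 (j : 'I_r) : `|u j 0| <= Y * n.+1%:R ^+ r.-1.
  by rewrite (le_trans _ uY) // /l1norm (bigD1 j) //= lerDl sumr_ge0.
have b0e k : `|b0 k| <= e / 2.
  have [/existsP[j /eqP <-]|nk] := boolP [exists j : 'I_r, (r + j == k)%N]; last first.
    rewrite /b0 big_pred0 ?normr0 ?(ltW e20) // => j; apply/negbTE.
    by move: nk; rewrite negb_exists => /forallP.
  rewrite b0E normrM normfV (ger0_norm (ltW (nX _))) ler_pdivrMr //.
  apply: (le_trans (ub0 j)); move: Yn; rewrite ler_pdivrMr // => Yn.
  apply: (le_trans (ler_wpM2r (ltW (nX _)) Yn)).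
  rewrite -[_ * _ ^+ r.-1]mulrA -exprS prednK // ler_wpM2l ?(ltW e20) //.
  by rewrite ler_weXn2l // leq_addr.
(* Repairs the last coefficient if it happens to vanish; the division by [n.+1 ^ (r + r)] keeps its
   effect on every equation below [e / 2]. *)
pose t : K := if b0 (r + r).-1 == 0 then e / 2 / n.+1%:R ^+ (r + r) else 0.
have t0 : 0 <= t.
  by rewrite /t; case: ifP => // _; rewrite divr_ge0 // ltW.
have te k : (k <= r + r)%N -> n.+1%:R ^+ k * t <= e / 2.
  move=> kr; apply: (@le_trans _ _ (n.+1%:R ^+ (r + r) * t)).
    by rewrite ler_wpM2r // ler_weXn2l.
  rewrite /t; case: ifP => _; last by rewrite mulr0 ltW.
  by rewrite mulrC divfK // gt_eqF.
exists n.+1, (fun k => b0 k + (k == (r + r).-1)%:R * t); split=> [j||i ir].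
- rewrite [leRHS]splitr (le_trans (ler_normD _ _)) // lerD //.
  case: eqP => _; last by rewrite mul0r normr0 ltW.
  by rewrite mul1r ger0_norm // -[t]mul1r -(expr0 n.+1%:R) te.
- rewrite eqxx mul1r /t; have [E|] := eqVneq (b0 (r + r).-1) 0; last by rewrite addr0.
  by rewrite E add0r gt_eqF // divr_gt0.
have -> : \sum_(j < r + r | (i <= j)%N) 'C(n.+1, j - i)%:R *
    (if (j < r)%N then x j else b0 j + (j == (r + r).-1 :> nat)%:R * t) =
  \sum_(j < r | (i <= j)%N) 'C(n.+1, j - i)%:R * x j +
  \sum_(j < r | (i <= r + j)%N) 'C(n.+1, r + j - i)%:R * b0 (r + j)%N +
  'C(n.+1, (r + r).-1 - i)%:R * t.
  rewrite big_mkcond big_split_ord /= -addrA; congr (_ + _).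
    by rewrite [RHS]big_mkcond; apply: eq_bigr => j _; rewrite ltn_ord.
  have -> : 'C(n.+1, (r + r).-1 - i)%:R * t = \sum_(j < r | (i <= r + j)%N)
      'C(n.+1, r + j - i)%:R * ((r + j == (r + r).-1)%N%:R * t).
    have r1 : (r.-1 < r)%N by rewrite prednK.
    rewrite (bigD1 (Ordinal r1)) /=; last first.
      by rewrite rr -ltnS prednK // addn_gt0 r0.
    rewrite rr eqxx mul1r big1 ?addr0 // => j /andP[_ jr].
    by rewrite -rr eqn_add2l (negbTE (jr : j != r.-1 :> nat)) mul0r mulr0.
  rewrite -big_split [RHS]big_mkcond; apply: eq_bigr => j _.
  by rewrite ltnNge leq_addr /= mulrDr.
set x1 := \sum_(j < r | _) _; set u1 := \sum_(j < r | _) _.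
suff h : `|x1 + u1 - (if (i < r)%N then z i else 0)| <= e / 2.
  rewrite addrAC [leRHS]splitr (le_trans (ler_normD _ _)) // lerD //.
  rewrite ger0_norm ?mulr_ge0 ?ler0n //.
  apply: (le_trans (ler_wpM2r t0 (bin_le_exp _ _))); rewrite te //.
  by rewrite (leq_trans (leq_subr _ _)) ?leq_pred.
have [i_r|ri] := ltnP i r.
  have -> : u1 = z i - x1.
    rewrite /u1 (eq_bigl predT) => [|j]; last first.
      by rewrite (leq_trans (ltnW i_r)) // leq_addr.
    have := uw (Ordinal i_r); rewrite mxE /= -/x1 => /esym/(canRL (mulKf _)) ->; last first.
      by rewrite gt_eqF.
    rewrite mulr_sumr; apply: eq_bigr => j _; rewrite b0E /binq.
    have -> : (r + j = r + j - i + i)%N by rewrite subnK // (leq_trans (ltnW i_r)) // leq_addr.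
    rewrite addnK exprD; field. by rewrite !expf_neq0 ?gt_eqF.
  by rewrite subrKC subrr normr0 ltW.
have -> : x1 = 0.
  by rewrite /x1 big_pred0 // => j; rewrite leqNgt (leq_trans (ltn_ord j)).
rewrite add0r subr0 (le_trans (ler_norm_sum _ _ _)) //.
apply: (@le_trans _ _ (l1norm u / n.+1%:R ^+ r)).
  rewrite /l1norm mulr_suml [leLHS]big_mkcond ler_sum // => j _; case: ifP => ij; last first.
    by rewrite divr_ge0 // ltW.
  rewrite b0E !normrM normr_nat normfV (ger0_norm (ltW (nX _))).
  rewrite mulrCA ler_wpM2l // ler_pdivrMr //.
  rewrite (le_trans (bin_le_exp _ _)) // exprD mulKf ?gt_eqF //.
  by rewrite ler_weXn2l // leq_subLR leq_add2r.
rewrite ler_pdivrMr // (le_trans uY) // -[in leRHS](prednK r0) exprS mulrA.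
by rewrite ler_wpM2r ?(ltW (nX _)) // -ler_pdivrMr.
Qed.
End HermiteMatrix.

(** * Cyclic nilpotent operators and the chain step *)

Section LinearExtension.
Variables (K : fieldType) (V : lmodType K) (v : nat -> V).
Implicit Types u w : {poly K}.

(** [{poly K}] serves as the space with basis ['X^k]; an operator is stored as the sequence of
    images of that basis. *)
Definition lext u : V := \sum_(k < size u) u`_k *: v k.

Lemma lext_wide n u : (size u <= n)%N -> lext u = \sum_(k < n) u`_k *: v k.
Proof.
move=> un; rewrite /lext (big_ord_widen _ (fun k => u`_k *: v k) un) big_mkcond.
apply: eq_bigr => k _; case: ltnP => // ku.
by rewrite nth_default ?scale0r.
Qed.

Fact lext_is_linear : linear lext.
Proof.
move=> a u w; pose n := maxn (size u) (size w).
have un : (size u <= n)%N by rewrite leq_maxl.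
have wn : (size w <= n)%N by rewrite leq_maxr.
have auwn : (size (a *: u + w)%R <= n)%N.
  rewrite (leq_trans (size_polyD _ _)) // geq_max wn andbT.
  by rewrite (leq_trans (size_scale_leq _ _)).
rewrite (lext_wide auwn) (lext_wide un) (lext_wide wn).
rewrite scaler_sumr -big_split; apply: eq_bigr => k _.
by rewrite coefD coefZ scalerDl scalerA.
Qed.
HB.instance Definition _ := GRing.isLinear.Build K {poly K} V *:%R lext
  lext_is_linear.

Lemma lextX k : lext 'X^k = v k.
Proof.
rewrite /lext size_polyXn big_ord_recr /= big1 => [|i _].
  by rewrite coefXn eqxx scale1r add0r.
by rewrite coefXn ltn_eqF ?scale0r.
Qed.

End LinearExtension.

Lemma iter_linear_sum (K : fieldType) (V : lmodType K) (L : {linear V -> V})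
    n (I : Type) (r : seq I) (P : pred I) (f : I -> K) (u : I -> V) :
  iter n L (\sum_(i <- r | P i) f i *: u i)
    = \sum_(i <- r | P i) f i *: iter n L (u i).
Proof.
elim: n => // n IHn; rewrite iterS IHn linear_sum.
by apply: eq_bigr => i _; rewrite linearZ.
Qed.

Section Supported.
Variable K : fieldType.
Implicit Types (s : seq nat) (u : {poly K}).

Definition supported s u := forall k, k \notin s -> u`_k = 0.

Lemma supportedE s u : uniq s -> supported s u ->
  u = \sum_(k <- s) u`_k *: 'X^k.
Proof.
move=> us su; apply/polyP => i; rewrite coef_sum.
have [is_|nis] := boolP (i \in s); last first.
  rewrite su // big_seq big1 // => k ks; rewrite coefZ coefXn.
  by rewrite (_ : (i == k) = false) ?mulr0 //; apply: contraNF nis => /eqP ->.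
rewrite (bigD1_seq i) //= coefZ coefXn eqxx mulr1 big1 ?addr0 // => k ki.
by rewrite coefZ coefXn eq_sym (negPf ki) mulr0.
Qed.

Lemma supported_sum s (I : Type) (r : seq I) (P : pred I) (f : I -> {poly K}) :
  (forall i, P i -> supported s (f i)) -> supported s (\sum_(i <- r | P i) f i).
Proof. by move=> h k ks; rewrite coef_sum big1 // => i /h; apply. Qed.

Lemma supportedZ s a u : supported s u -> supported s (a *: u).
Proof. by move=> h k ks; rewrite coefZ h // mulr0. Qed.

Lemma supportedD s u w : supported s u -> supported s w -> supported s (u + w).
Proof. by move=> hu hw k ks; rewrite coefD hu // hw // addr0. Qed.

Lemma supportedB s u w : supported s u -> supported s w -> supported s (u - w).
Proof. by move=> hu hw k ks; rewrite coefB hu // hw // subr0. Qed.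

Lemma supportedX s k : k \in s -> supported s ('X^k : {poly K}).
Proof.
move=> ks i nis; rewrite coefXn; case: eqP => // ik.
by rewrite ik ks in nis.
Qed.

Lemma supported_sub s t u : {subset s <= t} -> supported s u -> supported t u.
Proof. by move=> st su k kt; apply: su; apply: contra kt => /st. Qed.

Lemma lext_supported (V : lmodType K) (v : nat -> V) s u : uniq s ->
  supported s u -> lext v u = \sum_(k <- s) u`_k *: v k.
Proof.
move=> us su; rewrite {1}(supportedE us su) linear_sum.
by apply: eq_bigr => k _; rewrite linearZ /= lextX.
Qed.

Lemma lext_supported_eq (V : lmodType K) (v v' : nat -> V) s u : uniq s ->
  supported s u -> {in s, v =1 v'} -> lext v u = lext v' u.
Proof.
move=> us su vv'; rewrite !(lext_supported _ us su) big_seq [RHS]big_seq.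
by apply: eq_bigr => k /vv' ->.
Qed.

Lemma supported_lext s N u : uniq s -> (forall k, k \in s -> supported s (N k)) ->
  supported s u -> supported s (lext N u).
Proof.
move=> us sN su; rewrite (lext_supported _ us su) big_seq.
by apply: supported_sum => k /sN h; apply: supportedZ.
Qed.

(** As many spanning vectors as indices form a basis: the matrix expressing ['X^k] in the [y n] is a
    left inverse of their coordinate matrix, hence a right inverse, and its columns are the dual
    functionals. *)
Lemma spanning_dual s (y : nat -> {poly K}) : uniq s ->
  (forall n, (n < size s)%N -> supported s (y n)) ->
  (forall k, k \in s ->
     exists a : nat -> K, 'X^k = \sum_(n < size s) a n *: y n) ->
  exists G : nat -> nat -> K,
    forall m n, (m < size s)%N -> (n < size s)%N ->
      \sum_(k <- s) (y m)`_k * G n k = (m == n)%:R.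
Proof.
move=> us sy ysp.
have [a ha] : exists a : nat -> nat -> K,
    forall k, k \in s -> 'X^k = \sum_(n < size s) a k n *: y n.
  have : forall t : seq nat, {subset t <= s} -> exists a : nat -> nat -> K,
      forall k, k \in t -> 'X^k = \sum_(n < size s) a k n *: y n.
    elim=> [|k t IHt] ts; first by exists (fun _ _ => 0).
    have [|b hb] := IHt; first by move=> i it; apply: ts; rewrite inE it orbT.
    have [c hc] := ysp k (ts _ (mem_head _ _)).
    exists (fun i => if i == k then c else b i) => i; rewrite inE.
    by case: eqP => [->|_] //= /hb.
  by apply.
pose Y : 'M[K]_(size s) := \matrix_(m, i) (y m)`_(nth 0%N s i).
pose C : 'M[K]_(size s) := \matrix_(i, n) a (nth 0%N s i) n.
have CY : C *m Y = 1%:M.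
  apply/matrixP => i j; rewrite !mxE.
  have si (k : 'I_(size s)) : nth 0%N s k \in s by rewrite mem_nth.
  have /(congr1 (fun p : {poly K} => p`_(nth 0%N s j))) := ha _ (si i).
  rewrite coefXn coef_sum nth_uniq // eq_sym val_eqE => ->.
  by apply: eq_bigr => k _; rewrite !mxE coefZ.
have YC := mulmx1C CY.
exists (fun n k => a k n) => m n ms ns.
have := congr1 (fun A : 'M[K]_(size s) => A (Ordinal ms) (Ordinal ns)) YC.
rewrite !mxE => <-; rewrite (big_nth 0%N) big_mkord.
by apply: eq_bigr => i _; rewrite !mxE.
Qed.

End Supported.

Section NilpotentChain.
Variables (K : fieldType) (V : lmodType K) (L : {linear V -> V}).
Variables (r : nat) (h : nat -> V).
Hypothesis L0 : L (h 0) = 0.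
Hypothesis LS : forall j, (j.+1 < r)%N -> L (h j.+1) = h j.

Lemma iter_chain n j : (j < r)%N ->
  iter n L (h j) = if (n <= j)%N then h (j - n)%N else 0.
Proof.
move=> jr; elim: n => [|n IHn]; first by rewrite subn0.
rewrite iterS IHn; case: (ltngtP n j) => [nj|jn|->].
- by rewrite -(subnSK nj) LS // subnSK // (leq_ltn_trans (leq_subr _ _)).
- by rewrite linear0.
- by rewrite subnn L0.
Qed.

Lemma iter_chain_sum n (f : nat -> K) :
  iter n L (\sum_(j < r) f j *: h j) =
    \sum_(j < r | (n <= j)%N) f j *: h (j - n)%N.
Proof.
rewrite iter_linear_sum [RHS]big_mkcond; apply: eq_bigr => j _.
by rewrite iter_chain //; case: ifP; rewrite // scaler0.
Qed.

(** The binomial theorem for [1 + L] on a chain that [L] lowers by one, proved through Pascal's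
    rule. *)
Lemma iter_unipotent_chain (T : V -> V) n (f : nat -> K) :
  (forall u, T u = u + L u) ->
  iter n T (\sum_(j < r) f j *: h j) = \sum_(i < r)
    (\sum_(j < r | (i <= j)%N) 'C(n, j - i)%:R * f j) *: h i.
Proof.
move=> TE.
have step (g : nat -> K) : L (\sum_(j < r) g j *: h j) =
    \sum_(i < r) (if (i.+1 < r)%N then g i.+1 else 0) *: h i.
  rewrite linear_sum.
  case: r LS => [|q] LSq; first by rewrite !big_ord0.
  rewrite big_ord_recl linearZ /= L0 scaler0 add0r [RHS]big_ord_recr /=.
  rewrite ltnn scale0r addr0; apply: eq_bigr => i _.
  by rewrite linearZ /= LSq ltnS ltn_ord.
elim: n => [|n IHn] /=.
  apply: eq_bigr => i _; congr (_ *: _); rewrite (bigD1 i) //= subnn bin0 mul1r.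
  rewrite big1 ?addr0 // => j /andP[ij ji]; rewrite bin0n subn_eq0 leqNgt.
  by rewrite ltn_neqAle ij eq_sym ji mul0r.
rewrite IHn TE.
rewrite (step (fun i => \sum_(j < r | (i <= j)%N) 'C(n, j - i)%:R * f j)).
rewrite -big_split; apply: eq_bigr => i _.
rewrite /= -scalerDl; congr (_ *: _).
have -> : (if (i.+1 < r)%N then \sum_(j < r | (i < j)%N) 'C(n, j - i.+1)%:R * f j
    else 0) = \sum_(j < r | (i < j)%N) 'C(n, j - i.+1)%:R * f j.
  case: ltnP => // ri; rewrite big_pred0 // => j; apply: contraTF (ltn_ord j).
  by rewrite -leqNgt; apply: leq_trans.
rewrite [X in _ + X]big_mkcond [X in X + _]big_mkcond [RHS]big_mkcond.
rewrite -big_split; apply: eq_bigr => j _ /=.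
case: (ltngtP i j) => [ij|ji|ij]; last 2 first.
- by rewrite addr0.
- by rewrite ij subnn !bin0 addr0.
by rewrite -(subnSK ij) binS natrD mulrDl.
Qed.

End NilpotentChain.

(** There are as many iterates as indices in [s], so the orbit of [1] is a basis of the coordinate
    subspace and not merely a spanning family. *)
Definition cyclic_on (K : fieldType) (s : seq nat) (N : nat -> {poly K}) : Prop :=
  [/\ uniq s, forall k, k \in s -> supported s (N k), supported s (1 : {poly K}),
      iter (size s) (lext N) 1 = 0 &
      forall k, k \in s -> exists a : nat -> K,
        'X^k = \sum_(n < size s) a n *: iter n (lext N) 1].

Section ChainStep.
Variables (K : fieldType) (s c : seq nat) (N : nat -> {poly K}).
Variables (rho b eta : nat -> K).
Let R := size s.
Let r := (R + size c)%N.
Hypothesis cycN : cyclic_on s N.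
Hypothesis uniq_sc : uniq (s ++ c).
Hypothesis rho_neq0 : forall i, rho i != 0.
Hypothesis Rr : (R + R < r)%N.
Hypothesis b_top : b r.-1 != 0.
Hypothesis etaP : forall m, (m < R)%N ->
  \sum_(k <- s) (iter m (lext N) 1)`_k * eta k = (m == R.-1)%:R.

(* [chain_vec] continues the orbit of [1] backwards along the fresh chain [c]:
   for the operator [N] extended by [c] it is mapped to itself with index
   lowered by one. The perturbation replaces [1] by [1 - chain_shift 0] at the
   junction of [c] and [s] and is compensated on [s] by [eta], the coordinate
   along the last vector of the orbit; [tilted_vec] is the resulting chain. *)
Definition chain_vec (j : nat) : {poly K} :=
  if (j < R)%N then iter (R.-1 - j) (lext N) 1
  else (\prod_(i < (j - R).+1) rho i)^-1 *: 'X^(nth 0%N c (j - R)).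

(** The sum starts at [R + R] so that for [n <= R] the shifted indices stay at least [R], in the
    fresh part of the chain, on which the new operator lowers the index by exactly one. *)
Definition chain_shift (n : nat) : {poly K} :=
  \sum_(j < r | (R + R <= j)%N) b j *: chain_vec (j - n).

Definition step_op (k : nat) : {poly K} :=
  if k \in s then N k + eta k *: chain_shift R
  else if index k c is i.+1 then rho i.+1 *: 'X^(nth 0%N c i)
  else rho 0%N *: (1 - chain_shift 0).

Definition tilted_vec (j : nat) : {poly K} :=
  if (j < R)%N then chain_vec j - chain_shift (R.-1 - j) else chain_vec j.

Definition tilted_coef (j : nat) : K :=
  if (j < R + R)%N then (j == R.-1)%:R else b j.

Let uniq_s : uniq s. Proof. by case: cycN. Qed.
Let uniq_c : uniq c.
Proof. by move: uniq_sc; rewrite cat_uniq => /and3P[]. Qed.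

Lemma size_gt0 : (0 < R)%N.
Proof.
rewrite lt0n; apply/eqP => R0; have [_ _ s1 _ _] := cycN.
have s0 : s = [::] by apply: size0nil.
by have := s1 0%N; rewrite s0 coef1 => /(_ isT)/eqP; rewrite oner_eq0.
Qed.

Let nth_cNs i : (i < size c)%N -> nth 0%N c i \notin s.
Proof.
move=> ic; move: uniq_sc; rewrite cat_uniq => /and3P[_ /hasPn h _].
exact/h/mem_nth.
Qed.

Let yS n : supported s (iter n (lext N) 1).
Proof.
have [us sN s1 _ _] := cycN; elim: n => // n IHn.
exact: supported_lext.
Qed.

Lemma supported_chain_vec j : (j < r)%N -> supported (s ++ c) (chain_vec j).
Proof.
move=> jr; rewrite /chain_vec; case: ifP => [jR|/negbT].
  by apply: supported_sub (@yS _) => k ks; rewrite mem_cat ks.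
rewrite -leqNgt => Rj; apply/supportedZ/supportedX.
by rewrite mem_cat mem_nth ?orbT // -(ltn_add2l R) subnKC.
Qed.

Lemma supported_chain_shift n : supported (s ++ c) (chain_shift n).
Proof.
apply: supported_sum => j _; apply: supportedZ; apply: supported_chain_vec.
exact: leq_ltn_trans (leq_subr _ _) (ltn_ord j).
Qed.

Lemma supported_step_op k : k \in s ++ c -> supported (s ++ c) (step_op k).
Proof.
have [us sN s1 _ _] := cycN.
have ssub : {subset s <= s ++ c} by move=> i; rewrite mem_cat => ->.
rewrite mem_cat /step_op; case: ifP => /= [ks _|_ kc].
  apply: supportedD; last exact/supportedZ/supported_chain_shift.
  exact: supported_sub (sN _ ks).
case E: (index k c) => [|i]; apply: supportedZ.
  by apply: supportedB; [exact: supported_sub s1|exact: supported_chain_shift].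
apply: supportedX; rewrite mem_cat mem_nth ?orbT // ltnW //.
by rewrite -E index_mem.
Qed.

Let LX i : (i.+1 < size c)%N ->
  lext step_op 'X^(nth 0%N c i.+1) = rho i.+1 *: 'X^(nth 0%N c i).
Proof.
move=> ic; rewrite lextX /step_op (negPf (nth_cNs ic)) index_uniq //.
Qed.

Let LX0 : lext step_op 'X^(nth 0%N c 0) = rho 0%N *: (1 - chain_shift 0).
Proof.
have c0 : (0 < size c)%N.
  have := leq_trans Rr (leqnn r); rewrite /r; have := size_gt0; lia.
by rewrite lextX /step_op (negPf (nth_cNs c0)) index_uniq.
Qed.

Lemma step_chain_vecS j : (R <= j)%N -> (j.+1 < r)%N ->
  lext step_op (chain_vec j.+1) = chain_vec j.
Proof.
move=> Rj jr; have jc : ((j - R).+1 < size c)%N by rewrite -(ltn_add2l R) addnS subnKC.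
rewrite /chain_vec ltnNge (leq_trans Rj) //= ltnNge Rj /= subSn //.
rewrite linearZ /= LX // scalerA big_ord_recr /= invfM mulrAC mulfK //.
Qed.

Lemma step_chain_vecR : lext step_op (chain_vec R) = 1 - chain_shift 0.
Proof.
rewrite /chain_vec ltnn subnn big_ord_recl big_ord0 mulr1 linearZ /= LX0.
by rewrite scalerA mulVf ?scale1r.
Qed.

Lemma step_supported n : (n < R)%N -> lext step_op (iter n (lext N) 1) =
  iter n.+1 (lext N) 1 + (n == R.-1)%:R *: chain_shift R.
Proof.
move=> nR; rewrite (lext_supported _ uniq_s (@yS n)) big_seq.
rewrite -(etaP nR) scaler_suml /=.
rewrite (lext_supported N uniq_s (@yS n)) [in RHS]big_seq.
rewrite [X in _ = _ + X]big_seq -big_split; apply: eq_bigr => k ks /=.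
by rewrite /step_op ks scalerDr scalerA.
Qed.

Lemma step_chain_shift n : (n < R)%N ->
  lext step_op (chain_shift n) = chain_shift n.+1.
Proof.
move=> nR; rewrite linear_sum; apply: eq_bigr => j Rj; rewrite linearZ /=.
have nj : (n < j)%N by have := ltn_ord j; lia.
rewrite -(subnSK nj) step_chain_vecS //; first by lia.
by have := ltn_ord j; lia.
Qed.

(** This is what [eta] is for: on the last old orbit vector it adds [chain_shift R], which cancels
    the image of the tilt [chain_shift R.-1]. *)
Lemma step_tilted_vec0 : lext step_op (tilted_vec 0) = 0.
Proof.
have R0 := size_gt0; rewrite /tilted_vec R0 /chain_vec R0 subn0 linearB /=.
have R1 : (R.-1 < R)%N by rewrite prednK.
rewrite step_supported // step_chain_shift // eqxx scale1r prednK //.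
by case: cycN => _ _ _ -> _; rewrite add0r subrr.
Qed.

Lemma step_tilted_vecS j : (j.+1 < r)%N ->
  lext step_op (tilted_vec j.+1) = tilted_vec j.
Proof.
move=> jr; rewrite /tilted_vec; case: (ltngtP j.+1 R) => [jR|Rj|jR].
- rewrite /chain_vec jR (ltnW jR) linearB /= step_supported; last by lia.
  rewrite step_chain_shift; last by lia.
  have -> : (R.-1 - j.+1 == R.-1)%N = false by lia.
  rewrite scale0r addr0; have -> : (R.-1 - j.+1).+1 = (R.-1 - j)%N by lia.
  by [].
- by rewrite step_chain_vecS.
by rewrite jR step_chain_vecR /chain_vec -jR leqnn /= subnn.
Qed.

(** The tilted vector of index [R.-1] is [1 - chain_shift 0], and [chain_shift 0] only involves
    indices at which nothing is tilted. *)
Lemma tilted_expand : 1 = \sum_(j < r) tilted_coef j *: tilted_vec j.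
Proof.
have R0 := size_gt0; have R1r : (R.-1 < r)%N by lia.
rewrite (bigD1 (Ordinal R1r)) //= /tilted_coef /tilted_vec /=.
have -> : (R.-1 < R + R)%N by lia.
have R1 : (R.-1 < R)%N by lia.
rewrite R1 eqxx scale1r subnn /chain_vec R1 subnn /=.
rewrite -[LHS]addr0 -addrA; congr (_ + _); apply/esym/eqP; rewrite addrC subr_eq0.
rewrite /chain_shift big_mkcond [X in _ == X]big_mkcond; apply/eqP; apply: eq_bigr => j _.
rewrite -val_eqE /= subn0; case: (ltnP j (R + R)%N) => [jR|Rj].
  by case: ifP => // /negPf ->; rewrite scale0r.
have -> : j != R.-1 :> nat by lia.
by rewrite /chain_vec; have -> : (j < R)%N = false by lia.
Qed.

Lemma iter_step n : iter n (lext step_op) 1 =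
  \sum_(j < r | (n <= j)%N) tilted_coef j *: tilted_vec (j - n)%N.
Proof.
rewrite {1}tilted_expand (iter_chain_sum step_tilted_vec0) //.
exact: step_tilted_vecS.
Qed.

Lemma iter_step_unipotent (T : {poly K} -> {poly K}) n :
  (forall u, T u = u + lext step_op u) ->
  iter n T 1 = \sum_(i < r)
    (\sum_(j < r | (i <= j)%N) 'C(n, j - i)%:R * tilted_coef j) *: tilted_vec i.
Proof.
move=> TE; rewrite {1}tilted_expand.
exact: (iter_unipotent_chain step_tilted_vec0 step_tilted_vecS).
Qed.

(** By duality [eta] vanishes on the earlier orbit vectors, so the correction first appears when the
    last one, of exponent [R.-1], is mapped. *)
Lemma iter_step_old n : (n < R)%N ->
  iter n (lext step_op) 1 = iter n (lext N) 1.
Proof.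
elim: n => [//|n IHn] nR; rewrite iterS IHn ?(ltnW nR) // step_supported ?(ltnW nR) //.
have -> : (n == R.-1) = false by lia.
by rewrite scale0r addr0.
Qed.

(** In the tilted chain the orbit of [1] is triangular with [b r.-1] on the diagonal: the iterate of
    exponent [r.-1 - j] has top index [j]. So every tilted vector is in the span; the fresh ones are
    untilted, and with them the tilt of the old ones can be undone. *)
Lemma cyclic_on_step : cyclic_on (s ++ c) step_op.
Proof.
have R0 := size_gt0.
have szr : size (s ++ c) = r by rewrite size_cat.
split; [by []|exact: supported_step_op| | |]; rewrite ?szr.
- case: cycN => _ _ s1 _ _; apply: supported_sub s1 => k ks.
  by rewrite mem_cat ks.
- by rewrite iter_step big_pred0 // => j; rewrite leqNgt ltn_ord.
pose W u := exists a : nat -> K,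
  u = \sum_(n < r) a n *: iter n (lext step_op) 1.
have WD u w : W u -> W w -> W (u + w).
  move=> [a ->] [a' ->]; exists (fun n => a n + a' n).
  by rewrite -big_split; apply: eq_bigr => n _; rewrite scalerDl.
have WZ x u : W u -> W (x *: u).
  move=> [a ->]; exists (fun n => x * a n).
  by rewrite scaler_sumr; apply: eq_bigr => n _; rewrite scalerA.
have W0 : W 0 by exists (fun _ => 0); rewrite big1 // => n _; rewrite scale0r.
have Wsum (I : Type) (l : seq I) (P : pred I) (f : I -> {poly K}) :
    (forall i, P i -> W (f i)) -> W (\sum_(i <- l | P i) f i).
  by move=> h; apply: (big_ind W).
have Wit n : (n < r)%N -> W (iter n (lext step_op) 1).
  move=> nr; exists (fun m => (m == n)%:R).
  rewrite (bigD1 (Ordinal nr)) //= eqxx scale1r big1 ?addr0 // => m mn.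
  by rewrite -val_eqE /= in mn; rewrite (negPf mn) scale0r.
have Wtilt j : (j < r)%N -> W (tilted_vec j).
  elim/ltn_ind: j => j IHj jr.
  have r1r : (r.-1 < r)%N by lia.
  have := iter_step (r.-1 - j); rewrite (bigD1 (Ordinal r1r)) /=; last by lia.
  rewrite subKn; last by lia.
  rewrite /tilted_coef; have -> : (r.-1 < R + R)%N = false by lia.
  move=> /esym/(canRL (addrK _))/(canRL (scalerK b_top)) ->; apply: (WZ).
  apply: (WD); first by apply: (Wit); lia.
  rewrite -scaleN1r; apply/WZ/Wsum => i /andP[ij ir]; apply/WZ/IHj.
    by move: ir; rewrite -val_eqE /=; have := ltn_ord i; lia.
  by have := ltn_ord i; lia.
have Whigh j : (R <= j)%N -> (j < r)%N -> W (chain_vec j).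
  move=> Rj jr; have := Wtilt j jr; rewrite /tilted_vec.
  by have -> : (j < R)%N = false by lia.
have Wshift n : (n < R)%N -> W (chain_shift n).
  by move=> nR; apply: (Wsum) => j Rj; apply/WZ/Whigh; have := ltn_ord j; lia.
have Wlow m : (m < R)%N -> W (iter m (lext N) 1).
  move=> mR; have jr : (R.-1 - m < r)%N by lia.
  have := Wtilt _ jr; rewrite /tilted_vec /chain_vec.
  have -> : (R.-1 - m < R)%N by lia.
  have -> : (R.-1 - (R.-1 - m))%N = m by lia.
  by move=> /WD /(_ (Wshift _ mR)); rewrite subrK.
move=> k; rewrite mem_cat => /orP[ks|kc].
  have [_ _ _ _ /(_ _ ks)[a ->]] := cycN.
  by apply: (Wsum) => n _; apply/WZ/Wlow.
have ic : (index k c < size c)%N by rewrite index_mem.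
have jr : (R + index k c < r)%N by rewrite ltn_add2l.
have := Whigh _ (leq_addr _ _) jr; rewrite /chain_vec ltnNge leq_addr /= addKn.
rewrite nth_index // => /(WZ (\prod_(i < (index k c).+1) rho i)).
rewrite scalerA mulfV ?scale1r //; apply/prodf_neq0 => i _; exact: rho_neq0.
Qed.

End ChainStep.

(** * Estimates for the chain step *)

Section SeminormTheory.
Variables (K : numFieldType) (V : lmodType K).
Implicit Types (p : seminorm V) (u w : V).

Lemma seminorm0 p : p 0 = 0.
Proof. by rewrite -(scale0r 0) seminormZ normr0 mul0r. Qed.

Lemma seminormN p u : p (- u) = p u.
Proof. by rewrite -scaleN1r seminormZ normrN1 mul1r. Qed.

Lemma seminormB p u w : p (u - w) <= p u + p w.
Proof. by rewrite (le_trans (seminormD _ _ _)) // seminormN. Qed.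

Lemma seminorm_tri p v u w : p (u - w) <= p (u - v) + p (v - w).
Proof. by rewrite -[X in p X](subrKA v) seminormD. Qed.

Lemma seminorm_sum p (I : Type) (r : seq I) (P : pred I) (f : I -> V) :
  p (\sum_(i <- r | P i) f i) <= \sum_(i <- r | P i) p (f i).
Proof.
elim/big_rec2: _ => [|i x y _ h]; first by rewrite seminorm0.
by rewrite (le_trans (seminormD _ _ _)) // lerD.
Qed.

Lemma seminorm_le0 p u : p u <= 0 -> p u = 0.
Proof. by move=> h; apply/eqP; rewrite eq_le h seminorm_ge0. Qed.

Lemma seminorm_sum0 p (I : Type) (r : seq I) (P : pred I) (f : I -> V) :
  (forall i, P i -> p (f i) = 0) -> p (\sum_(i <- r | P i) f i) = 0.
Proof.
by move=> h; apply: seminorm_le0; rewrite (le_trans (seminorm_sum _ _ _ _)) // big1.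
Qed.

Lemma seminormZ0 p a u : p u = 0 -> p (a *: u) = 0.
Proof. by move=> h; rewrite seminormZ h mulr0. Qed.

Lemma seminormD0 p u w : p u = 0 -> p w = 0 -> p (u + w) = 0.
Proof.
by move=> hu hw; apply: seminorm_le0; rewrite (le_trans (seminormD _ _ _)) // hu hw addr0.
Qed.

Lemma seminorm_incr (q : nat -> seminorm V) :
  (forall n u, q n u <= q n.+1 u) -> forall m n u, (m <= n)%N -> q m u <= q n u.
Proof.
move=> h m n u /subnK <-; elim: (n - m)%N => // k IHk.
exact: le_trans IHk (h _ _).
Qed.

Lemma seminorm_incr0 (q : nat -> seminorm V) :
  (forall n u, q n u <= q n.+1 u) ->
  forall m n u, (m <= n)%N -> q n u = 0 -> q m u = 0.
Proof.
move=> h m n u mn q0; apply: seminorm_le0; rewrite -q0; exact: seminorm_incr.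
Qed.

End SeminormTheory.

(** [K] may be [R[i]], with its partial order; positive elements are real and therefore
    comparable. *)
Lemma pos_lower_bound (K : numFieldType) (s : seq nat) (a : nat -> K) :
  (forall k, 0 < a k) -> exists2 d, 0 < d & forall k, k \in s -> d <= a k.
Proof.
move=> a0; elim: s => [|k s [d d0 ds]]; first by exists 1.
have [dk|kd] := real_leP (gtr0_real d0) (gtr0_real (a0 k)).
  by exists d => // i; rewrite inE => /orP[/eqP -> //|/ds].
exists (a k) => // i; rewrite inE => /orP[/eqP -> //|/ds].
exact/le_trans/ltW.
Qed.

Section AnalyticStep.
Variables (K : numFieldType) (q : nat -> seminorm {poly K}).
Variables (l : nat -> nat) (C : nat -> K).
Hypothesis q_incr : forall n u, q n u <= q n.+1 u.
Hypothesis C_ge0 : forall k, 0 <= C k.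
Hypothesis q_lt : forall k m, (m < l k)%N -> q m 'X^k = 0.

(* With [|u_k| <= C k * q (l k) u], an operator sending each ['X^k] to an
   [admissible] vector is continuous: the sum of the [C k * tol k] converges. *)
Definition tol k : K := (2 ^+ k * (C k + 1))^-1.

Lemma tol_gt0 k : 0 < tol k.
Proof. by rewrite invr_gt0 mulr_gt0 ?exprn_gt0 ?ltr0n // ltr_wpDl. Qed.

Definition admissible k (v : {poly K}) :=
  q k v <= tol k /\ forall m, (m.+1 < l k)%N -> q m v = 0.

(** Half of the tolerance goes to the unperturbed image of a link, the other half is left for
    [chain_shift 0]; the [+ 1] covers a vanishing seminorm. *)
Definition chain_weight (c : seq nat) i : K :=
  if i is j.+1 then
    tol (nth 0%N c i) / 2 / (q (nth 0%N c i) 'X^(nth 0%N c j) + 1)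
  else tol (nth 0%N c 0) / 2 / (q (nth 0%N c 0) 1 + 1).

Lemma chain_weight_gt0 c i : 0 < chain_weight c i.
Proof.
by case: i => [|i]; rewrite !divr_gt0 ?tol_gt0 ?ltr0n // ltr_wpDl ?seminorm_ge0.
Qed.

Lemma chain_weight_neq0 c i : chain_weight c i != 0.
Proof. by rewrite gt_eqF ?chain_weight_gt0. Qed.

Lemma chain_weightP (p : seminorm {poly K}) u (t : K) : 0 < t ->
  p ((t / 2 / (p u + 1)) *: u) <= t / 2.
Proof.
move=> t0; have p0 := seminorm_ge0 p u.
have p1 : 0 < p u + 1 by rewrite ltr_wpDl.
rewrite seminormZ ger0_norm ?divr_ge0 ?(ltW t0) ?ler0n ?(ltW p1) //.
rewrite mulrAC ler_pdivrMr // ler_wpM2l ?divr_ge0 ?(ltW t0) ?ler0n //.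
by rewrite lerDl.
Qed.

(** Each link is sent to a multiple of its predecessor, and [admissible] lets the level drop by at
    most one, so levels may rise by at most one per link. *)
Definition level_chain (c : seq nat) :=
  (l (nth 0 c 0) <= 1)%N /\
  forall i, (i.+1 < size c)%N -> (l (nth 0 c i.+1) <= (l (nth 0 c i)).+1)%N.

(** The shifts enter the new operator only at the finitely many indices of [s], multiplied by [eta],
    and at the first link. All are at most [M], so one bound on [q M] of the shifts is enough. *)
Lemma step_admissible (s c : seq nat) (N : nat -> {poly K}) (eta : nat -> K)
    (M : nat) : uniq (s ++ c) -> level_chain c -> (0 < size c)%N ->
  (forall k, k \in s -> (k <= M)%N) ->
  (forall k, k \in s -> (l k <= M)%N) -> (nth 0 c 0 <= M)%N ->
  exists2 d, 0 < d & forall b,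
    let A := chain_shift s c N (chain_weight c) b in
    (forall n, (n <= size s)%N -> q M (A n) <= d) ->
    (forall n k m, k \in s -> (n <= size s)%N -> (m.+1 < l k)%N -> q m (A n) = 0) ->
    (forall k, k \in s ->
       admissible k (step_op s c N (chain_weight c) b eta k - N k)) /\
    (forall k, k \in c -> admissible k (step_op s c N (chain_weight c) b eta k)).
Proof.
move=> usc [lc0 lcS] c0 sM lM c0M.
have [d1 d10 d1s] := @pos_lower_bound K s (fun k => tol k / (`|eta k| + 1))
   (fun k => divr_gt0 (tol_gt0 k) (ltr_wpDl (normr_ge0 _) ltr01)).
pose w0 := chain_weight c 0.
have w00 : 0 < w0 by exact: chain_weight_gt0.
have d20 : 0 < tol (nth 0%N c 0) / 2 / w0.
  by rewrite divr_gt0 // divr_gt0 ?tol_gt0 ?ltr0n.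
have [d d0 dle] : exists2 d, 0 < d & d <= d1 /\ d <= tol (nth 0%N c 0) / 2 / w0.
  have [le|lt] := real_leP (gtr0_real d10) (gtr0_real d20); first by exists d1.
  by exists (tol (nth 0%N c 0) / 2 / w0) => //; split => //; exact: ltW.
case: dle => dd1 dd2; exists d => // b A Ad Al; split=> k ks.
  rewrite /step_op ks addrC addKr; split; last first.
    by move=> m ml; apply: seminormZ0; apply: Al ks _ ml.
  have e0 : 0 < `|eta k| + 1 by rewrite ltr_wpDl.
  rewrite seminormZ; apply: (@le_trans _ _ ((`|eta k| + 1) * d1)).
    rewrite ler_pM ?seminorm_ge0 ?lerDl //.
    apply: (le_trans (seminorm_incr q_incr _ (sM _ ks))).
    by rewrite (le_trans (Ad _ _)).
  by rewrite mulrC -ler_pdivlMr // d1s.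
have ns : k \notin s.
  by move: usc; rewrite cat_uniq => /and3P[_ /hasPn /(_ _ ks)].
rewrite /step_op (negPf ns).
have kE : nth 0%N c (index k c) = k by rewrite nth_index.
have kc : (index k c < size c)%N by rewrite index_mem.
case E: (index k c) kE kc => [|i] kE kc; last first.
  split=> [|m ml].
    rewrite /chain_weight -kE.
    apply: (le_trans (chain_weightP _ _ (tol_gt0 _))).
    by rewrite ler_pdivrMr ?ltr0n // ler_peMr ?ler1n // ltW // tol_gt0.
  apply/seminormZ0/q_lt; rewrite -ltnS (leq_trans _ (lcS i _)) //.
  by rewrite kE.
split=> [|m]; last by rewrite -{1}kE => /leq_trans/(_ lc0).
rewrite -kE scalerBr (le_trans (seminormB _ _ _)) // [leRHS]splitr lerD //.
  exact: chain_weightP (tol_gt0 _).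
rewrite seminormZ ger0_norm ?(ltW w00) //.
rewrite mulrC -ler_pdivlMr // (le_trans _ dd2) //.
rewrite (le_trans _ (Ad 0%N _)) //; exact: seminorm_incr.
Qed.

End AnalyticStep.

(** * One stage: meeting a target by a chain step *)

Section Extension.
Variables (K : numFieldType) (q : nat -> seminorm {poly K}).
Variables (l : nat -> nat) (C : nat -> K).
Hypothesis q_incr : forall n u, q n u <= q n.+1 u.
Hypothesis C_ge0 : forall k, 0 <= C k.
Hypothesis q_lt : forall k m, (m < l k)%N -> q m 'X^k = 0.

Definition extends (s : seq nat) (N : nat -> {poly K})
    (s' : seq nat) (N' : nat -> {poly K}) : Prop :=
  [/\ cyclic_on s' N', (size s < size s')%N, {subset s <= s'},
      (forall n, (n < size s)%N -> iter n (lext N') 1 = iter n (lext N) 1) &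
      (forall k, k \in s -> admissible q l C k (N' k - N k)) /\
      (forall k, k \in s' -> k \notin s -> admissible q l C k (N' k))].

(** The order of the quantifiers matters: [eta] and [d] are fixed before [b], which is then free to
    aim at a target subject to the bound [d]. *)
Lemma step_extends (s c : seq nat) (N : nat -> {poly K}) (M : nat) :
  cyclic_on s N -> uniq (s ++ c) -> (size s + size s < size s + size c)%N ->
  level_chain l c ->
  (forall k, k \in s -> (k <= M)%N) ->
  (forall k, k \in s -> (l k <= M)%N) -> (nth 0 c 0 <= M)%N ->
  let rho := chain_weight q C c in
  exists eta d, [/\ 0 < d, forall m, (m < size s)%N ->
      \sum_(k <- s) (iter m (lext N) 1)`_k * eta k = (m == (size s).-1)%:R &
    forall b, let A := chain_shift s c N rho b in
    b (size s + size c).-1 != 0 ->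
    (forall n, (n <= size s)%N -> q M (A n) <= d) ->
    (forall n k m, k \in s -> (n <= size s)%N -> (m.+1 < l k)%N -> q m (A n) = 0) ->
    extends s N (s ++ c) (step_op s c N rho b eta)].
Proof.
move=> cN usc Rr lc sM lM c0M rho.
have [us sN s1 _ sp] := cN.
have yS n : supported s (iter n (lext N) 1).
  by elim: n => // n IHn; exact: supported_lext.
have [G hG] := spanning_dual us (fun n _ => yS n) sp.
pose eta := G (size s).-1.
have R0 := size_gt0 cN.
have etaP m : (m < size s)%N ->
    \sum_(k <- s) (iter m (lext N) 1)`_k * eta k = (m == (size s).-1)%:R.
  by move=> ms; apply: hG; rewrite ?prednK.
have c0 : (0 < size c)%N by lia.
have [d d0 hd] := step_admissible q_incr C_ge0 q_lt N eta usc lc c0 sM lM c0M.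
exists eta, d; split=> // b A btop Ad Al; split.
- by apply: cyclic_on_step => //; exact: chain_weight_neq0.
- by rewrite size_cat; lia.
- by move=> k ks; rewrite mem_cat ks.
- move=> n ns; apply: iter_step_old => //; exact: chain_weight_neq0.
have [h1 h2] := hd b Ad Al; split=> // k; rewrite mem_cat => /orP[->//|kc _].
exact: h2.
Qed.

Lemma cyclic_on_chain (s c : seq nat) N rho z : cyclic_on s N -> supported s z ->
  exists a : nat -> K, z = \sum_(i < size s) a i *: chain_vec s c N rho i.
Proof.
move=> cN sz; have [us sN s1 _ sp] := cN; have R0 := size_gt0 cN.
pose W u := exists a : nat -> K, u = \sum_(i < size s) a i *: chain_vec s c N rho i.
suff: forall k, k \in s -> W 'X^k.
  move=> h; rewrite (supportedE us sz) big_seq; apply: (big_ind W).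
  - by exists (fun _ => 0); rewrite big1 // => i _; rewrite scale0r.
  - move=> u w [a ->] [a' ->]; exists (fun n => a n + a' n).
    by rewrite -big_split; apply: eq_bigr => n _; rewrite scalerDl.
  - move=> k /h[a ->]; exists (fun n => z`_k * a n).
    by rewrite scaler_sumr; apply: eq_bigr => n _; rewrite scalerA.
move=> k /sp[a ->]; exists (fun i => a ((size s).-1 - i)%N).
rewrite (reindex_inj rev_ord_inj) /=; apply: eq_bigr => i _.
rewrite /chain_vec ltn_ord; have -> : (size s - i.+1 = (size s).-1 - i)%N by lia.
by [].
Qed.

Lemma maxn_bound (s : seq nat) (f : nat -> nat) :
  exists M, forall k, k \in s -> (f k <= M)%N.
Proof.
exists (\max_(k <- s) f k) => k ks.
by rewrite (big_rem _ ks) /= leq_maxl.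
Qed.

(** The target is met exactly modulo [ker (q M0)]. The far end of the climbing chain is killed by
    the seminorms up to [M], so the [b] can simply copy the coordinates of [z], whatever their
    size. *)
Lemma extend_levels (s : seq nat) (N : nat -> {poly K}) (i0 : nat) (z : {poly K})
    (M0 : nat) :
  (forall i n, exists2 k, (n <= k)%N & l k = i) ->
  cyclic_on s N -> supported s z ->
  exists s' N', [/\ extends s N s' N', i0 \in s' &
    exists2 n, (n < size s')%N & q M0 (iter n (lext N') 1 - z) = 0].
Proof.
move=> linf cN sz; have [us sN s1 _ sp] := cN.
have [Ms hMs] := maxn_bound s id.
have [Ml hMl] := maxn_bound s l.
have [phi hphi] : exists phi : nat -> nat,
    forall i, (maxn i0 Ms < phi i)%N /\ l (phi i) = i.
  suff: {f : nat -> nat & forall i, (maxn i0 Ms < f i)%N /\ l (f i) = i}.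
    by case=> f hf; exists f.
  apply: (@choice _ _ (fun i k => (maxn i0 Ms < k)%N /\ l k = i)) => i.
  by have [k ? ?] := linf i (maxn i0 Ms).+1; exists k.
(* A fresh index for each level; [i0], if still missing, is used at its own level so that the stages
   exhaust all indices. *)
pose cc i := if (i == l i0) && (i0 \notin s) then i0 else phi i.
have ccl i : l (cc i) = i.
  by rewrite /cc; case: ifP => [/andP[/eqP -> _]//|_]; have [] := hphi i.
have ccs i : cc i \notin s.
  rewrite /cc; case: ifP => [/andP[]//|_]; have [h _] := hphi i.
  apply/negP => /hMs; lia.
pose M := (M0 + Ms + Ml + l i0 + cc 0)%N.
pose R := size s.
(* Room for the level [l i0], and for a last index [r.-1] that lies beyond the window [[n, n + R)]
   and, lowered by [n], is still above [R + M]. *)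
pose m := (2 * R + 2 * M + 3)%N.
pose c := mkseq cc m.
have szc : size c = m by rewrite size_mkseq.
have cE i : (i < m)%N -> nth 0%N c i = cc i by move=> im; rewrite nth_mkseq.
have usc : uniq (s ++ c).
  rewrite cat_uniq us mkseq_uniq ?andbT /=; last first.
    by move=> i j /(congr1 l); rewrite !ccl.
  by apply/hasPn => _ /mapP[i _ ->]; exact: ccs.
have R0 : (0 < R)%N := size_gt0 cN.
have lc : level_chain l c.
  have m0 : (0 < m)%N by rewrite /m; lia.
  split=> [|i]; first by rewrite cE ?ccl.
  by rewrite szc => im; rewrite !cE ?ccl // ltnW.
have [||||eta [d [d0 etaP ext]]] := @step_extends s c N M cN usc _ lc.
- by rewrite szc; lia.
- by move=> k /hMs; rewrite /M; lia.
- by move=> k /hMl; rewrite /M; lia.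
- by rewrite cE /M; lia.
have [a za] := cyclic_on_chain c (chain_weight q C c) cN sz.
pose r := (R + m)%N.
(* The vectors [H j] with [R + M < j] vanish under [q M]; from [n] on, indices stay in that range
   after up to [R] shifts. *)
pose n := (2 * R + M + 1)%N.
pose b j := if j == r.-1 then 1 else if (n <= j < n + R)%N then a (j - n)%N else 0.
pose H := chain_vec s c N (chain_weight q C c).
pose A := chain_shift s c N (chain_weight q C c) b.
have Hlev j k : (k <= M)%N -> (R + M < j < r)%N -> q k (H j) = 0.
  move=> kM /andP[Mj jr]; rewrite /H /chain_vec -/R.
  have -> : (j < R)%N = false by lia.
  apply/seminormZ0/q_lt; rewrite cE; last by lia.
  by rewrite ccl; lia.
have Alev i k : (i <= R)%N -> (k <= M)%N -> q k (A i) = 0.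
  move=> iR kM; apply: seminorm_sum0 => j Rj.
  have jr : (j < r)%N by rewrite /r -szc; exact: ltn_ord.
  rewrite /b; case: eqP => [jE|_].
    by apply/seminormZ0/Hlev => //; move: jE; rewrite /r /m; lia.
  case: ifP => [nj|_]; last by rewrite scale0r seminorm0.
  by apply/seminormZ0/Hlev => //; rewrite /n in nj; lia.
exists (s ++ c), (step_op s c N (chain_weight q C c) b eta); split.
- apply: ext => [|i iR|i k k' ks iR kl].
  + by rewrite /b szc eqxx oner_neq0.
  + by rewrite Alev // ltW.
  + by rewrite Alev //; have := hMl _ ks; rewrite /M; lia.
- rewrite mem_cat; have [//|i0s] := boolP (i0 \in s).
  apply/orP; right; apply/mapP; exists (l i0); first by rewrite mem_iota; lia.
  by rewrite /cc eqxx i0s.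
exists n; first by rewrite size_cat szc -/R; lia.
have szr : (size s + size c = r)%N by rewrite szc.
have rho0 := chain_weight_neq0 q C_ge0 c.
have Rrm : (size s + size s < size s + size c)%N by rewrite szc -/R; lia.
have btop : b (size s + size c).-1 != 0 by rewrite szr /b eqxx oner_neq0.
rewrite iter_step // szr; pose F j := if (j < n + R)%N then b j *: H (j - n)%N else 0.
have -> : z = \sum_(j < r | (n <= j)%N) F j.
  rewrite -(big_geq_mkord n r predT F) (@big_cat_nat _ _ _ (n + R)) ?leq_addr //=; last first.
    by rewrite /n /r /m; lia.
  rewrite [X in _ + X]big_nat_cond [X in _ + X]big1 => [|j /andP[/andP[nRj _] _]].
    rewrite addr0 -{1}[n]add0n big_addn addKn big_mkord za.
    apply: eq_bigr => i _; rewrite /F.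
    have -> : (i + n < n + R)%N by rewrite addnC ltn_add2l.
    rewrite addnK /b; have -> : (i + n == r.-1)%N = false.
      by have := ltn_ord i; rewrite -/R /r /m /n; lia.
    have -> : (n <= i + n < n + R)%N.
      by rewrite leq_addl addnC ltn_add2l ltn_ord.
    by rewrite addnK.
  by rewrite /F ltnNge nRj.
rewrite -sumrB; apply: seminorm_sum0 => j nj.
have jr := ltn_ord j.
have -> : tilted_coef s b j = b j.
  by rewrite /tilted_coef -/R; have -> : (j < R + R)%N = false by rewrite /n in nj; lia.
rewrite /F; case: ltnP => jn; last first.
  rewrite subr0 /b; case: eqP => [jE|_]; last first.
    have -> : (n <= j < n + R)%N = false by lia.
    by rewrite scale0r seminorm0.
  rewrite scale1r /tilted_vec -/R.
  have -> : (j - n < R)%N = false by lia.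
  by apply: Hlev; rewrite ?/M; rewrite /n /r /m in jE jn *; lia.
rewrite -scalerBr; apply: seminormZ0; rewrite /tilted_vec -/R.
have -> : (j - n < R)%N by lia.
rewrite -/(H _) -/(A _) addrAC subrr add0r seminormN Alev //; first by lia.
by rewrite /M; lia.
Qed.

Lemma fresh_chain (s : seq nat) (i0 m : nat) : uniq s -> (0 < m)%N ->
  exists c : seq nat, [/\ uniq (s ++ c), size c = m & i0 \in s ++ c].
Proof.
move=> us m0; have [Ms hMs] := maxn_bound s id.
pose t k := iota (maxn i0 Ms).+1 k.
have ts k : ~~ has (mem s) (t k).
  by apply/hasPn => i; rewrite mem_iota => /andP[h _]; apply/negP => /hMs; lia.
have [i0s|i0s] := boolP (i0 \in s).
  exists (t m); rewrite mem_cat i0s size_iota; split=> //.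
  by rewrite cat_uniq us ts iota_uniq.
exists (i0 :: t m.-1); rewrite mem_cat mem_head orbT /= size_iota prednK //; split=> //.
rewrite cat_uniq us /= negb_or i0s ts iota_uniq !andbT mem_iota.
by rewrite negb_and -ltnNge ltnS leq_maxl.
Qed.

Lemma le_one_add3 (u v w : K) : 0 <= u -> 0 <= v -> 0 <= w ->
  let x := 1 + u + v + w in [/\ 1 <= x, u <= x, v <= x & w <= x].
Proof.
move=> u0 v0 w0 x; rewrite /x; split.
- by rewrite -!addrA lerDl !addr_ge0.
- by rewrite [1 + u]addrC -!addrA lerDl !addr_ge0.
- by rewrite [_ + v]addrC -!addrA lerDl !addr_ge0.
- by rewrite [_ + w]addrC lerDl !addr_ge0.
Qed.

(** Nothing is annihilated here: the [b] are small and a large exponent does the work. Their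
    smallness also keeps the orbit of the unipotent operator within [e] up to the exponent [n0]. *)
Lemma extend_norm (s : seq nat) (N : nat -> {poly K}) (i0 : nat) (z : {poly K})
    (M0 n0 : nat) (e : K) :
  (forall a : K, 0 <= a -> exists n, a <= n%:R) ->
  (forall k, l k = 0%N) ->
  cyclic_on s N -> supported s z -> 0 < e ->
  exists s' N', [/\ extends s N s' N', i0 \in s',
    exists n, q M0 (iter n (fun u => u + lext N' u) 1 - z) <= e &
    forall n, (n <= n0)%N -> q M0 (iter n (fun u => u + lext N' u) 1 -
                                  iter n (fun u => u + lext N u) 1) <= e].
Proof.
move=> archi l0 cN sz e0; have [us sN s1 NR sp] := cN.
pose R := size s; have R0 : (0 < R)%N := size_gt0 cN.
(* The chain then has [R + m = 4 * R] vectors: [binomial_steering] with parameter [R + R] takes the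
   first half as the fixed coordinates of [1] and the second half as the free [b]. *)
pose m := (R + R + R)%N.
have [c [usc szc i0c]] := @fresh_chain s i0 m us ltac:(rewrite /m; lia).
have [Ms hMs] := maxn_bound s id.
pose M := (M0 + Ms + nth 0 c 0)%N.
have lc : level_chain l c by split=> *; rewrite !l0.
have [||||eta [d [d0 etaP ext]]] := @step_extends s c N M cN usc _ lc.
- by rewrite szc -/R /m; lia.
- by move=> k /hMs; rewrite /M; lia.
- by move=> k _; rewrite l0.
- by rewrite /M; lia.
have [a za] := cyclic_on_chain c (chain_weight q C c) cN sz.
pose r := (R + m)%N.
have szr : (size s + size c = r)%N by rewrite szc.
pose H := chain_vec s c N (chain_weight q C c).
pose S := \sum_(n < R.+1) \sum_(j < r) q M (H (j - n)%N).
have S0 : 0 <= S by rewrite sumr_ge0 // => n _; rewrite sumr_ge0 // => j _; exact: seminorm_ge0.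
pose S1 := S + S *+ r.
have S10 : 0 <= S1 by rewrite addr_ge0 // mulrn_wge0.
have Ale b f n : (n <= R)%N -> (forall j, `|b j| <= f) ->
    q M (chain_shift s c N (chain_weight q C c) b n) <= f * S.
  move=> nR bf; rewrite /chain_shift szr -/H.
  have f0 : 0 <= f by exact: le_trans (bf 0%N).
  apply: (le_trans (seminorm_sum _ _ _ _)).
  apply: (@le_trans _ _ (\sum_(j < r) f * q M (H (j - n)%N))).
    rewrite [leLHS]big_mkcond ler_sum // => j _; case: ifP => _; last first.
      by rewrite mulr_ge0 ?seminorm_ge0.
    by rewrite seminormZ ler_wpM2r ?seminorm_ge0.
  rewrite -mulr_sumr ler_wpM2l // /S.
  have nR1 : (n < R.+1)%N by [].
  rewrite (bigD1 (Ordinal nR1)) //= lerDl sumr_ge0 // => i _.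
  by rewrite sumr_ge0 // => j _; rewrite seminorm_ge0.
(* Separates two errors: [E] for the coefficients and [f] for the tilts. It is used for the target
   and again for the old orbit points. *)
have est b f E (g gam : nat -> K) : (forall j, `|b j| <= f) -> f <= 1 ->
    (forall i, (i < r)%N -> `|gam i - (if (i < R)%N then g i else 0)| <= E) ->
    q M0 (\sum_(i < r) gam i *: tilted_vec s c N (chain_weight q C c) b i
          - \sum_(i < R) g i *: H i)
      <= E * S1 + f * ((\sum_(i < R) `|g i|) * S).
  move=> bf f1 gamE; have f0 : 0 <= f by exact: le_trans (bf 0%N).
  have E0 : 0 <= E by apply: (le_trans _ (gamE 0%N _)); rewrite /r ?addn_gt0 ?R0.
  pose g' i := if (i < R)%N then g i else 0.
  have Rr : (R <= r)%N by rewrite leq_addr.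
  have -> : \sum_(i < R) g i *: H i = \sum_(i < r) g' i *: H i.
    rewrite (big_ord_widen _ (fun i => g i *: H i) Rr) big_mkcond.
    by apply: eq_bigr => i _; rewrite /g'; case: ifP; rewrite ?scale0r.
  have -> : \sum_(i < R) `|g i| = \sum_(i < r) `|g' i|.
    rewrite (big_ord_widen _ (fun i => `|g i|) Rr) big_mkcond.
    by apply: eq_bigr => i _; rewrite /g'; case: ifP; rewrite ?normr0.
  set t := tilted_vec _ _ _ _ _.
  have tH i : q M (t i - H i) <= f * S.
    rewrite /t /tilted_vec -/R -/(H i); case: ifP => [iR|_]; last first.
      by rewrite subrr seminorm0 mulr_ge0.
    by rewrite addrAC subrr add0r seminormN Ale // (leq_trans (leq_subr _ _)) ?leq_pred.
  have M0M u : q M0 u <= q M u by apply: seminorm_incr; rewrite // /M -addnA leq_addr.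
  have -> : \sum_(i < r) gam i *: t i - \sum_(i < r) g' i *: H i =
      \sum_(i < r) (gam i - g' i) *: t i + \sum_(i < r) g' i *: (t i - H i).
    rewrite -sumrB -big_split; apply: eq_bigr => i _ /=.
    by rewrite scalerBl scalerBr addrA subrK.
  apply: (le_trans (seminormD _ _ _)); apply: lerD; last first.
    apply: (le_trans (seminorm_sum _ _ _ _)).
    rewrite mulrCA mulr_suml ler_sum // => i _; rewrite seminormZ ler_wpM2l //.
    exact: le_trans (M0M _) (tH _).
  apply: (le_trans (seminorm_sum _ _ _ _)).
  apply: (@le_trans _ _ (\sum_(i < r) E * (q M (H i) + S))).
    apply: ler_sum => i _; rewrite seminormZ ler_pM ?seminorm_ge0 //.
      exact: gamE.
    rewrite (le_trans (M0M _)) // -[t i](subrKC (H i)).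
    rewrite (le_trans (seminormD _ _ _)) // lerD // (le_trans (tH i)) //.
    by rewrite ler_piMl.
  rewrite -mulr_sumr ler_wpM2l // big_split /= sumr_const card_ord lerD //.
  rewrite /S (bigD1 ord0) //=.
  under [X in _ <= X + _]eq_bigr do rewrite subn0.
  rewrite lerDl sumr_ge0 // => i _.
  by rewrite sumr_ge0 // => j _; rewrite seminorm_ge0.
pose Z := (\sum_(i < R) `|a i|) * S.
have Z0 : 0 <= Z by apply: mulr_ge0 => //; rewrite sumr_ge0.
pose B : K := \sum_(n < n0.+1) \sum_(k < r) 'C(n, k)%:R.
have B0 : 0 <= B.
  by rewrite sumr_ge0 // => n _; rewrite sumr_ge0 //.
have binB n k : (n <= n0)%N -> (k < r)%N -> 'C(n, k)%:R <= B.
  move=> nn0 kr; have nn1 : (n < n0.+1)%N by [].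
  rewrite /B (bigD1 (Ordinal nn1)) //= (bigD1 (Ordinal kr)) //= -addrA lerDl.
  by rewrite addr_ge0 ?sumr_ge0 // => *; rewrite ?sumr_ge0.
pose Y := (B *+ r) * S1 + (B *+ R) * S.
have Y0 : 0 <= Y.
  by apply: addr_ge0; apply: mulr_ge0 => //; apply: mulrn_wge0; exact: B0.
(* The inverse of [x] meets at once the bound [d] on the shifts, the error [e] at the target and the
   error [e] for exponents up to [n0]; the summand [1] gives [f <= 1]. *)
pose x := 1 + S / d + (S1 + Z) / e + Y / e.
have xS0 : 0 <= S / d by rewrite divr_ge0 // ltW.
have xZ0 : 0 <= (S1 + Z) / e by apply: divr_ge0; [exact: addr_ge0|exact: ltW].
have xY0 : 0 <= Y / e by rewrite divr_ge0 // ltW.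
have [x1 xS xZ xY] : [/\ 1 <= x, S / d <= x, (S1 + Z) / e <= x & Y / e <= x].
  exact: le_one_add3.
have x0 : 0 < x by rewrite (lt_le_trans ltr01).
pose f := x^-1; have f0 : 0 < f by rewrite invr_gt0.
have f1 : f <= 1 by rewrite invf_le1.
have fle y t : 0 < t -> y / t <= x -> f * y <= t.
  by move=> t0 yt; rewrite /f mulrC ler_pdivrMr // mulrC -ler_pdivrMr.
have [n [b [bf btop bn]]] := @binomial_steering K archi (R + R) (fun j => (j == R.-1)%:R)
  (fun i => if (i < R)%N then a i else 0) f ltac:(by rewrite addn_gt0 R0) f0.
have rE : (r = R + R + (R + R))%N by rewrite /r /m !addnA.
rewrite -rE in btop bn.
have btop' : b (size s + size c).-1 != 0 by rewrite szr.
have extb := ext b btop' (fun i iR => le_trans (Ale b f i iR bf) (fle _ _ d0 xS)).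
have rho0 := chain_weight_neq0 q C_ge0 c.
have Rrm : (size s + size s < size s + size c)%N.
  by rewrite szc -/R ltn_add2l /m -addnA -[X in (X < _)%N]addn0 ltn_add2l addn_gt0 R0.
pose N' := step_op s c N (chain_weight q C c) b eta.
pose gam k i : K :=
  \sum_(j < r | (i <= j)%N) 'C(k, j - i)%:R * tilted_coef s b j.
have uni k : iter k (fun u => u + lext N' u) 1 =
    \sum_(i < r) gam k i *: tilted_vec s c N (chain_weight q C c) b i.
  have := @iter_step_unipotent _ s c N _ b eta cN usc rho0 Rrm btop' etaP
    (fun u => u + lext N' u) k (fun u => erefl).
  by rewrite szr.
exists (s ++ c), N'; split=> //.
- by apply: extb => i k j _ _; rewrite l0.
- exists n; rewrite uni {1}za -/H.
  apply: (le_trans (est b f f a (gam n) bf f1 _)); last first.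
    by rewrite -mulrDr -/Z; exact: fle xZ.
  move=> i ir; have := bn i ir; congr (`|_ - _| <= _).
  case: (ltnP i R) => [iR|Ri]; first by rewrite ltn_addr.
  by case: ifP.
move=> n' nn0; rewrite uni.
pose g i : K := \sum_(j < R | (i <= j)%N) 'C(n', j - i)%:R * (j == R.-1 :> nat)%:R.
have -> : iter n' (fun u => u + lext N u) 1 = \sum_(i < R) g i *: H i.
  have R1 : (R.-1 < R)%N by rewrite prednK.
  have {1}-> : 1 = \sum_(j < R) (j == R.-1 :> nat)%:R *: H j.
    rewrite (bigD1 (Ordinal R1)) //= eqxx scale1r big1 ?addr0.
      by rewrite /H /chain_vec -/R R1 subnn.
    by move=> j; rewrite -val_eqE /= => /negPf ->; rewrite scale0r.
  have HL0 : lext N (H 0) = 0 by rewrite /H /chain_vec -/R R0 subn0 -iterS prednK.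
  have HLS j : (j.+1 < R)%N -> lext N (H j.+1) = H j.
    move=> jR; rewrite /H /chain_vec -/R jR (ltnW jR).
    have -> : (R.-1 - j = (R.-1 - j.+1).+1)%N.
      by rewrite [in RHS]subnS prednK // subn_gt0 -ltnS prednK.
    by rewrite iterS.
  exact: (iter_unipotent_chain HL0 HLS n' (fun j => (j == R.-1)%:R) (fun u => erefl)).
apply: (le_trans (est b f (f * (B *+ r)) g (gam n') bf f1 _)).
  move=> i ir.
  have -> : (if (i < R)%N then g i else 0) = \sum_(j < r | (i <= j)%N)
      'C(n', j - i)%:R * (if (j < R + R)%N then (j == R.-1 :> nat)%:R else 0).
    have jR (j : nat) : (R <= j)%N -> (j == R.-1) = false.
      by move=> Rj; rewrite gtn_eqF // (leq_trans _ Rj) // prednK.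
    case: ltnP => [iR|Ri].
      have Rr : (R <= r)%N by rewrite leq_addr.
      rewrite /g (big_ord_widen_cond _ (fun j => (i <= j)%N)
        (fun j => 'C(n', j - i)%:R * (j == R.-1)%:R) Rr).
      rewrite big_mkcond [RHS]big_mkcond; apply: eq_bigr => j _.
      case: (leqP i j) => //= ij; case: ltnP => Rj; first by rewrite ltn_addr.
      by rewrite jR //; case: ifP; rewrite mulr0.
    rewrite big1 // => j ij; rewrite jR ?(leq_trans Ri) //.
    by case: ifP; rewrite mulr0.
  rewrite -sumrB; apply: (le_trans (ler_norm_sum _ _ _)).
  rewrite -[in leRHS](card_ord r) -sumr_const mulr_sumr [leLHS]big_mkcond.
  apply: ler_sum => j _; case: ifP => ij; last by rewrite mulr_ge0 // ltW.
  rewrite -mulrBr normrM normr_nat mulrC ler_pM //.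
    rewrite /tilted_coef -/R; case: ifP => _; first by rewrite subrr normr0 ltW.
    by rewrite subr0.
  by apply: binB => //; apply: leq_ltn_trans (leq_subr _ _) (ltn_ord j).
apply: (@le_trans _ _ (f * Y)); last exact: fle xY.
rewrite [leRHS]mulrDr; apply: lerD; first by rewrite mulrA.
rewrite ler_wpM2l ?(ltW f0) // ler_wpM2r //.
rewrite -[in leRHS](card_ord R) -sumr_const ler_sum // => i _.
have R1 : (R.-1 < R)%N by rewrite prednK.
have iR : (i <= R.-1)%N by rewrite -ltnS prednK.
rewrite /g (bigD1 (Ordinal R1)) //= big1 ?addr0 => [|j /andP[_]]; last first.
  by rewrite -val_eqE /= => /negPf ->; rewrite mulr0.
rewrite eqxx mulr1 normr_nat binB // (leq_ltn_trans (leq_subr _ _)) //.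
by rewrite (leq_trans R1) // leq_addr.
Qed.

End Extension.

(** * Passage to the limit *)

Lemma injective_unbounded (f : nat -> nat) : injective f ->
  forall B, exists t, (B <= f t)%N.
Proof.
move=> fI B; apply: contrapT => /forallNP h.
have := @uniq_leq_size _ (mkseq f B.+1) (iota 0 B).
rewrite mkseq_uniq // size_mkseq size_iota ltnn => H; suff: false by [].
apply: H => // _ /mapP[t _ ->]; rewrite mem_iota /= add0n ltnNge.
exact/negP/h.
Qed.

Section SpanSeq.
Variables (K : numFieldType) (V : lmodType K).
Implicit Types (x : nat -> V) (u w : V).

Definition in_span x u := exists m (a : nat -> K), u = \sum_(n < m) a n *: x n.

Definition total_family x := forall u, in_span x u.

Lemma in_span_sum_le x m (a : nat -> K) n : (m <= n)%N ->
  \sum_(k < m) a k *: x k = \sum_(k < n) (if (k < m)%N then a k else 0) *: x k.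
Proof.
move=> mn; rewrite (big_ord_widen _ (fun k => a k *: x k) mn) big_mkcond.
by apply: eq_bigr => k _; case: ifP => // _; rewrite scale0r.
Qed.

Lemma in_span0 x : in_span x 0.
Proof. by exists 0%N, (fun _ => 0); rewrite big_ord0. Qed.

Lemma in_spanD x u w : in_span x u -> in_span x w -> in_span x (u + w).
Proof.
move=> [m [a ->]] [n [b ->]]; exists (maxn m n).
rewrite (in_span_sum_le x a (leq_maxl m n)) (in_span_sum_le x b (leq_maxr m n)).
exists (fun k => (if (k < m)%N then a k else 0) + (if (k < n)%N then b k else 0)).
by rewrite -big_split; apply: eq_bigr => k _; rewrite scalerDl.
Qed.

Lemma in_spanZ x c u : in_span x u -> in_span x (c *: u).
Proof.
move=> [m [a ->]]; exists m, (fun k => c * a k).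
by rewrite scaler_sumr; apply: eq_bigr => k _; rewrite scalerA.
Qed.

Lemma in_spanB x u w : in_span x u -> in_span x w -> in_span x (u - w).
Proof. by move=> hu hw; rewrite -scaleN1r; apply/in_spanD/in_spanZ. Qed.

Lemma in_span_sum x (I : Type) (r : seq I) (P : pred I) (f : I -> V) :
  (forall i, P i -> in_span x (f i)) -> in_span x (\sum_(i <- r | P i) f i).
Proof.
by move=> h; apply: (big_ind (in_span x)) => //; [exact: in_span0|exact: in_spanD].
Qed.

Lemma in_span_mem x n : in_span x (x n).
Proof.
exists n.+1, (fun k => (k == n)%:R).
rewrite big_ord_recr /= eqxx scale1r big1 ?add0r // => k _.
by rewrite ltn_eqF // scale0r.
Qed.

Lemma in_span_iter (T : {linear V -> V}) v u :
  in_span (fun n => iter n T v) u -> in_span (fun n => iter n T v) (T u).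
Proof.
move=> [m [a ->]]; rewrite linear_sum; apply: in_span_sum => n _.
rewrite linearZ; apply: in_spanZ; exact: (in_span_mem (fun n => iter n T v) n.+1).
Qed.

End SpanSeq.

(** Continuity, hypercyclicity and spanning in terms of seminorms alone, so that they can be
    transported to [{poly K}], which carries no topology here. *)
Definition strongly_cyclic (K : numFieldType) (V : lmodType K)
    (q : nat -> seminorm V) : Prop :=
  exists (T : {linear V -> V}) (x : V),
    [/\ forall n, exists m c, forall u, q n (T u) <= c * q m u,
        forall z M e, 0 < e -> exists n, q M (iter n T x - z) <= e &
        total_family (fun n => iter n T x)].

(** Enumerates words over the dense sequence, each with every tag [t]. The tags make a good
    approximation recur at arbitrarily late [i], when its degree is small enough for [z i] to be
    supported on stage [i]. *)
Lemma dense_targets (K : numFieldType) (q : nat -> seminorm {poly K})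
    (d : nat -> K) : (forall x e, 0 < e -> exists n, `|x - d n| <= e) ->
  exists z : nat -> {poly K}, forall u M B e, 0 < e ->
    exists2 i, (B <= i)%N & (size (z i) <= i)%N /\ q M (z i - u) <= e.
Proof.
move=> hd.
pose dec (w : seq nat) : {poly K} := \poly_(j < size w) d (nth 0%N w j).
exists (fun i => if unpickle i is Some (w, t) then dec (w, t : nat).1 else 0).
move=> u M B e e0.
pose Q := \sum_(j < size u) q M 'X^j.
have Q0 : 0 <= Q by rewrite sumr_ge0 // => j _; rewrite seminorm_ge0.
have e'0 : 0 < e / (1 + Q) by rewrite divr_gt0 // ltr_pwDl.
have [w hw] : exists w : nat -> nat, forall j, `|u`_j - d (w j)| <= e / (1 + Q).
  have [w hw] := choice (fun j => hd u`_j _ e'0); by exists w.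
pose W := mkseq w (size u).
have [t ht] : exists t : nat, (maxn B (size u) <= pickle (W, t))%N.
  apply: (@injective_unbounded (fun t : nat => pickle (W, t))) => t t'.
  by move=> /(pcan_inj pickleK) [].
exists (pickle (W, t)); first by rewrite (leq_trans _ ht) // leq_maxl.
rewrite pickleK /=; split.
  rewrite (leq_trans (size_poly _ _)) // size_mkseq (leq_trans _ ht) //.
  by rewrite leq_maxr.
have -> : dec W - u = \sum_(j < size u) (d (w j) - u`_j) *: 'X^j.
  rewrite -{1}[u]coefK /dec size_mkseq !poly_def -sumrB.
  by apply: eq_bigr => j _; rewrite scalerBl nth_mkseq.
apply: (le_trans (seminorm_sum _ _ _ _)).
apply: (@le_trans _ _ (e / (1 + Q) * Q)).
  rewrite mulr_sumr ler_sum // => j _.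
  by rewrite seminormZ ler_wpM2r ?seminorm_ge0 // distrC.
rewrite mulrAC ler_pdivrMr ?ltr_pwDl // ler_wpM2l ?(ltW e0) // lerDr //.
Qed.

Lemma sequential_choice (X : Type) (R : nat -> X -> X -> Prop) (x0 : X) :
  (forall n x, exists y, R n x y) ->
  exists f : nat -> X, f 0%N = x0 /\ forall n, R n (f n) (f n.+1).
Proof.
move=> h; have [F hF] := choice (fun p : nat * X => h p.1 p.2).
pose f := fix f n := if n is m.+1 then F (m, f m) else x0.
by exists f; split=> // n; exact: (hF (n, f n)).
Qed.

Section Limit.
Variables (K : numFieldType) (q : nat -> seminorm {poly K}).
Variables (l : nat -> nat) (C : nat -> K).
Hypothesis q_incr : forall n u, q n u <= q n.+1 u.
Hypothesis C_ge0 : forall k, 0 <= C k.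
Hypothesis coef_le : forall k (u : {poly K}), `|u`_k| <= C k * q (l k) u.

Variables (S : nat -> seq nat) (Ns : nat -> nat -> {poly K}).
Hypothesis ext : forall i, extends q l C (S i) (Ns i) (S i.+1) (Ns i.+1).
Hypothesis cyc0 : cyclic_on (S 0) (Ns 0).
Hypothesis S_mem : forall i, i \in S i.+1.
Hypothesis adm0 : forall k, k \in S 0 -> admissible q l C k (Ns 0 k).

(** [k] has entered by stage [k.+1], and its image is final one stage after its entry. *)
Definition limit_op k := Ns k.+2 k.

Let cyc i : cyclic_on (S i) (Ns i).
Proof. by case: i => // i; have [] := ext i. Qed.

Let S_sub i j : (i <= j)%N -> {subset S i <= S j}.
Proof.
move=> /subnK <-; elim: (j - i)%N => // n IHn k /IHn.
by have [_ _ h _ _] := ext (n + i); exact: h.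
Qed.

Let S_size i j : (i <= j)%N -> (size (S i) + (j - i) <= size (S j))%N.
Proof.
move=> ij; rewrite -{2}(subnK ij); elim: (j - i)%N => [|n IHn]; first by rewrite addn0.
by rewrite addnS (leq_ltn_trans IHn) //; have [_ h _ _ _] := ext (n + i).
Qed.

Let iter_agree i j n : (i <= j)%N -> (n < size (S i))%N ->
  iter n (lext (Ns j)) 1 = iter n (lext (Ns i)) 1.
Proof.
move=> ij nS; rewrite -(subnK ij); elim: (j - i)%N => // m IHm.
rewrite -IHm; have [_ _ _ h _] := ext (m + i); apply: h.
by rewrite (leq_trans nS) // (leq_trans _ (S_size (leq_addl m i))) // leq_addr.
Qed.

(** ['X^k] is a combination of the first [size (S i)] orbit vectors. Its image involves the next one
    as well, and this one is frozen from stage [i.+1] on because the sizes grow strictly. *)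
Lemma stage_stable i j k : (i < j)%N -> k \in S i -> Ns j k = Ns i.+1 k.
Proof.
move=> ij ki; have [_ _ _ _ /(_ k ki)[a ak]] := cyc i.
have sz : (size (S i) < size (S i.+1))%N by have [] := ext i.
have E m : (i < m)%N -> Ns m k =
    \sum_(n < size (S i)) a n *: iter n.+1 (lext (Ns i.+1)) 1.
  move=> im; rewrite -lextX ak linear_sum; apply: eq_bigr => n _.
  rewrite linearZ /=; congr (_ *: _).
  rewrite -(iter_agree (ltnW im) (ltn_ord n)) -iterS.
  by apply: iter_agree => //; apply: leq_trans sz; rewrite ltnS ltn_ord.
by rewrite E // (E i.+1).
Qed.

Lemma limit_opE i k : k \in S i -> limit_op k = Ns i.+1 k.
Proof.
move=> ki; rewrite /limit_op; have kk := S_mem k.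
have [ik|ki1] := leqP i k.+1; first by rewrite (stage_stable _ ki).
by rewrite (@stage_stable k.+1 i.+1 k) // ltnW.
Qed.

Lemma iter_limit i n : (n < size (S i))%N ->
  iter n (lext limit_op) 1 = iter n (lext (Ns i)) 1.
Proof.
have [uS sN s1 _ _] := cyc i.
elim: n => // n IHn nS; rewrite iterS IHn ?(ltnW nS) //.
have sup : supported (S i) (iter n (lext (Ns i)) 1).
  by elim: (n) => // m IHm; exact: supported_lext.
rewrite (lext_supported_eq uS sup (@limit_opE i)).
rewrite -(iter_agree (leqnSn i)) ?(ltnW nS) // -iterS.
exact: iter_agree.
Qed.

Lemma total_limit : total_family (fun n => iter n (lext limit_op) 1).
Proof.
move=> u; pose i := size u.
have su : supported (S i) u.
  move=> k kS; apply: nth_default; rewrite leqNgt; apply/negP => ku.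
  by move/negP: kS; apply; exact: S_sub (S_mem k).
have [uS _ _ _ sp] := cyc i.
have [a ha] := cyclic_on_chain [::] (fun _ => 1) (cyc i) su.
exists (size (S i)), (fun n => a ((size (S i)).-1 - n)%N).
rewrite {1}ha (reindex_inj rev_ord_inj) /=; apply: eq_bigr => n _.
rewrite (iter_limit (i := i)) // /chain_vec.
have nS := ltn_ord n; rewrite ltn_subrL (leq_ltn_trans _ nS) //=.
have e1 : (size (S i) - n.+1 = (size (S i)).-1 - n)%N by rewrite subnS -subn1 subnAC subn1.
rewrite e1; congr (_ *: iter _ _ _); rewrite subKn // -ltnS prednK //.
exact: leq_ltn_trans nS.
Qed.

(** An image is chosen when its index enters and corrected only once, whence the factor [2]. *)
Lemma limit_op_small k : q k (limit_op k) <= tol C k * 2 /\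
  forall m, (m.+1 < l k)%N -> q m (limit_op k) = 0.
Proof.
have ex : exists i, k \in S i by exists k.+1.
case: (ex_minnP ex) => i ki imin.
have hN : admissible q l C k (Ns i k).
  case: i ki imin => [|i] ki imin; first exact: adm0.
  have [_ _ _ _ [_ h]] := ext i; apply: h => //.
  by apply/negP => /imin; rewrite ltnn.
have [_ _ _ _ [/(_ k ki) [h1 h2] _]] := ext i.
rewrite (limit_opE ki) -(subrK (Ns i k) (Ns i.+1 k)).
case: hN => h3 h4; split.
  by rewrite (le_trans (seminormD _ _ _)) // mulr_natr mulr2n lerD.
by move=> m ml; apply: seminormD0; [exact: h2|exact: h4].
Qed.

(** Levels drop by at most one, so coordinates of level above [n.+1] do not contribute to [q n]. For
    [k >= n] the choice of [tol] leaves at most [2 / 2 ^ k], of total at most [4]; the finitely many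
    [k < n] are bounded directly. *)
Lemma limit_op_continuous n :
  exists c, forall u, q n (lext limit_op u) <= c * q n.+1 u.
Proof.
pose b k := if (k < n)%N then C k * q n (limit_op k) else 0.
exists (\sum_(k < n) b k + 4) => u.
have term k : `|u`_k| * q n (limit_op k) <=
    (b k + 2 / 2 ^+ k) * q n.+1 u.
  have [ln|nl] := leqP (l k) n.+1; last first.
    have [_ ->] := limit_op_small k; rewrite // mulr0 mulr_ge0 ?seminorm_ge0 //.
    rewrite addr_ge0 ?divr_ge0 ?exprn_ge0 ?ler0n // /b.
    by case: ifP => // _; rewrite mulr_ge0 ?seminorm_ge0.
  have uk : `|u`_k| <= C k * q n.+1 u.
    by rewrite (le_trans (coef_le _ _)) // ler_wpM2l // seminorm_incr.
  apply: (le_trans (ler_wpM2r (seminorm_ge0 _ _) uk)).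
  rewrite mulrAC ler_wpM2r ?seminorm_ge0 // /b; case: ltnP => kn.
    by rewrite lerDl divr_ge0 ?exprn_ge0 ?ler0n.
  rewrite add0r.
  have [h _] := limit_op_small k.
  apply: (le_trans (ler_wpM2l (C_ge0 k) (le_trans (seminorm_incr q_incr _ kn) h))).
  have C1 : 0 < C k + 1 by rewrite ltr_wpDl.
  have k2 : 0 < 2 ^+ k :> K by rewrite exprn_gt0 ?ltr0n.
  rewrite mulrA [leRHS]mulrC ler_wpM2r ?ler0n // /tol invfM mulrCA.
  by rewrite ger_pMr ?invr_gt0 // ler_pdivrMr // mul1r lerDl.
apply: (le_trans (seminorm_sum _ _ _ _)).
apply: (@le_trans _ _ (\sum_(k < size u) (b k + 2 / 2 ^+ k) * q n.+1 u)).
  by apply: ler_sum => k _; rewrite seminormZ term.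
rewrite -mulr_suml ler_wpM2r ?seminorm_ge0 // big_split /= lerD //.
  have b0 k : 0 <= b k.
    by rewrite /b; case: ifP => // _; rewrite mulr_ge0 ?seminorm_ge0.
  have h m : \sum_(k < m) b k <= \sum_(k < n) b k.
    elim: m => [|m IHm]; first by rewrite big_ord0 sumr_ge0.
    have [mn|nm] := ltnP m n; last by rewrite big_ord_recr /= {2}/b ltnNge nm addr0.
    rewrite (big_ord_widen _ b mn) [leRHS](bigID (fun k : 'I_n => (k < m.+1)%N)) /=.
    by rewrite lerDl sumr_ge0.
  exact: h.
have h m : \sum_(k < m) 2 / 2 ^+ k = 4 - 4 / 2 ^+ m :> K.
  elim: m => [|m IHm]; first by rewrite big_ord0 expr0 divr1 subrr.
  rewrite big_ord_recr /= IHm exprS; field.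
  by rewrite expf_neq0 // pnatr_eq0.
by rewrite h lerBlDr lerDl divr_ge0 ?exprn_ge0 ?ler0n.
Qed.

End Limit.

(** * Running all stages *)

Section StronglyCyclic.
Variables (K : numFieldType) (q : nat -> seminorm {poly K}).
Variables (l : nat -> nat) (C : nat -> K).
Hypothesis archi : forall a : K, 0 <= a -> exists n, a <= n%:R.
Hypothesis separable : exists d : nat -> K,
  forall x e, 0 < e -> exists n, `|x - d n| <= e.
Hypothesis q_incr : forall n u, q n u <= q n.+1 u.
Hypothesis C_ge0 : forall k, 0 <= C k.
Hypothesis coef_le : forall k (u : {poly K}), `|u`_k| <= C k * q (l k) u.
Hypothesis q_lt : forall k m, (m < l k)%N -> q m 'X^k = 0.

Let stage := {sN : seq nat * (nat -> {poly K}) * nat | cyclic_on sN.1.1 sN.1.2}.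
Let idx (st : stage) := (sval st).1.1.
Let op (st : stage) := (sval st).1.2.

Lemma cyclic_on0 : cyclic_on [:: 0%N] (fun _ => 0 : {poly K}).
Proof.
split=> //.
- by move=> k _ i _; rewrite coef0.
- by move=> k; rewrite coef1 inE => /negPf ->.
- by rewrite /= /lext big1 // => k _; rewrite scaler0.
move=> k; rewrite inE => /eqP ->; exists (fun _ => 1).
by rewrite big_ord1 scale1r.
Qed.

Let st0 : stage := exist _ ([:: 0%N], fun _ => 0, 0%N) cyclic_on0.

Let adm0 k : admissible q l C k (op st0 k).
Proof. by split=> [|m _]; rewrite seminorm0 // ltW // tol_gt0. Qed.

Let supported_small (S : nat -> seq nat) (u : {poly K}) i :
  (forall j, j \in S j.+1) -> (forall j, {subset S j <= S j.+1}) ->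
  (size u <= i)%N -> supported (S i) u.
Proof.
move=> Sm Ss ui k kS; apply: nth_default; apply: (leq_trans ui).
rewrite leqNgt; apply/negP => ki; move/negP: kS; apply.
rewrite -(subnK ki); elim: (i - k.+1)%N => // n IHn; exact: Ss.
Qed.

Lemma strongly_cyclic_levels :
  (forall i n, exists2 k, (n <= k)%N & l k = i) -> strongly_cyclic q.
Proof.
move=> linf; have [d hd] := separable; have [z hz] := dense_targets q hd.
pose R i (st st' : stage) :=
  [/\ extends q l C (idx st) (op st) (idx st') (op st'), i \in idx st' &
    supported (idx st) (z i) -> exists2 n, (n < size (idx st'))%N &
      q i (iter n (lext (op st')) 1 - z i) = 0].
have [f [f0 fR]] : exists f : nat -> stage,
    f 0%N = st0 /\ forall n, R n (f n) (f n.+1).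
  apply: sequential_choice => i [[[s N] nu] /= cN].
  have [sz|nsz] := pselect (supported s (z i)).
    have [s' [N' [ex is' hn]]] := extend_levels q_incr C_ge0 q_lt i i linf cN sz.
    by have [cN' _ _ _ _] := ex; exists (exist _ (s', N', 0%N) cN').
  have [|s' [N' [ex is' hn]]] := @extend_levels _ q l C q_incr C_ge0 q_lt s N i 0 i linf cN.
    by move=> k _; rewrite coef0.
  by have [cN' _ _ _ _] := ex; exists (exist _ (s', N', 0%N) cN').
pose S i := idx (f i); pose Ns i := op (f i).
have ext i : extends q l C (S i) (Ns i) (S i.+1) (Ns i.+1) by have [] := fR i.
have cyc0 : cyclic_on (S 0%N) (Ns 0%N) by rewrite /S /Ns f0; exact: cyclic_on0.
have Sm i : i \in S i.+1 by have [] := fR i.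
have ad0 k : k \in S 0%N -> admissible q l C k (Ns 0%N k).
  by move=> _; rewrite /Ns f0; exact: adm0.
have Ss i : {subset S i <= S i.+1} by have [] := ext i.
exists (lext (limit_op Ns)), 1; split.
- move=> n; have [c hc] := limit_op_continuous q_incr C_ge0 coef_le ext cyc0 Sm ad0 n.
  by exists n.+1, c.
- move=> u M e e0; have [i Mi [zi zu]] := hz u M M e e0.
  have [_ _ /(_ (supported_small Sm Ss zi))[n nS hn]] := fR i.
  exists n; rewrite (iter_limit ext cyc0 Sm nS).
  apply: (le_trans (seminorm_tri _ (z i) _ _)).
  rewrite (@seminorm_incr0 _ _ q q_incr M i _ Mi) ?add0r //.
exact: total_limit ext cyc0 Sm.
Qed.

(** In the expansion of [(1 + L) ^ n] only the [L ^ k x] with [k <= n] occur. *)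
Lemma iter_unipotent_agree (L L' : {linear {poly K} -> {poly K}}) x n :
  (forall k, (k <= n)%N -> iter k L x = iter k L' x) ->
  iter n (fun u => u + L u) x = iter n (fun u => u + L' u) x.
Proof.
have itD (A : {linear {poly K} -> {poly K}}) m u w :
    iter m (fun v => v + A v) (u + w) =
    iter m (fun v => v + A v) u + iter m (fun v => v + A v) w.
  by elim: m => //= m ->; rewrite linearD addrACA.
move=> h; have gen m k : (m + k <= n)%N ->
    iter m (fun u => u + L u) (iter k L x) =
    iter m (fun u => u + L' u) (iter k L' x).
  elim: m k => [|m IHm] k mk; first exact: h.
  rewrite !iterSr !itD -!iterS IHm; last by rewrite -ltnS -addSn ltnW.
  by rewrite IHm // addnS.
by have := gen n 0%N; rewrite addn0 => /(_ (leqnn _)).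
Qed.

Lemma exp2_small (e : K) : 0 < e ->
  exists m, forall i, (m <= i)%N -> (2 ^+ i)^-1 <= e.
Proof.
move=> e0; have [|m hm] := archi (_ : 0 <= e^-1); first by rewrite invr_ge0 ltW.
exists m => i mi.
rewrite -[leRHS]invrK lef_pV2 ?posrE ?exprn_gt0 ?invr_gt0 ?ltr0n //.
by rewrite (le_trans hm) // -natrX ler_nat (leq_trans mi) // ltnW // ltn_expl.
Qed.

Lemma strongly_cyclic_norm : (forall k, l k = 0%N) -> strongly_cyclic q.
Proof.
move=> l0; have [d hd] := separable; have [z hz] := dense_targets q hd.
pose T (N : nat -> {poly K}) u := u + lext N u.
(* The last component of a stage bounds the exponents at which targets have been approached; up to
   it, stage [i] may move the unipotent orbit by at most [2 ^ -i]. *)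
pose R i (st st' : stage) :=
  [/\ extends q l C (idx st) (op st) (idx st') (op st'), i \in idx st',
    supported (idx st) (z i) -> exists2 n, (n <= (sval st').2)%N &
      q i (iter n (T (op st')) 1 - z i) <= (2 ^+ i)^-1,
    ((sval st).2 <= (sval st').2)%N &
    forall n, (n <= (sval st).2)%N ->
      q i (iter n (T (op st')) 1 - iter n (T (op st)) 1) <= (2 ^+ i)^-1].
have [f [f0 fR]] : exists f : nat -> stage,
    f 0%N = st0 /\ forall n, R n (f n) (f n.+1).
  apply: sequential_choice => i [[[s N] nu] /= cN].
  have i0 : 0 < (2 ^+ i)^-1 :> K by rewrite invr_gt0 exprn_gt0 ?ltr0n.
  have [z' z'E sz'] : exists2 z', supported s (z i) -> z' = z i & supported s z'.
    have [sz|nsz] := pselect (supported s (z i)); first by exists (z i).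
    by exists 0 => // k _; rewrite coef0.
  have [s' [N' [ex is' [n hn] hnu]]] :=
    extend_norm q_incr C_ge0 q_lt i i nu archi l0 cN sz' i0.
  have [cN' _ _ _ _] := ex.
  exists (exist _ (s', N', maxn n nu) cN'); split=> //=; last by rewrite leq_maxr.
  move=> sz; exists n; first by rewrite leq_maxl.
  by rewrite -z'E.
pose S i := idx (f i); pose Ns i := op (f i); pose nu i := (sval (f i)).2.
have ext i : extends q l C (S i) (Ns i) (S i.+1) (Ns i.+1) by have [] := fR i.
have cyc0 : cyclic_on (S 0%N) (Ns 0%N) by rewrite /S /Ns f0; exact: cyclic_on0.
have Sm i : i \in S i.+1 by have [] := fR i.
have ad0 k : k \in S 0%N -> admissible q l C k (Ns 0%N k).
  by move=> _; rewrite /Ns f0; exact: adm0.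
have Ss i : {subset S i <= S i.+1} by have [] := ext i.
have Ssize n : (n < size (S n.+1))%N.
  elim: n => [|n IHn]; have [_ h _ _ _] := ext 0%N; first exact: leq_ltn_trans h.
  by have [_ h' _ _ _] := ext n.+1; exact: leq_ltn_trans h'.
pose N := limit_op Ns.
have TE u : lext (fun k => 'X^k + N k) u = T N u.
  rewrite /T /N -{2}[u]coefK poly_def /lext -big_split.
  by apply: eq_bigr => k _; rewrite scalerDr.
exists (lext (fun k => 'X^k + N k)), 1; split.
- move=> n; have [c hc] := limit_op_continuous q_incr C_ge0 coef_le ext cyc0 Sm ad0 n.
  exists n.+1, (1 + c) => u; rewrite /= TE (le_trans (seminormD _ _ _)) //.
  by rewrite mulrDl mul1r lerD.
- move=> u M e e0.
  have e30 : 0 < e / 3 by rewrite divr_gt0 ?ltr0n.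
  have [m hm] := exp2_small e30.
  have [i Mi [zi zu]] := hz u M (maxn M m) _ e30.
  have [_ _ /(_ (supported_small Sm Ss zi))[n nn hn] _ _] := fR i.
  exists n; rewrite (eq_iter TE).
  (* The drifts of the later stages form a geometric series, summed here in telescoped form. *)
  have tail k : q i (iter n (T (Ns (i.+1 + k)%N)) 1 - iter n (T (Ns i.+1)) 1) <=
      (2 ^+ i)^-1 - (2 ^+ (i + k))^-1.
    elim: k => [|k IHk]; first by rewrite !addn0 !subrr seminorm0.
    have nnu : (n <= nu (i.+1 + k)%N)%N.
      elim: (k) => [|j IHj]; first by rewrite addn0.
      by rewrite addnS (leq_trans IHj) //; have [_ _ _ h _] := fR (i.+1 + j)%N.
    have [_ _ _ _ /(_ n nnu) hk] := fR (i.+1 + k)%N.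
    apply: (le_trans (seminorm_tri _ (iter n (T (Ns (i.+1 + k)%N)) 1) _ _)).
    have ii : (i <= i.+1 + k)%N by rewrite addSn leqW // leq_addr.
    rewrite addnS.
    apply: (le_trans (lerD (le_trans (seminorm_incr q_incr _ ii) hk) IHk)).
    rewrite addnS addSn exprS.
    rewrite [X in X <= _](_ : _ = (2 ^+ i)^-1 - (2 * 2 ^+ (i + k))^-1) //.
    by field; rewrite !expf_neq0 ?pnatr_eq0.
  (* For a fixed exponent the limit operator already agrees with a finite stage, so [tail] applies
     without passing to a limit. *)
  have nE : iter n (T N) 1 = iter n (T (Ns (i.+1 + n)%N)) 1.
    apply: (@iter_unipotent_agree (lext N) (lext (Ns (i.+1 + n)%N))) => k kn.
    rewrite (iter_limit ext cyc0 Sm (i := (i.+1 + n)%N)) //.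
    apply: leq_ltn_trans kn (leq_trans (Ssize n) _).
    rewrite addSnnS addnC; elim: (i) => [|j IHj]; first by rewrite addn0.
    by rewrite addnS (leq_trans IHj) // ltnW //; have [_ h _ _ _] := ext (n.+1 + j)%N.
  have iM : (M <= i)%N by rewrite (leq_trans _ Mi) // leq_maxl.
  have im : (m <= i)%N by rewrite (leq_trans _ Mi) // leq_maxr.
  apply: (le_trans (seminorm_tri _ (z i) _ _)).
  have -> : e = e / 3 + e / 3 + e / 3 by field.
  apply: lerD => //; apply: (le_trans (seminorm_incr q_incr _ iM)).
  apply: (le_trans (seminorm_tri _ (iter n (T (Ns i.+1)) 1) _ _)).
  apply: lerD; last exact: le_trans hn (hm i im).
  rewrite nE (le_trans (tail n)) // (le_trans _ (hm i im)) // lerBlDr lerDl.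
  by rewrite invr_ge0 exprn_ge0 ?ler0n.
set T' := lext _.
(* Since [N = T' - 1], the orbit of [1] under [N], known to be total, lies in the span of its orbit
   under [T']. *)
have W0 n : in_span (fun n => iter n T' 1) (iter n (lext N) 1).
  elim: n => [|n IHn]; first exact: (in_span_mem (fun n => iter n T' 1) 0).
  rewrite iterS; have -> : lext N (iter n (lext N) 1) =
    T' (iter n (lext N) 1) - iter n (lext N) 1 by rewrite /T' TE /T addrAC subrr add0r.
  by apply: in_spanB => //; exact: in_span_iter.
move=> u; have [m [a ->]] := total_limit ext cyc0 Sm u.
by apply: in_span_sum => n _; apply: in_spanZ.
Qed.

End StronglyCyclic.

(** * Hahn-Banach in countable dimension *)

(** Dependent choice for properties of initial segments: the value at [k] is frozen after stage
    [k.+1], and the diagonal has every property. *)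
Lemma prefix_choice (X : Type) (P : nat -> (nat -> X) -> Prop) (c0 : nat -> X) :
  (forall n c c', (forall k, (k < n)%N -> c k = c' k) -> P n c -> P n c') ->
  P 0%N c0 ->
  (forall n c, P n c -> exists t, P n.+1 (fun k => if k == n then t else c k)) ->
  exists c, forall n, P n c.
Proof.
move=> Pext P0 PS.
pose R n (c c' : nat -> X) := P n c ->
  P n.+1 c' /\ forall k, (k < n)%N -> c' k = c k.
have [|f [f0 fR]] := @sequential_choice _ R c0.
  move=> n c; have [Pn|nPn] := pselect (P n c); last by exists c.
  have [t Pt] := PS n c Pn; exists (fun k => if k == n then t else c k) => _.
  by split=> // k kn; rewrite ltn_eqF.
have fP n : P n (f n).
  by elim: n => [|n IHn]; [rewrite f0|have [] := fR n IHn].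
have fE n m k : (k < n)%N -> f (m + n)%N k = f n k.
  move=> kn; elim: m => // m IHm; have [_ h] := fR _ (fP (m + n)%N).
  by rewrite addSn h // ltn_addl.
exists (fun k => f k.+1 k) => n; apply: Pext (fP n) => k kn.
by rewrite -(subnK kn) fE.
Qed.

Section HahnBanach.
Variables (R : realType) (W : lmodType R) (P : W -> R).
Hypothesis PD : forall x y, P (x + y) <= P x + P y.
Hypothesis PZ : forall a x, P (a *: x) = `|a| * P x.

Let P0 : P 0 = 0. Proof. by rewrite -(scale0r 0) PZ normr0 mul0r. Qed.
Let PN x : P (- x) = P x. Proof. by rewrite -scaleN1r PZ normrN1 mul1r. Qed.

Let P_ge0 x : 0 <= P x.
Proof. by have := PD x (- x); rewrite subrr P0 PN -mulr2n pmulrn_lge0. Qed.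

(* The value on a new vector [y] of a functional dominated by [P] on [x]'s can
   be any number between the [g x - P (x - y)] and the [P (x + y) - g x]. *)
Lemma dominated_extension (x : nat -> W) n (c : nat -> R) (y : W) :
  (forall a : nat -> R, \sum_(k < n) a k * c k <= P (\sum_(k < n) a k *: x k)) ->
  exists t, forall (a : nat -> R) s, \sum_(k < n) a k * c k + s * t
    <= P (\sum_(k < n) a k *: x k + s *: y).
Proof.
move=> dom.
pose g (a : nat -> R) := \sum_(k < n) a k * c k.
pose v (a : nat -> R) := \sum_(k < n) a k *: x k.
pose A : set R := [set g a - P (v a - y) | a in setT]%classic.
have gD a b : g (fun k => a k + b k) = g a + g b.
  by rewrite /g -big_split; apply: eq_bigr => k _; rewrite mulrDl.
have vD a b : v (fun k => a k + b k) = v a + v b.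
  by rewrite /v -big_split; apply: eq_bigr => k _; rewrite scalerDl.
have gZ s a : g (fun k => s * a k) = s * g a.
  by rewrite /g mulr_sumr; apply: eq_bigr => k _; rewrite mulrA.
have vZ s a : v (fun k => s * a k) = s *: v a.
  by rewrite /v scaler_sumr; apply: eq_bigr => k _; rewrite scalerA.
have ub b : ubound A (P (v b + y) - g b).
  move=> _ [a _ <-]; rewrite lerBlDr addrAC lerBrDr -gD.
  have := dom (fun k => a k + b k); rewrite -/(g _) -[X in P X]/(v (fun k => a k + b k)).
  move=> /le_trans; apply; rewrite vD.
  have -> : v a + v b = (v b + y) + (v a - y) by rewrite addrACA subrr addr0 addrC.
  exact: PD.
have A0 : (A !=set0)%classic by exists (g (fun _ => 0) - P (v (fun _ => 0) - y)), (fun _ => 0).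
have hsup : has_sup A by split=> //; exists (P (v (fun _ => 0) + y) - g (fun _ => 0)); exact: ub.
exists (sup A) => a s; rewrite -/(g a) -/(v a).
have up b : g b + sup A <= P (v b + y).
  by rewrite addrC -lerBrDr; apply: ge_sup.
have low b : g b - sup A <= P (v b - y).
  rewrite lerBlDr addrC -lerBlDr; apply: ub_le_sup; first by case: hsup.
  by exists b.
have [s0|s0|->] := ltgtP s 0; last by rewrite mul0r scale0r !addr0 dom.
- have s'0 : 0 < - s by rewrite oppr_gt0.
  have := low (fun k => (- s)^-1 * a k).
  rewrite gZ vZ -(ler_pM2l s'0) mulrBr mulVKf ?gt_eqF // mulNr opprK.
  rewrite -[X in X * P _]gtr0_norm // -PZ scalerBr scalerA mulfV ?gt_eqF //.
  by rewrite scale1r scaleNr opprK.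
- have := up (fun k => s^-1 * a k).
  rewrite gZ vZ -(ler_pM2l s0) mulrDr mulVKf ?gt_eqF //.
  rewrite -[X in X * P _]gtr0_norm // -PZ scalerDr scalerA mulfV ?gt_eqF //.
  by rewrite scale1r.
Qed.

(** Along a countable total family one extension per vector suffices. Different representations of a
    vector give the same value, because the difference is dominated by [P 0 = 0]. *)
Lemma hahn_banach (x : nat -> W) : total_family x ->
  exists g : {scalar W}, g (x 0) = P (x 0) /\ forall y, `|g y| <= P y.
Proof.
move=> tx.
pose dom n (c : nat -> R) := ((0 < n)%N -> c 0%N = P (x 0)) /\
  forall a : nat -> R, \sum_(k < n) a k * c k <= P (\sum_(k < n) a k *: x k).
have [|||c hc] := @prefix_choice R dom (fun _ => 0).
- move=> n c c' cc' [c0 h]; split=> [n0|a]; first by rewrite -cc' ?c0.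
  apply: le_trans (h a); rewrite le_eqVlt; apply/orP; left; apply/eqP.
  by apply: eq_bigr => k _; rewrite cc'.
- by split=> // a; rewrite !big_ord0 P0.
- move=> [|n] c [c0 h].
    exists (P (x 0)); split=> // a; rewrite !big_ord1 PZ /=.
    by rewrite ler_wpM2r ?ler_norm.
  have [t ht] := dominated_extension (x n.+1) h; exists t; split=> [_|a].
    by rewrite /= c0.
  rewrite big_ord_recr [X in P X]big_ord_recr /= eqxx.
  apply: le_trans (ht _ _); rewrite lerD2r le_eqVlt; apply/orP; left; apply/eqP.
  by apply: eq_bigr => k _; rewrite ltn_eqF.
have {}hc0 : c 0%N = P (x 0) by have [-> ] := hc 1%N.
have {}hc m (a : nat -> R) : \sum_(k < m) a k * c k <= P (\sum_(k < m) a k *: x k).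
  by have [_] := hc m; apply.
pose ev m (a : nat -> R) := \sum_(k < m) a k * c k.
have comb m (a : nat -> R) m' (a' : nat -> R) s : exists n (b : nat -> R),
    \sum_(k < m) a k *: x k - s *: \sum_(k < m') a' k *: x k =
      \sum_(k < n) b k *: x k /\ ev m a - s * ev m' a' = ev n b.
  pose n := maxn m m'.
  pose b k := (if (k < m)%N then a k else 0) - s * (if (k < m')%N then a' k else 0).
  exists n, b; split.
    rewrite (in_span_sum_le x a (leq_maxl m m')) (in_span_sum_le x a' (leq_maxr m m')).
    rewrite scaler_sumr -sumrB.
    by apply: eq_bigr => k _; rewrite scalerBl scalerA.
  have pad q (f : nat -> R) : (q <= n)%N ->
      ev q f = \sum_(k < n) (if (k < q)%N then f k else 0) * c k.
    move=> qn; rewrite /ev (big_ord_widen _ (fun k => f k * c k) qn) big_mkcond.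
    by apply: eq_bigr => k _; case: ifP; rewrite ?mul0r.
  rewrite (pad m a) ?leq_maxl // (pad m' a') ?leq_maxr // mulr_sumr -sumrB.
  by apply: eq_bigr => k _; rewrite mulrBl mulrA.
have [rep hrep] : exists rep : W -> nat * (nat -> R), forall y,
    y = \sum_(k < (rep y).1) (rep y).2 k *: x k.
  have [|rep hrep] := @choice W (nat * (nat -> R))
    (fun y r => y = \sum_(k < r.1) r.2 k *: x k); last by exists rep.
  by move=> y; have [m [a ->]] := tx y; exists (m, a).
pose G y := ev (rep y).1 (rep y).2.
have Geq m (a : nat -> R) y : y = \sum_(k < m) a k *: x k -> G y = ev m a.
  move=> yE; have le m1 (a1 : nat -> R) m2 (a2 : nat -> R) : \sum_(k < m1) a1 k *: x k =
      \sum_(k < m2) a2 k *: x k -> ev m1 a1 <= ev m2 a2.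
    move=> E; have [n [b [h1 h2]]] := comb m1 a1 m2 a2 1.
    rewrite -subr_le0 -[ev m2 a2]mul1r h2 (le_trans (hc _ _)) // -h1 E.
    by rewrite scale1r subrr P0.
  by apply/eqP; rewrite eq_le !le // -hrep.
have Glin : scalar G.
  move=> s y z; rewrite addrC -[s]opprK scaleNr.
  have [n [b [h1 h2]]] := comb (rep z).1 (rep z).2 (rep y).1 (rep y).2 (- s).
  by rewrite (Geq n b) -?h2 /G ?mulNr 1?addrC // -h1 -!hrep.
pose g : {scalar W} := HB.pack G (GRing.isLinear.Build _ _ _ _ G Glin).
exists g; split=> [|y].
  rewrite /= (Geq 1%N (fun _ => 1)) ?big_ord1 ?scale1r // /ev big_ord1 mul1r //.
have Gle z : G z <= P z by rewrite [in leRHS](hrep z); exact: hc.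
apply/ler_normlP; split; last exact: Gle.
by rewrite -(linearN g) -[leRHS]PN; exact: Gle.
Qed.
End HahnBanach.

(* [K] is [R] (with [j = 0]) or [R[i]] (with [j = 'i]), and [io] the inclusion
   of [R] in [K]. *)
Record real_form (R : realType) (K : numFieldType) := RealForm {
  rf_inj :> {rmorphism R -> K} ;
  rf_im : K ;
  rf_le : forall a b, (rf_inj a <= rf_inj b) = (a <= b) ;
  rf_ge0 : forall x : K, 0 <= x -> exists a, x = rf_inj a ;
  rf_im2 : rf_im = 0 \/ rf_im * rf_im = -1 ;
  rf_dec : forall x, exists a b, x = rf_inj a + rf_im * rf_inj b ;
  rf_re0 : forall a b, rf_inj a + rf_im * rf_inj b = 0 -> a = 0 }.

Lemma real_form_exists (R : realType) (K : numFieldType) :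
  K = R :> numFieldType \/ K = R[i] :> numFieldType -> inhabited (real_form R K).
Proof.
case=> ->; constructor.
  apply: (@RealForm R R idfun 0) => //.
  - by move=> x _; exists x.
  - by left.
  - by move=> x; exists x, 0; rewrite mul0r addr0.
  - by move=> a b; rewrite mul0r addr0.
apply: (@RealForm R R[i] (real_complex R) 'i%C).
- by move=> a b; rewrite lecR.
- by move=> [a b]; rewrite lecE /= => /andP[/eqP -> _]; exists a.
- by right; rewrite -expr2 sqr_i.
- by move=> [a b]; exists a, b; exact: (complexE (a +i* b)%C).
- by move=> a b; rewrite -(complexE (a +i* b)%C) => -[].
Qed.

Section ScalarField.
Variables (R : realType) (K : numFieldType) (io : real_form R K).
Let j := rf_im io.

Lemma rf_pos a : (0 <= io a) = (0 <= a).
Proof. by rewrite -(rf_le io) rmorph0. Qed.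

Lemma rf_norm a : `|io a| = io `|a|.
Proof.
have [a0|a0] := leP 0 a; first by rewrite !ger0_norm ?rf_pos.
by rewrite -normrN -rmorphN ger0_norm ?rf_pos ?oppr_ge0 ?(ltW a0) // ler0_norm ?ltW.
Qed.

Lemma rf_lt a b : (io a < io b) = (a < b).
Proof. by rewrite !lt_neqAle rf_le (inj_eq (fmorph_inj _)). Qed.

Lemma rf_norm_im : `|j| <= 1.
Proof.
rewrite /j; case: (rf_im2 io) => [->|j2]; first by rewrite normr0.
have : `|rf_im io| ^+ 2 = 1 by rewrite -normrX expr2 j2 normrN1.
by move/eqP; rewrite pexpr_eq1 // => /eqP ->.
Qed.

Lemma rf_archi (x : K) : 0 <= x -> exists n, x <= n%:R.
Proof.
move=> /(rf_ge0 io)[a ->]; have [n hn] : exists n : nat, `|a| <= n%:R.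
  by exists (Num.bound `|a|); rewrite ltW // archi_boundP.
by exists n; rewrite -(rmorph_nat io) rf_le (le_trans (ler_norm _)).
Qed.

Lemma rf_separable :
  exists d : nat -> K, forall x e, 0 < e -> exists n, `|x - d n| <= e.
Proof.
exists (fun n => if unpickle n is Some (r, s) then
  io (ratr (r : rat)) + j * io (ratr (s : rat)) else 0) => x e e0.
have [a [b ->]] := rf_dec io x.
have [f fe] := rf_ge0 io (ltW e0); rewrite fe -(rmorph0 io) rf_lt in e0.
have f2 : 0 < f / 2 by rewrite divr_gt0.
have rat_near (t : R) : exists r : rat, `|t - ratr r| <= f / 2.
  have [r rt] := @rat_in_itvoo R (t - f / 2) (t + f / 2) ltac:(lra).
  by exists r; rewrite ler_distlC !ltW // (itvP rt).
have [r hr] := rat_near a; have [s hs] := rat_near b.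
exists (pickle (r, s)); rewrite pickleK opprD addrACA -mulrBr -!rmorphB.
apply: (le_trans (ler_normD _ _)); rewrite normrM !rf_norm fe [f]splitr rmorphD.
apply: lerD; first by rewrite rf_le.
rewrite (le_trans (ler_piMl _ rf_norm_im)) ?rf_le //.
by rewrite -(rmorph0 io) rf_le.
Qed.

End ScalarField.

Section Realify.
Variables (R : realType) (K : numFieldType) (io : real_form R K) (V : lmodType K).

(** Restriction of scalars to [R]; the real form stays an argument of the type so that the instances
    below know which scaling is meant. *)
Definition realify of real_form R K : Type := V.
Local Notation VR := (realify io).
HB.instance Definition _ := GRing.Zmodule.on VR.
Definition realify_scale (a : R) (v : VR) : VR := io a *: (v : V).

Fact realify_scalerA a b v :
  realify_scale a (realify_scale b v) = realify_scale (a * b) v.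
Proof. by rewrite /realify_scale scalerA rmorphM. Qed.
Fact realify_scale1r : left_id 1 realify_scale.
Proof. by move=> v; rewrite /realify_scale rmorph1 scale1r. Qed.
Fact realify_scalerDr : right_distributive realify_scale +%R.
Proof. by move=> a u w; rewrite /realify_scale scalerDr. Qed.
Fact realify_scalerDl v : {morph realify_scale^~ v : a b / a + b}.
Proof. by move=> a b; rewrite /realify_scale rmorphD scalerDl. Qed.
HB.instance Definition _ := GRing.Zmodule_isLmodule.Build R VR
  realify_scalerA realify_scale1r realify_scalerDr realify_scalerDl.

Let j := rf_im io.

(** A real functional [g] with [g e = P e] is complexified as [g y - j * g (j *: y)], which is [g]
    itself for [j = 0]. At [e] its real part is [P e], so it can be normalised. *)
Lemma norming_functional (x : nat -> V) (p : seminorm V) (e : V) :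
  total_family x -> p e != 0 ->
  exists (f : {scalar V}) (c : K), [/\ f e = 1, 0 <= c & forall y, `|f y| <= c * p y].
Proof.
move=> tx pe.
have [P hP] : exists P : V -> R, forall v, p v = io (P v).
  have [P hP] := choice (fun v => rf_ge0 io (seminorm_ge0 p v)); by exists P.
have PD (u w : VR) : P (u + w) <= P u + P w.
  by rewrite -(rf_le io) rmorphD -!hP seminormD.
have PZ (a : R) (u : VR) : P (a *: u) = `|a| * P u.
  apply: (fmorph_inj io); rewrite -hP seminormZ rmorphM -rf_norm -hP //.
(* [hahn_banach] attains its bound at the first member, hence [e] in front; over [R] both [x m] and
   [j *: x m] are listed. *)
pose w n : VR := if n is m.+1 then (if odd m then j *: x m./2 else x m./2) else e.
have tw : total_family w.
  have wx m : in_span w (x m).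
    by have := in_span_mem w m.*2.+1; rewrite /w odd_double doubleK.
  have wjx m : in_span w (j *: x m : VR).
    have := in_span_mem w m.*2.+2; rewrite /w /= odd_double /=.
    by rewrite uphalf_double.
  move=> y; have [m [a ->]] := tx y.
  apply: (big_ind (in_span w)); [exact: in_span0|exact: in_spanD|] => n _.
  have [b [c ->]] := rf_dec io (a n).
  rewrite scalerDl [rf_im io * _]mulrC -scalerA.
  apply: in_spanD; first exact: (in_spanZ b (wx n)).
  exact: (in_spanZ c (wjx n)).
have [g [ge gP]] := hahn_banach PD PZ tw.
pose f0 (y : V) : K := io (g y) - j * io (g (j *: y)).
have gD (u v : V) : g (u + v) = g u + g v by exact: (linearD g).
have gZ (a : R) (u : V) : g (io a *: u) = a * g u by exact: (linearZ_LR g).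
have f0D u v : f0 (u + v) = f0 u + f0 v.
  by rewrite /f0 scalerDr !gD !rmorphD mulrDr opprD addrACA.
have f0Z a u : f0 (io a *: u) = io a * f0 u.
  rewrite /f0 scalerA [j * io a]mulrC -scalerA !gZ !rmorphM mulrBr; congr (_ - _).
  by rewrite mulrCA.
have g0 : g 0 = 0 by exact: (linear0 g).
have f0j u : f0 (j *: u) = j * f0 u.
  rewrite /f0 scalerA /j; case: (rf_im2 io) => [->|j2].
    by rewrite !mul0r !scale0r g0 rmorph0 subr0.
  rewrite j2 scaleN1r (linearN g) rmorphN mulrN opprK mulrBr mulrA j2 mulN1r.
  by rewrite opprK addrC.
have f0lin : scalar f0.
  move=> a u v; rewrite f0D; congr (_ + _); have [b [c ->]] := rf_dec io a.
  by rewrite scalerDl f0D f0Z -scalerA f0j f0Z mulrDl mulrA.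
have f0P y : `|f0 y| <= 2 * p y.
  rewrite /f0 (le_trans (ler_normB _ _)) // mulr_natl mulr2n.
  have gp u : `|io (g u)| <= p u by rewrite rf_norm hP rf_le.
  rewrite lerD // normrM (le_trans (ler_wpM2l (normr_ge0 _) (gp _))) //.
  rewrite seminormZ mulrA ler_piMl ?seminorm_ge0 //.
  by rewrite mulr_ile1 // rf_norm_im.
have fe : f0 e != 0.
  apply/eqP; rewrite /f0 -mulrN -rmorphN => /rf_re0 ge0.
  by move: pe; rewrite hP -[P e]ge ge0 rmorph0 eqxx.
pose f y := (f0 e)^-1 * f0 y.
have flin : scalar f by move=> a u v; rewrite /f f0lin mulrDr mulrCA.
exists (HB.pack f (GRing.isLinear.Build _ _ _ _ f flin) : {scalar V}).
exists (`|(f0 e)^-1| * 2); split=> /=.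
- by rewrite /f mulVf.
- by rewrite mulr_ge0.
- by move=> y; rewrite /f normrM -mulrA ler_wpM2l.
Qed.

End Realify.

(** * Level bases *)

Definition pack_scalar (K : numFieldType) (V : lmodType K) (f : V -> K)
    (fP : scalar f) : {scalar V} :=
  HB.pack f (GRing.isLinear.Build _ _ _ _ f fP).

Section LevelBasis.
Variables (R : realType) (K : numFieldType) (io : real_form R K) (V : lmodType K).
Variables (x : nat -> V) (p : nat -> seminorm V).
Hypothesis tx : total_family x.
Hypothesis x_free : forall m (a : nat -> K), \sum_(n < m) a n *: x n = 0 ->
  forall n, (n < m)%N -> a n = 0.
Hypothesis p_incr : forall n u, p n u <= p n.+1 u.
Hypothesis p_sep : forall u, (forall n, p n u = 0) -> u = 0.

Let X : Type := V * {scalar V} * nat * K.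
Let e_ (t : X) := t.1.1.1.
Let f_ (t : X) := t.1.1.2.
Let l_ (t : X) := t.1.2.
Let C_ (t : X) := t.2.

Let good n (c : nat -> X) : Prop :=
  (forall k, (k < n)%N -> [/\ 0 <= C_ (c k),
     forall y, `|f_ (c k) y| <= C_ (c k) * p (l_ (c k)) y,
     forall m, (m < l_ (c k))%N -> p m (e_ (c k)) = 0 &
     exists a : nat -> K, e_ (c k) = x k + \sum_(i < k) a i *: x i]) /\
  forall k m, (k < n)%N -> (m < n)%N -> f_ (c k) (e_ (c m)) = (k == m)%:R.

(** A Gram-Schmidt step: [e] is [x n] without its components along the earlier vectors, and [l] is
    the first seminorm not vanishing on it. The new functional must kill the earlier vectors and yet
    remain bounded by [p l]. *)
Let good_step n c : good n c ->
  exists t, good n.+1 (fun k => if k == n then t else c k).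
Proof.
move=> [h1 h2].
pose e := x n - \sum_(k < n) f_ (c k) (x n) *: e_ (c k).
have [a ea] : exists a : nat -> K, e = x n + \sum_(i < n) a i *: x i.
  pose sp u := exists a : nat -> K, u = \sum_(i < n) a i *: x i.
  have [a ea] : sp (\sum_(k < n) f_ (c k) (x n) *: e_ (c k)).
    apply: (big_ind sp).
    - by exists (fun _ => 0); rewrite big1 // => i _; rewrite scale0r.
    - move=> u w [a ->] [b ->]; exists (fun n => a n + b n).
      by rewrite -big_split; apply: eq_bigr => i _; rewrite scalerDl.
    - move=> k _; have [_ _ _ [a ->]] := h1 k (ltn_ord k).
      exists (fun i => f_ (c k) (x n) *
        (if (i < k.+1)%N then (if i == k then 1 else a i) else 0)).
      have -> : x k + \sum_(i < k) a i *: x i =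
          \sum_(i < k.+1) (if i == k :> nat then 1 else a i) *: x i.
        rewrite big_ord_recr /= eqxx scale1r addrC; congr (_ + _).
        by apply: eq_bigr => i _; rewrite ltn_eqF.
      rewrite (in_span_sum_le x (fun i => if i == k :> nat then 1 else a i) (ltn_ord k)).
      by rewrite scaler_sumr; apply: eq_bigr => i _; rewrite scalerA.
  exists (fun i => - a i); rewrite /e ea -sumrN; congr (_ + _).
  by apply: eq_bigr => i _; rewrite scaleNr.
have e_neq0 : e <> 0.
  rewrite ea => e0; suff /eqP : (1 : K) = 0 by rewrite oner_eq0.
  have := @x_free n.+1 (fun i => if i == n then 1 else a i) _ n (ltnSn n).
  rewrite eqxx; apply; rewrite big_ord_recr /= eqxx scale1r addrC -[RHS]e0.
  by congr (_ + _); apply: eq_bigr => i _; rewrite ltn_eqF.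
have ex : exists l, p l e != 0.
  apply: contrapT => /forallNP h; apply: e_neq0; apply: p_sep => m.
  by apply/eqP/negPn/negP; exact: h.
case: (ex_minnP ex) => l le lmin.
have [f0 [c0 [f0e c00 f0le]]] := norming_functional io tx le.
(* Only functionals bounded by [p l] may be subtracted. The others call for no correction: if
   [l < l_ (c k)], then [p l] and hence [f0] vanish on [e_ (c k)]. *)
pose f y := f0 y - \sum_(k < n | (l_ (c k) <= l)%N) f0 (e_ (c k)) * f_ (c k) y.
have flin : scalar f.
  move=> s u v; rewrite /f linearP mulrBr -addrACA; congr (_ + _).
  rewrite mulr_sumr -opprD -big_split; congr (- _); apply: eq_bigr => k _.
  by rewrite linearP mulrDr mulrCA.
have fke k : (k < n)%N -> f_ (c k) e = 0.
  move=> kn; rewrite /e linearB linear_sum (bigD1 (Ordinal kn)) //= linearZ /=.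
  rewrite h2 // eqxx mulr1 big1 ?addr0 ?subrr // => i ik.
  rewrite linearZ /= h2 //; move: ik; rewrite -val_eqE /= eq_sym => /negPf ->.
  by rewrite mulr0.
have fe : f e = 1.
  by rewrite /f f0e big1 ?subr0 // => k _; rewrite fke ?mulr0.
have fem m : (m < n)%N -> f (e_ (c m)) = 0.
  move=> mn; have [lm|lm] := leqP (l_ (c m)) l.
    rewrite /f (bigD1 (Ordinal mn)) //= h2 // eqxx mulr1 big1 ?addr0 ?subrr //.
    move=> k /andP[_]; rewrite -val_eqE /= => /negPf km.
    by rewrite h2 // km mulr0.
  have f0m : f0 (e_ (c m)) = 0.
    apply/eqP; rewrite -normr_le0 (le_trans (f0le _)) //.
    by have [_ _ pm0 _] := h1 m mn; rewrite pm0 ?mulr0.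
  rewrite /f f0m big1 ?subr0 // => k lk; rewrite h2 //.
  case: eqP => [km|_]; last by rewrite mulr0.
  by move: lk; rewrite km leqNgt lm.
exists (e, pack_scalar flin, l,
  c0 + \sum_(k < n | (l_ (c k) <= l)%N) `|f0 (e_ (c k))| * C_ (c k)).
split=> [k|k m].
  rewrite ltnS leq_eqVlt; case: eqP => [-> _|_ /=]; last first.
    exact: h1.
  rewrite /C_ /f_ /l_ /e_ /=; split; last by exists a.
  - rewrite addr_ge0 ?sumr_ge0 // => i _; rewrite mulr_ge0 //.
    by have [] := h1 i (ltn_ord i).
  - move=> y; rewrite /f (le_trans (ler_normB _ _)) // mulrDl lerD //.
    rewrite mulr_suml (le_trans (ler_norm_sum _ _ _)) // ler_sum // => i li.
    rewrite normrM -mulrA ler_wpM2l //.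
    have [C0 h _ _] := h1 i (ltn_ord i); rewrite (le_trans (h _)) // ler_wpM2l //.
    exact: seminorm_incr.
  - move=> m ml; apply/eqP/negPn/negP => /lmin; by rewrite leqNgt ml.
have lt i : (i < n.+1)%N -> i != n -> (i < n)%N by move=> ? ?; rewrite ltn_neqAle -ltnS; apply/andP.
move=> /lt kn /lt mn.
case: (eqVneq k n) kn => [-> _|kE /(_ isT) kn]; case: (eqVneq m n) mn => [-> _|mE /(_ isT) mn].
- exact: fe.
- exact: fem.
- by rewrite (negPf kE); exact: fke.
exact: h2.
Qed.

Lemma level_basis : exists (e : nat -> V) (f : nat -> {scalar V})
    (l : nat -> nat) (C : nat -> K),
  [/\ total_family e, forall k m, f k (e m) = (k == m)%:R,
      forall k, 0 <= C k, forall k y, `|f k y| <= C k * p (l k) y &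
      forall k m, (m < l k)%N -> p m (e k) = 0].
Proof.
have zero_lin : scalar (fun _ : V => 0 : K) by move=> a u v; rewrite mulr0 addr0.
have [|||c hc] := @prefix_choice X good (fun _ => (0, pack_scalar zero_lin, 0%N, 0)).
- move=> n c c' cc' [h1 h2]; split=> [k kn|k m kn mn]; first by rewrite -cc' //; exact: h1.
  by rewrite -!cc' //; exact: h2.
- by split.
- exact: good_step.
exists (fun k => e_ (c k)), (fun k => f_ (c k)), (fun k => l_ (c k)), (fun k => C_ (c k)).
split.
- suff h n : in_span (fun k => e_ (c k)) (x n).
    by move=> u; have [m [a ->]] := tx u; apply: in_span_sum => n _; apply: in_spanZ.
  elim/ltn_ind: n => n IHn; have [/(_ n (ltnSn n))[_ _ _ [a ea]] _] := hc n.+1.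
  rewrite -[x n](addrK (\sum_(i < n) a i *: x i)) -ea.
  apply: in_spanB; first exact: (in_span_mem (fun k => e_ (c k))).
  by apply: in_span_sum => i _; apply/in_spanZ/IHn.
- move=> k m; have [_ h] := hc (maxn k m).+1.
  by apply: h; rewrite ltnS ?leq_maxl ?leq_maxr.
- by move=> k; have [/(_ k (ltnSn k))[]] := hc k.+1.
- by move=> k; have [/(_ k (ltnSn k))[]] := hc k.+1.
- by move=> k; have [/(_ k (ltnSn k))[]] := hc k.+1.
Qed.

End LevelBasis.

Lemma le_norm_mul (K : numFieldType) (a b c : K) :
  0 <= a -> 0 <= b -> a <= c * b -> a <= `|c| * b.
Proof.
move=> a0 b0 acb; rewrite -[X in _ * X]ger0_norm // -normrM ger0_norm //.
exact: le_trans acb.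
Qed.

Lemma strongly_cyclic_iso (K : numFieldType) (U V : lmodType K)
    (L : {linear U -> V}) (L' : V -> U) (q : nat -> seminorm U) (p : nat -> seminorm V) :
  cancel L L' -> cancel L' L ->
  (forall n, exists m c, forall u, p n (L u) <= c * q m u) ->
  (forall n, exists m c, forall u, q n u <= c * p m (L u)) ->
  strongly_cyclic q -> strongly_cyclic p.
Proof.
move=> LK L'K pq qp [T [x [Tc Td Tt]]].
have L'lin : linear L'.
  by move=> a u v; apply: (can_inj LK); rewrite linearP !L'K.
pose T' v := L (T (L' v)).
have T'lin : linear T' by move=> a u v; rewrite /T' L'lin !linearP.
pose T1 : {linear V -> V} := HB.pack T' (GRing.isLinear.Build _ _ _ _ T' T'lin).
have iterT n : iter n T1 (L x) = L (iter n T x).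
  by elim: n => //= n ->; rewrite /T' LK.
exists T1, (L x); split.
- move=> n; have [m [c hc]] := pq n; have [m' [c' hc']] := Tc m.
  have [m'' [c'' hc'']] := qp m'.
  exists m'', (`|c| * (`|c'| * `|c''|)) => u.
  rewrite /= /T' (le_trans (le_norm_mul _ _ (hc _))) ?seminorm_ge0 //.
  rewrite -!mulrA ler_wpM2l //.
  rewrite (le_trans (le_norm_mul _ _ (hc' _))) ?seminorm_ge0 // ler_wpM2l //.
  by rewrite -{2}[u]L'K le_norm_mul ?seminorm_ge0.
- move=> z M e e0; have [m [c hc]] := pq M.
  have c1 : 0 < `|c| + 1 by rewrite ltr_wpDl.
  have [n hn] := Td (L' z) m _ (divr_gt0 e0 c1).
  exists n; rewrite iterT -{1}[z]L'K -linearB.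
  rewrite (le_trans (le_norm_mul _ _ (hc _))) ?seminorm_ge0 //.
  rewrite (le_trans (ler_wpM2l (normr_ge0 _) hn)) // mulrCA ger_pMr //.
  by rewrite ler_pdivrMr // mul1r lerDl.
move=> v; have [m [a ha]] := Tt (L' v).
exists m, a; rewrite -[v]L'K ha linear_sum; apply: eq_bigr => n _.
by rewrite linearZ iterT.
Qed.

Lemma dependent_family (K : fieldType) n (A : nat -> nat -> K) :
  exists c : nat -> K, (exists2 i, (i <= n)%N & c i != 0) /\
    forall j, (j < n)%N -> \sum_(i < n.+1) c i * A i j = 0.
Proof.
pose M : 'M[K]_(n.+1, n) := \matrix_(i, j) A i j.
have : kermx M != 0.
  by rewrite -mxrank_eq0 mxrank_ker subn_eq0 -ltnNge ltnS rank_leq_col.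
case/rowV0Pn => v /sub_kermxP vM v0.
exists (fun i => v 0 (inord i)); split.
  have [i vi] : exists i, v 0 i != 0.
    apply: contrapT => /forallNP h; move/eqP: v0; apply; apply/rowP => i.
    by rewrite [RHS]mxE; apply/eqP/negPn/negP; exact: h.
  by exists i; [rewrite -ltnS|rewrite inord_val].
move=> j jn; have := congr1 (fun B : 'rV_n => B 0 (Ordinal jn)) vM.
rewrite mxE [RHS]mxE => E; rewrite -[RHS]E.
by apply: eq_bigr => i _; rewrite inord_val mxE.
Qed.

Lemma infinite_subseq (Q : nat -> Prop) :
  (forall B, exists2 k, (B <= k)%N & Q k) ->
  exists s : nat -> nat, {homo s : i j / (i < j)%N} /\ forall i, Q (s i).
Proof.
move=> h; have [k0 _ Qk0] := h 0%N.
have [|s [s0 sR]] := @sequential_choice nat (fun _ k k' => (k < k')%N /\ Q k') k0.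
  by move=> _ k; have [k' kk' Qk'] := h k.+1; exists k'.
exists s; split; first by apply: homo_ltn => [|i]; [exact: ltn_trans|have [] := sR i].
by case=> [|i]; [rewrite s0|have [] := sR i].
Qed.

Lemma not_infinite_bound (Q : nat -> Prop) :
  ~ (forall B, exists2 k, (B <= k)%N & Q k) ->
  exists B, forall k, (B <= k)%N -> ~ Q k.
Proof.
move=> /existsNP[B h]; exists B => k Bk Qk; apply: h; by exists k.
Qed.

Section Pullback.
Variables (K : numFieldType) (U V : lmodType K) (L : {linear U -> V}).

Definition pullback (p : seminorm V) : seminorm U.
Proof.
apply: (@Seminorm K U (fun u => p (L u))).
- by move=> u; exact: seminorm_ge0.
- by move=> u w; rewrite linearD seminormD.
- by move=> a u; rewrite linearZ seminormZ.
Defined.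

End Pullback.

Definition abs_sum (K : numFieldType) (V : lmodType K) (f : nat -> {scalar V})
  (n : nat) : seminorm V.
Proof.
apply: (@Seminorm K V (fun u => \sum_(k < n) `|f k u|)).
- by move=> u; rewrite sumr_ge0.
- by move=> u w; rewrite -big_split ler_sum // => k _; rewrite linearD ler_normD.
- by move=> a u; rewrite mulr_sumr; apply: eq_bigr => k _; rewrite linearZ normrM.
Defined.

Definition seminormed_iso (K : numFieldType) (U V : lmodType K)
    (q : nat -> seminorm U) (p : nat -> seminorm V) : Prop :=
  exists (L : {linear U -> V}) (L' : V -> U), [/\ cancel L L', cancel L' L,
    forall n, exists m c, forall u, p n (L u) <= c * q m u &
    forall n, exists m c, forall u, q n u <= c * p m (L u)].

Lemma seminormed_iso_sym (K : numFieldType) (U V : lmodType K)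
    (q : nat -> seminorm U) (p : nat -> seminorm V) :
  seminormed_iso q p -> seminormed_iso p q.
Proof.
move=> [L [L' [LK L'K pq qp]]].
have L'lin : linear L'.
  by move=> a u v; apply: (can_inj LK); rewrite linearP !L'K.
exists (HB.pack L' (GRing.isLinear.Build _ _ _ _ L' L'lin) : {linear V -> U}), L.
split=> // n.
  have [m [c h]] := qp n; exists m, c => u.
  by apply: le_trans (h _) _; rewrite L'K.
have [m [c h]] := pq n; exists m, c => u.
by rewrite -{1}[u]L'K; exact: h.
Qed.

Lemma seminormed_iso_cyclic (K : numFieldType) (U V : lmodType K)
    (q : nat -> seminorm U) (p : nat -> seminorm V) :
  seminormed_iso q p -> strongly_cyclic q -> strongly_cyclic p.
Proof. by move=> [L [L' [LK L'K pq qp]]]; exact: strongly_cyclic_iso LK L'K pq qp. Qed.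

Section LevelData.
Variables (K : numFieldType).
Hypothesis archi : forall a : K, 0 <= a -> exists n, a <= n%:R.
Hypothesis separable : exists d : nat -> K,
  forall x e, 0 < e -> exists n, `|x - d n| <= e.

Definition level_data (V : lmodType K) (p : nat -> seminorm V) (e : nat -> V)
    (f : nat -> {scalar V}) (l : nat -> nat) (C : nat -> K) : Prop :=
  [/\ total_family e, forall k m, f k (e m) = (k == m)%:R,
      forall k, 0 <= C k, forall k y, `|f k y| <= C k * p (l k) y &
      forall k m, (m < l k)%N -> p m (e k) = 0].

Variables (V : lmodType K) (p : nat -> seminorm V) (e : nat -> V).
Variables (f : nat -> {scalar V}) (l : nat -> nat) (C : nat -> K).
Hypothesis p_incr : forall n u, p n u <= p n.+1 u.
Hypothesis data : level_data p e f l C.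

Lemma level_coef k (u : {poly K}) : f k (lext e u) = u`_k.
Proof.
have [_ fe _ _ _] := data.
rewrite /lext linear_sum; have [ku|uk] := ltnP k (size u).
  rewrite (bigD1 (Ordinal ku)) //= linearZ /= fe eqxx mulr1 big1 ?addr0 // => i ik.
  by rewrite linearZ /= fe; move: ik; rewrite -val_eqE /= eq_sym => /negPf ->; rewrite mulr0.
rewrite nth_default // big1 // => i _; rewrite linearZ /= fe.
by rewrite gtn_eqF ?mulr0 // (leq_trans _ uk).
Qed.

Lemma lext_bijective : exists L' : V -> {poly K}, cancel (lext e) L' /\ cancel L' (lext e).
Proof.
have [te _ _ _ _] := data.
have surj v : exists u, lext e u = v.
  have [m [a ->]] := te v; exists (\poly_(k < m) a k).
  rewrite (lext_wide e (size_poly _ _)); apply: eq_bigr => k _.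
  by rewrite coef_poly ltn_ord.
have [L' hL'] := choice surj; exists L'; split=> // u.
by apply/polyP => k; rewrite -!level_coef hL'.
Qed.

Lemma level_data_pullback : seminormed_iso (fun n => pullback (lext e) (p n)) p.
Proof.
have [L' [LK L'K]] := lext_bijective.
by exists (lext e), L'; split=> // n; exists n, 1 => u; rewrite mul1r.
Qed.

Lemma level_data_cyclic :
  (forall k, l k = 0%N) \/ (forall i n, exists2 k, (n <= k)%N & l k = i) ->
  strongly_cyclic p.
Proof.
move=> h; apply: seminormed_iso_cyclic level_data_pullback _.
have [_ _ C0 fle pl] := data.
pose q n := pullback (lext e) (p n).
have q_incr n u : q n u <= q n.+1 u by exact: p_incr.
have cle k (u : {poly K}) : `|u`_k| <= C k * q (l k) u.
  by rewrite -level_coef; exact: fle.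
have qlt k m : (m < l k)%N -> q m 'X^k = 0 by move=> ml; rewrite /= lextX pl.
case: h => [l0|linf].
  exact: (strongly_cyclic_norm archi separable q_incr C0 cle qlt l0).
exact: (strongly_cyclic_levels separable q_incr C0 cle qlt linf).
Qed.

(** The topology is that of coordinatewise convergence: [p n] vanishes on all but finitely many
    [e k], and each coordinate is bounded by some seminorm. *)
Lemma finite_levels_iso : (forall n, exists B, forall k, (B <= k)%N -> (n < l k)%N) ->
  seminormed_iso (abs_sum (fun k => coefp k : {scalar {poly K}})) p.
Proof.
move=> fin; have [L' [LK L'K]] := lext_bijective.
have [_ _ C0 fle pl] := data.
exists (lext e), L'; split=> // n.
  have [B hB] := fin n; exists B, (\sum_(k < B) p n (e k)) => u /=.
  have E : lext e u = \sum_(k < maxn B (size u)) u`_k *: e k.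
    by apply: lext_wide; rewrite leq_maxr.
  rewrite E (le_trans (seminorm_sum _ _ _ _)) //.
  apply: (@le_trans _ _ (\sum_(k < B) `|u`_k| * p n (e k))).
    rewrite (big_ord_widen _ (fun k => `|u`_k| * p n (e k)) (leq_maxl B (size u))).
    rewrite [leRHS]big_mkcond ler_sum // => k _; rewrite seminormZ.
    by case: ltnP => // Bk; rewrite pl ?mulr0 //; exact: hB.
  rewrite mulr_suml ler_sum // => k _; rewrite mulrC ler_wpM2l ?seminorm_ge0 //.
  by rewrite (bigD1 k) //= lerDl sumr_ge0.
exists (\max_(k < n) l k)%N, (\sum_(k < n) C k) => u /=.
rewrite mulr_suml ler_sum // => k _; rewrite -level_coef (le_trans (fle _ _)) //.
rewrite ler_wpM2l // seminorm_incr //; exact: leq_bigmax.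
Qed.

End LevelData.

(** * The case of finite levels *)

Section UniversalSequence.
Variables (R : realType) (K : numFieldType) (io : real_form R K).

Lemma universal_sequence : exists s : nat -> K, forall n (v : nat -> K) e, 0 < e ->
  exists N, forall i, (i < n)%N -> `|s (N + i)%N - v i| <= e.
Proof.
have [d hd] := rf_separable io.
(* The [b]-th word of an enumeration is written from position [2 ^ b] on; each
   word [w] is listed with every tag [t], hence also at some [b] large enough
   for it to fit before [2 ^ b.+1]. *)
pose word b : seq nat := if unpickle b is Some (w, t) then (w, t : nat).1 else [::].
exists (fun k => d (nth 0%N (word (trunc_log 2 k)) (k - 2 ^ trunc_log 2 k)%N)).
move=> n v e e0.
have [w hw] : exists w : nat -> nat, forall i, `|d (w i) - v i| <= e.
  have [w hw] := choice (fun i => hd (v i) e e0).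
  by exists w => i; rewrite distrC.
pose W := mkseq w n.
have [t ht] : exists t : nat, (n <= pickle (W, t))%N.
  apply: (@injective_unbounded (fun t : nat => pickle (W, t))) => t t'.
  by move=> /(pcan_inj pickleK) [].
pose b := pickle (W, t); exists (2 ^ b)%N => i ni.
have nb : (i < 2 ^ b)%N by rewrite (leq_trans ni) // (leq_trans ht) // ltnW // ltn_expl.
have -> : trunc_log 2 (2 ^ b + i) = b.
  by apply: trunc_log_eq => //; rewrite leq_addr /= expnS mul2n -addnn ltn_add2l.
by rewrite addKn /word /b pickleK nth_mkseq.
Qed.

Let shift_form (s : nat -> K) i : {scalar {poly K}} :=
  lext (fun k => s (i + k)%N : K^o).

Lemma shift_formX s i k : shift_form s i 'X^k = s (i + k)%N.
Proof. by rewrite /shift_form /= lextX. Qed.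

Lemma polyX_total : total_family (fun k => 'X^k : {poly K}).
Proof. by move=> u; exists (size u), (nth 0 u); rewrite -poly_def coefK. Qed.

Lemma polyX_free m (a : nat -> K) : \sum_(n < m) a n *: ('X^n : {poly K}) = 0 ->
  forall n, (n < m)%N -> a n = 0.
Proof.
rewrite -poly_def => E n nm.
by have := congr1 (fun u : {poly K} => u`_n) E; rewrite coef_poly nm coef0.
Qed.

Section Model.
Variable s : nat -> K.
Hypothesis s_universal : forall n (v : nat -> K) e, 0 < e ->
  exists N, forall i, (i < n)%N -> `|s (N + i)%N - v i| <= e.
(* Multiplication by ['X] turns [shift_form s i] into [shift_form s i.+1]. *)
Let rho n := abs_sum (shift_form s) n.

Lemma model_incr n u : rho n u <= rho n.+1 u.
Proof. by rewrite /= big_ord_recr /= lerDl. Qed.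

(** A window of [s] close to the indicator of the degree of [u] yields a functional whose value at
    [u] is close to the leading coefficient. *)
Lemma model_sep u : (forall n, rho n u = 0) -> u = 0.
Proof.
move=> h; apply/eqP; apply/negPn/negP => u0.
have phi0 i : shift_form s i u = 0.
  apply/eqP; rewrite -normr_le0 -(h i.+1) /= (bigD1 ord_max) //= lerDl.
  by rewrite sumr_ge0.
pose D := (size u).-1.
have uD : u`_D != 0 by rewrite -lead_coefE lead_coef_eq0.
have uDpos : 0 < `|u`_D| by rewrite normr_gt0.
pose S := \sum_(k < size u) `|u`_k|.
have S0 : 0 <= S by rewrite sumr_ge0.
have S1 : 0 < S + 1 by rewrite ltr_wpDl.
have [N hN] := s_universal (size u) (fun k => (k == D)%:R)
  (divr_gt0 (divr_gt0 uDpos (ltr0Sn _ 1)) S1).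
have : `|u`_D| <= `|u`_D| / 2.
  have {1}-> : u`_D = \sum_(k < size u) u`_k * ((k == D :> nat)%:R - s (N + k)%N).
    have sD : (D < size u)%N by rewrite /D prednK // lt0n size_poly_eq0.
    transitivity (\sum_(k < size u) u`_k * (k == D :> nat)%:R - shift_form s N u).
      rewrite phi0 subr0 (bigD1 (Ordinal sD)) //= eqxx mulr1 big1 ?addr0 // => k.
      by rewrite -val_eqE /= => /negPf ->; rewrite mulr0.
    by rewrite /shift_form /= /lext -sumrB; apply: eq_bigr => k _; rewrite mulrBr.
  rewrite (le_trans (ler_norm_sum _ _ _)) //.
  apply: (@le_trans _ _ (S * (`|u`_D| / 2 / (S + 1)))).
    rewrite mulr_suml ler_sum // => k _; rewrite normrM ler_wpM2l // distrC.
    exact: hN.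
  rewrite mulrCA ger_pMr ?divr_gt0 ?ltr0n //.
  by rewrite ler_pdivrMr // mul1r lerDl.
by rewrite ler_pMr // invf_ge1 ?ltr0n // lern1.
Qed.

(** The functionals take the values [s (i + n)] on the orbit point ['X^n], so density of the orbit
    is the universality of [s]. *)
Lemma model_cyclic : strongly_cyclic rho.
Proof.
exists (lext (fun k => 'X^(k.+1) : {poly K})), 1.
have itX n : iter n (lext (fun k => 'X^(k.+1) : {poly K})) 1 = 'X^n.
  by elim: n => //= n ->; rewrite lextX.
split=> [n|z M e e0|u].
- exists n.+1, 1 => u; rewrite mul1r /= [leRHS]big_ord_recl /=.
  apply: (@le_trans _ _ (\sum_(k < n) `|shift_form s k.+1 u|)); last first.
    by rewrite /bump /= lerDr.
  apply: ler_sum => k _.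
  suff -> : shift_form s k (lext (fun k => 'X^(k.+1) : {poly K}) u) = shift_form s k.+1 u by [].
  rewrite /shift_form /= [lext _ u in LHS]/lext linear_sum /lext.
  by apply: eq_bigr => i _; rewrite linearZ /= lextX addnS.
- have [N hN] := s_universal M (fun i => shift_form s i z)
    (divr_gt0 e0 (ltr0Sn _ M)).
  exists N; rewrite itX /=.
  apply: (@le_trans _ _ (\sum_(k < M) e / M.+1%:R)).
    apply: ler_sum => k _; rewrite linearB shift_formX addnC; exact: hN.
  rewrite sumr_const card_ord -[leLHS]mulr_natr mulrAC ler_pdivrMr ?ltr0n //.
  by rewrite ler_wpM2l ?ler_nat // ltW.
by have [m [a ->]] := polyX_total u; exists m, a; apply: eq_bigr => n _; rewrite itX.
Qed.

(** [rho n] comes from [n] functionals, so some nontrivial combination of [n.+1] basis vectors has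
    [rho n] zero; if their levels were at most [n], its coordinates would be bounded by [rho n]. *)
Lemma model_finite_levels e f l C : level_data rho e f l C ->
  forall n, exists B, forall k, (B <= k)%N -> (n < l k)%N.
Proof.
move=> [te fe C0 fle pl] n.
suff [B hB] : exists B, forall k, (B <= k)%N -> ~ (l k <= n)%N.
  by exists B => k /hB /negP; rewrite -ltnNge.
apply: not_infinite_bound => inf.
have [k [kS kn]] := infinite_subseq inf.
have kI i i' : (k i == k i') = (i == i').
  case: (ltngtP i i') => [/kS|/kS|->]; rewrite ?eqxx //.
    by move=> h; rewrite ltn_eqF.
  by move=> h; rewrite gtn_eqF.
have [c [[i0 i0n ci0] h]] := dependent_family n (fun i j => shift_form s j (e (k i))).
pose u := \sum_(i < n.+1) c i *: e (k i).
have u0 : rho n u = 0.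
  rewrite /= big1 // => j _; rewrite linear_sum.
  under eq_bigr do rewrite linearZ.
  by rewrite (h j (ltn_ord j)) normr0.
have : f (k i0) u = c i0.
  rewrite /u linear_sum (bigD1 (Ordinal (i0n : (i0 < n.+1)%N))) //= linearZ /=.
  rewrite fe eqxx mulr1 big1 ?addr0 // => i; rewrite -val_eqE /= => /negPf ii0.
  by rewrite linearZ /= fe kI eq_sym ii0 mulr0.
move=> fc; move/negP: ci0; apply; rewrite -normr_le0 -fc (le_trans (fle _ _)) //.
rewrite (_ : rho _ u = 0) ?mulr0 //; apply: seminorm_le0; rewrite -u0.
exact: (seminorm_incr model_incr).
Qed.

End Model.

Lemma finite_levels_cyclic (V : lmodType K) (p : nat -> seminorm V) e f l C :
  (forall n u, p n u <= p n.+1 u) -> level_data p e f l C ->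
  (forall n, exists B, forall k, (B <= k)%N -> (n < l k)%N) -> strongly_cyclic p.
Proof.
move=> p_incr data fin; have [s hs] := universal_sequence.
have [e' [f' [l' [C' data']]]] :=
  level_basis io polyX_total polyX_free (model_incr s) (model_sep hs).
have fin' := model_finite_levels data'.
apply: seminormed_iso_cyclic (finite_levels_iso p_incr data fin) _.
apply: seminormed_iso_cyclic (model_cyclic hs).
apply: seminormed_iso_sym.
exact: (finite_levels_iso (model_incr s) data' fin').
Qed.

End UniversalSequence.

(** * The three cases *)

Section Cases.
Variables (R : realType) (K : numFieldType) (io : real_form R K).
Variables (V : lmodType K) (p : nat -> seminorm V) (e : nat -> V).
Variables (f : nat -> {scalar V}) (l : nat -> nat) (C : nat -> K).
Hypothesis p_incr : forall n u, p n u <= p n.+1 u.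
Hypothesis data : level_data p e f l C.

Definition infinite_level i := forall B, exists2 k, (B <= k)%N & l k = i.

(** Keep only the seminorms indexed by infinite levels [s i]. The new level of [k] is the least [i]
    with [l k <= s i], so every new level occurs infinitely often. *)
Lemma infinitely_many_levels_cyclic :
  (forall i0, exists2 i, (i0 <= i)%N & infinite_level i) -> strongly_cyclic p.
Proof.
move=> /infinite_subseq[s [sS sinf]].
have si i : (i <= s i)%N.
  by elim: i => // i IHi; exact: leq_ltn_trans IHi (sS _ _ (ltnSn i)).
have sle i j : (i <= j)%N -> (s i <= s j)%N.
  by rewrite leq_eqVlt => /orP[/eqP -> //|/sS /ltnW].
pose p' i := p (s i).
have [l' hl'] : exists l' : nat -> nat, forall k, (l k <= s (l' k))%N /\
    forall m, (m < l' k)%N -> (s m < l k)%N.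
  suff: {l' : nat -> nat & forall k, (l k <= s (l' k))%N /\
    forall m, (m < l' k)%N -> (s m < l k)%N} by case=> l' h; exists l'.
  apply: (@choice _ _ (fun k i => (l k <= s i)%N /\
    forall m, (m < i)%N -> (s m < l k)%N)) => k.
  have ex : exists i, (l k <= s i)%N by exists (l k).
  case: (ex_minnP ex) => i li imin; exists i; split=> // m mi.
  by rewrite ltnNge; apply/negP => /imin; rewrite leqNgt mi.
have [te fe C0 fle pl] := data.
have data' : level_data p' e f l' C.
  split=> // [k y|k m ml].
    rewrite (le_trans (fle _ _)) // ler_wpM2l // seminorm_incr //.
    by have [] := hl' k.
  by apply: pl; have [_] := hl' k; exact.
have p'_incr n u : p' n u <= p' n.+1 u by apply: (seminorm_incr p_incr); exact: sle.
have iso : seminormed_iso p' p.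
  exists (idfun : {linear V -> V}), idfun; split=> // n.
    by exists n, 1 => u; rewrite mul1r; exact: (seminorm_incr p_incr).
  by exists (s n), 1 => u; rewrite mul1r.
apply: seminormed_iso_cyclic iso _.
apply: (level_data_cyclic (@rf_archi _ _ io) (rf_separable io) p'_incr data').
right=> i n; have [k nk lk] := sinf i n; exists k => //.
have [h1 h2] := hl' k; apply/eqP; rewrite eqn_leq; apply/andP; split; rewrite leqNgt; apply/negP.
  by move=> /h2; rewrite lk ltnn.
by move=> /sS; rewrite ltnNge -lk h1.
Qed.

(** Without the first [M] seminorms, the first remaining one bounds every coordinate, and all levels
    become [0]. *)
Lemma bounded_levels_cyclic M : (forall k, (l k < M)%N) -> strongly_cyclic p.
Proof.
move=> lM; pose p' n := p (M + n)%N.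
have [te fe C0 fle pl] := data.
have data' : level_data p' e f (fun _ => 0%N) C.
  split=> // k y; rewrite (le_trans (fle _ _)) // ler_wpM2l // seminorm_incr //.
  by rewrite addn0 ltnW.
have p'_incr n u : p' n u <= p' n.+1 u.
  by apply: (seminorm_incr p_incr); rewrite leq_add2l.
have iso : seminormed_iso p' p.
  exists (idfun : {linear V -> V}), idfun; split=> // n.
    by exists n, 1 => u; rewrite mul1r; apply: (seminorm_incr p_incr); exact: leq_addl.
  by exists (M + n)%N, 1 => u; rewrite mul1r.
apply: seminormed_iso_cyclic iso _.
by apply: (level_data_cyclic (@rf_archi _ _ io) (rf_separable io) p'_incr data'); left.
Qed.

(** If there are infinite levels but only finitely many, and the levels are unbounded, [N] is the
    largest infinite level. *)
Lemma cyclic_or_tail : strongly_cyclic p \/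
  exists N, [/\ infinite_level N,
    forall i, (N < i)%N -> exists B, forall k, (B <= k)%N -> l k <> i &
    forall i, exists k, (i <= l k)%N].
Proof.
have [h|/existsNP[I hI]] :=
  pselect (forall i0, exists2 i, (i0 <= i)%N & infinite_level i).
  by left; exact: infinitely_many_levels_cyclic.
have fin i : ~ infinite_level i -> exists B, forall k, (B <= k)%N -> l k <> i.
  exact: not_infinite_bound.
have [hall|/existsNP[i1 hi1]] := pselect (forall i, ~ infinite_level i).
  left; apply: (finite_levels_cyclic io p_incr data) => n.
  elim: n => [|n [B hB]].
    have [B hB] := fin 0%N (hall 0%N); exists B => k /hB.
    by case: (l k).
  have [B' hB'] := fin n.+1 (hall n.+1); exists (maxn B B') => k.
  rewrite geq_max => /andP[/hB h1 /hB' /eqP h2].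
  by rewrite ltn_neqAle eq_sym h2.
have {}hi1 : infinite_level i1 by apply: contrapT.
have [[M hM]|hM] := pselect (exists M, forall k, (l k < M)%N).
  by left; exact: bounded_levels_cyclic hM.
right; have ex : exists i, `[< infinite_level i >] by exists i1; apply/asboolP.
have ub i : `[< infinite_level i >] -> (i <= I)%N.
  by move=> /asboolP hi; rewrite leqNgt; apply/negP => /ltnW Ii; apply: hI; exists i.
case: (ex_maxnP ex ub) => N /asboolP hN Nmax; exists N; split=> //.
  move=> i Ni; apply: fin => /asboolP /Nmax; by rewrite leqNgt Ni.
move=> i; apply: contrapT => /forallNP h; apply: hM; exists i => k.
by rewrite ltnNge; apply/negP; exact: h.
Qed.

End Cases.

(** * Quotients by kernels in a level basis *)

Lemma finite_dimensionalP (K : numFieldType) (V : lmodType K) :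
  finite_dimensional V <-> exists m (b : nat -> V), forall v,
    exists a : nat -> K, v = \sum_(i < m) a i *: b i.
Proof.
split=> [[B [/finite_seqP[s ->] Bs]]|[m [b hb]]].
  exists (size s), (nth 0 s) => v.
  have : lspan [set` s]%classic v by rewrite Bs.
  move=> [n [a [w [ws ->]]]].
  apply: (big_ind (fun v => exists a : nat -> K, v = \sum_(i < size s) a i *: nth 0 s i)).
  - by exists (fun _ => 0); rewrite big1 // => i _; rewrite scale0r.
  - move=> u u' [c ->] [c' ->]; exists (fun i => c i + c' i).
    by rewrite -big_split; apply: eq_bigr => i _; rewrite scalerDl.
  - move=> i _; have iw : (index (w i) s < size s)%N by rewrite index_mem; exact: ws.
    exists (fun k => if k == index (w i) s then a i else 0).
    rewrite (bigD1 (Ordinal iw)) //= eqxx nth_index; last exact: ws.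
    rewrite big1 ?addr0 // => k; rewrite -val_eqE /= => /negPf ->.
    by rewrite scale0r.
exists [set` mkseq b m]%classic; split; first by apply/finite_seqP; exists (mkseq b m).
apply/seteqP; split=> // v _; have [a ->] := hb v.
exists m, (fun i => a i), (fun i => b i); split=> // i.
by apply/mapP; exists (val i) => //; rewrite mem_iota /= add0n ltn_ord.
Qed.

Section QuotKerLinear.
Variables (K : numFieldType) (V : lmodType K) (p : seminorm V).

Fact quot_ker_pi_is_linear : linear (@quot_ker_pi K V p).
Proof. by move=> a u v; rewrite quot_ker_piD quot_ker_piZ. Qed.
HB.instance Definition _ := GRing.isLinear.Build K V (quot_ker p) *:%R
  (@quot_ker_pi K V p) quot_ker_pi_is_linear.

Lemma quot_ker_pi_eq u v : (quot_ker_pi p u = quot_ker_pi p v) <-> p (u - v) = 0.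
Proof.
by split=> [/eqP|h]; [|apply/eqP]; rewrite quot_ker_piP unfold_in /=;
  [move/eqP|apply/eqP].
Qed.

End QuotKerLinear.

Section Quotients.
Variables (K : numFieldType) (V : lmodType K) (p : nat -> seminorm V).
Variables (e : nat -> V) (f : nat -> {scalar V}) (l : nat -> nat) (C : nat -> K).
Hypothesis p_incr : forall n u, p n u <= p n.+1 u.
Hypothesis data : level_data p e f l C.

(** In an [m]-dimensional quotient [m.+1] basis vectors of level [N] would be dependent, but their
    coordinates are bounded by [p N]. *)
Lemma infinite_level_quot N : infinite_level l N ->
  ~ finite_dimensional (quot_ker (p N)).
Proof.
move=> inf /finite_dimensionalP[m [b hb]].
have [te fe C0 fle pl] := data.
have [k [kS kN]] := infinite_subseq inf.
have kI i i' : (k i == k i') = (i == i').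
  case: (ltngtP i i') => [/kS|/kS|->]; rewrite ?eqxx //.
    by move=> h; rewrite ltn_eqF.
  by move=> h; rewrite gtn_eqF.
have [A hA] := choice (fun i => hb (quot_ker_pi (p N) (e (k i)))).
have [c [[i0 i0n ci0] h]] := dependent_family m A.
pose u := \sum_(i < m.+1) c i *: e (k i).
have u0 : p N u = 0.
  rewrite -[u]subr0; apply/quot_ker_pi_eq; rewrite [RHS]linear0 linear_sum.
  under eq_bigr do rewrite linearZ /= hA scaler_sumr.
  rewrite exchange_big big1 // => j _.
  under eq_bigr do rewrite scalerA.
  by rewrite -scaler_suml h // scale0r.
have : f (k i0) u = c i0.
  rewrite /u linear_sum (bigD1 (Ordinal (i0n : (i0 < m.+1)%N))) //= linearZ /=.
  rewrite fe eqxx mulr1 big1 ?addr0 // => i; rewrite -val_eqE /= => /negPf ii0.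
  by rewrite linearZ /= fe kI eq_sym ii0 mulr0.
move=> fc; move/negP: ci0; apply; rewrite -normr_le0 -fc (le_trans (fle _ _)) //.
by rewrite kN u0 mulr0.
Qed.

(** A vector of [ker (p N)] has no coordinates at levels up to [N], and basis vectors above level
    [N.+1] lie in [ker (p N.+1)]; only the finitely many of level [N.+1] remain. *)
Lemma finite_level_ker_quot N : (exists B, forall k, (B <= k)%N -> l k <> N.+1) ->
  finite_dimensional (ker_quot_ker (p N) (p N.+1)).
Proof.
move=> [B hB]; have [te fe C0 fle pl] := data.
apply/finite_dimensionalP.
pose q := ker_restr (p N) (p N.+1).
have eker k : l k = N.+1 -> e k \in ker (p N).
  by move=> lk; rewrite unfold_in /= pl ?lk.
have [b hb] : exists b : nat -> kerT (p N), forall k, l k = N.+1 -> val (b k) = e k.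
  suff h k : exists v : kerT (p N), l k = N.+1 -> val v = e k.
    by have [b hb] := choice h; exists b.
  have [lk|lk] := eqVneq (l k) N.+1; last by exists 0 => lk'; rewrite lk' eqxx in lk.
  by exists (exist _ (e k) (eker k lk)).
exists B, (fun k => quot_ker_pi q (b k)) => w.
have [y ->] := quot_ker_pi_surj w.
have yN : p N (val y) = 0 by have := valP y; rewrite unfold_in => /eqP.
pose a k := if l k == N.+1 then f k (val y) else 0.
exists a.
have -> : \sum_(k < B) a k *: quot_ker_pi q (b k) =
    quot_ker_pi q (\sum_(k < B) a k *: b k).
  by rewrite linear_sum; apply: eq_bigr => k _; rewrite linearZ.
have valS : val (\sum_(k < B) a k *: b k) = \sum_(k < B) val (a k *: b k).
  exact: (raddf_sum (val : kerT (p N) -> V)).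
apply/quot_ker_pi_eq; change (p N.+1 (val y - val (\sum_(k < B) a k *: b k)) = 0).
rewrite valS.
have [m [c yc]] := te (val y).
have cf k : (k < m)%N -> f k (val y) = c k.
  move=> km; rewrite yc linear_sum (bigD1 (Ordinal km)) //= linearZ /= fe eqxx mulr1.
  rewrite big1 ?addr0 // => i; rewrite -val_eqE /= => /negPf ik.
  by rewrite linearZ /= fe eq_sym ik mulr0.
have cf0 k : (m <= k)%N -> f k (val y) = 0.
  move=> mk; rewrite yc linear_sum big1 // => i _.
  by rewrite linearZ /= fe gtn_eqF ?mulr0 // (leq_trans (ltn_ord i)).
have fN k : (l k <= N)%N -> f k (val y) = 0.
  move=> lk; apply/eqP; rewrite -normr_le0 (le_trans (fle _ _)) //.
  by rewrite (seminorm_incr0 p_incr lk yN) mulr0.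
pose M := maxn m B.
have -> : val y = \sum_(k < M) f k (val y) *: e k.
  rewrite {1}yc (big_ord_widen _ (fun k => c k *: e k) (leq_maxl m B)) big_mkcond.
  apply: eq_bigr => k _; case: ltnP => [km|mk]; first by rewrite cf.
  by rewrite cf0 // scale0r.
have -> : \sum_(k < B) val (a k *: b k) = \sum_(k < M) a k *: e k.
  rewrite (big_ord_widen _ (fun k => val (a k *: b k)) (leq_maxr m B)) big_mkcond.
  apply: eq_bigr => k _; rewrite /a; case: eqP => [lk|_]; last first.
    by rewrite !scale0r raddf0; case: ifP.
  case: ltnP => [_|Bk]; last by case: (hB _ Bk).
  by rewrite linearZ /= hb.
rewrite -sumrB; apply: seminorm_sum0 => k _.
rewrite -scalerBl /a; case: eqP => [_|lk]; first by rewrite subrr scale0r seminorm0.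
rewrite subr0; have [lkN|Nlk] := leqP (l k) N; first by rewrite fN // scale0r seminorm0.
by apply/seminormZ0/pl; rewrite ltn_neqAle Nlk andbT eq_sym; apply/eqP.
Qed.

Lemma level_ker_quot k N : l k = N.+1 ->
  exists u : ker_quot_ker (p N) (p N.+1), u != 0.
Proof.
move=> lk; have [te fe C0 fle pl] := data.
have ek : e k \in ker (p N) by rewrite unfold_in /= pl ?lk.
exists (quot_ker_pi _ (exist _ (e k) ek : kerT (p N))).
rewrite -[0](linear0 (@quot_ker_pi _ _ (ker_restr (p N) (p N.+1)))).
apply/eqP => /quot_ker_pi_eq; rewrite subr0 /= => pk.
have := fle k (e k); rewrite lk pk mulr0 fe eqxx normr1.
by rewrite ler10.
Qed.

End Quotients.

(** * Seminorms defining a metrizable topology *)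

Local Open Scope classical_set_scope.
Local Open Scope ring_scope.

Section Gauge.
Variables (R : realType) (K : numFieldType) (io : real_form R K) (V : lmodType K).
Variable W : set V.
Hypothesis W_bal : forall (a : K) x, `|a| <= 1 -> W x -> W (a *: x).
Hypothesis W_conv : forall (t : K) x y, 0 <= t -> t <= 1 -> W x -> W y ->
  W (t *: x + (1 - t) *: y).
Hypothesis W_abs : forall x, exists t : R, 0 < t /\ W ((io t)^-1 *: x).

Definition gauge_set x : set R := [set t | 0 < t /\ W ((io t)^-1 *: x)].
(** The Minkowski functional, taken in [R] where infima exist and carried to [K] by [io]
    afterwards. *)
Definition gauge x : R := inf (gauge_set x).

Let io_gt0 t : (0 < io t) = (0 < t). Proof. by rewrite -(rmorph0 io) rf_lt. Qed.
Let io_neq0 t : 0 < t -> io t != 0. Proof. by move=> t0; rewrite gt_eqF // io_gt0. Qed.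

Lemma gauge_has_inf x : has_inf (gauge_set x).
Proof.
by split; [have [t ht] := W_abs x; exists t|exists 0 => t [/ltW]].
Qed.

Lemma gauge_ge0 x : 0 <= gauge x.
Proof.
by apply: lb_le_inf; [have [] := gauge_has_inf x|move=> t [/ltW]].
Qed.

Lemma gauge_le x t : gauge_set x t -> gauge x <= t.
Proof. by move=> h; apply: ge_inf => //; have [] := gauge_has_inf x. Qed.

Lemma gauge_lt x t : gauge x < t -> exists2 s, gauge_set x s & s < t.
Proof. by move=> h; apply: inf_lt h; have [] := gauge_has_inf x. Qed.

Lemma gaugeD x y : gauge (x + y) <= gauge x + gauge y.
Proof.
apply/ler_addgt0Pr => e e0.
have e2 : 0 < e / 2 by rewrite divr_gt0.
have [s [s0 Ws] sx] : exists2 s, gauge_set x s & s < gauge x + e / 2.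
  by apply: gauge_lt; rewrite ltrDl.
have [t [t0 Wt] ty] : exists2 t, gauge_set y t & t < gauge y + e / 2.
  by apply: gauge_lt; rewrite ltrDl.
have st0 : 0 < s + t by rewrite addr_gt0.
have /gauge_le /le_trans : gauge_set (x + y) (s + t).
  split=> //.
  have -> : (io (s + t))^-1 *: (x + y) = io (s / (s + t)) *: ((io s)^-1 *: x) +
      (1 - io (s / (s + t))) *: ((io t)^-1 *: y).
    rewrite !scalerA scalerDr -(rmorph1 io) -rmorphB -!fmorphV -!rmorphM.
    have [s_ t_ st_] : [/\ s != 0, t != 0 & s + t != 0] by rewrite !gt_eqF.
    by congr (io _ *: _ + io _ *: _); field; rewrite ?s_ ?t_ ?st_.
  apply: W_conv => //.
    by rewrite rf_pos divr_ge0 // ltW.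
  by rewrite -(rmorph1 io) rf_le ler_pdivrMr // mul1r lerDl ltW.
apply; rewrite [e]splitr addrACA; exact: ltW (ltrD sx ty).
Qed.

Lemma gauge0 : gauge 0 = 0.
Proof.
apply/eqP; rewrite eq_le gauge_ge0 andbT; apply/ler_addgt0Pl => e e0.
rewrite addr0; apply: gauge_le; split=> //; rewrite scaler0.
have [t [_ Wt]] := W_abs 0; rewrite -(scale0r ((io t)^-1 *: (0 : V))).
by apply: W_bal; rewrite ?normr0.
Qed.

Lemma gaugeZ_le (a : K) (b : R) x : a != 0 -> `|a| = io b -> gauge (a *: x) <= b * gauge x.
Proof.
move=> a0 ab; have b0 : 0 < b by rewrite -io_gt0 -ab normr_gt0.
rewrite mulrC -ler_pdivrMr //; apply: lb_le_inf; first by have [] := gauge_has_inf x.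
move=> t [t0 Wt]; rewrite ler_pdivrMr //; apply: gauge_le; split.
  by rewrite mulr_gt0.
have -> : (io (t * b))^-1 *: (a *: x) = (a / `|a|) *: ((io t)^-1 *: x).
  rewrite !scalerA rmorphM -ab; congr (_ *: _).
  have := io_neq0 t0; have : `|a| != 0 by rewrite normr_eq0.
  by move=> *; field; apply/andP.
by apply: W_bal => //; rewrite normrM normfV normr_id mulfV // normr_eq0.
Qed.

Lemma gaugeZ (a : K) x : io (gauge (a *: x)) = `|a| * io (gauge x).
Proof.
have [b ab] := rf_ge0 io (normr_ge0 a).
have [->|a0] := eqVneq a 0; first by rewrite scale0r gauge0 normr0 mul0r rmorph0.
have b0 : 0 < b by rewrite -io_gt0 -ab normr_gt0.
rewrite ab -rmorphM; congr (io _); apply/eqP; rewrite eq_le gaugeZ_le //=.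
rewrite mulrC -ler_pdivlMr //.
have aV : `|a^-1| = io b^-1 by rewrite normfV ab fmorphV.
have := @gaugeZ_le a^-1 b^-1 (a *: x) _ aV; rewrite invr_eq0 a0 => /(_ isT).
by rewrite scalerA mulVf // scale1r mulrC.
Qed.

Definition gauge_seminorm : seminorm V.
Proof.
apply: (@Seminorm K V (fun x => io (gauge x))).
- by move=> x; rewrite rf_pos gauge_ge0.
- by move=> x y; rewrite -rmorphD rf_le gaugeD.
- exact: gaugeZ.
Defined.

Lemma gauge_seminorm_lt1 x : gauge_seminorm x < 1 -> W x.
Proof.
rewrite /= -(rmorph1 io) rf_lt => /gauge_lt[t [t0 Wt] t1].
rewrite -[x]scale1r -(mulfV (io_neq0 t0)) -scalerA; apply: W_bal => //.
by rewrite rf_norm -(rmorph1 io) rf_le gtr0_norm // ltW.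
Qed.

Lemma gauge_seminorm_le t x : 0 < t -> W ((io t)^-1 *: x) -> gauge_seminorm x <= io t.
Proof. by move=> t0 Wt; rewrite /= rf_le; apply: gauge_le. Qed.

End Gauge.

Section TvsSeminorms.
Variables (R : realType) (K : numFieldType) (io : real_form R K) (E : tvsType K).

Lemma nbhs0_translate (x : E) (A : set E) :
  nbhs x A <-> nbhs (0 : E) [set y | A (x + y)].
Proof.
split=> [/(nbhsB (- x))|/(nbhsT x)].
  rewrite addNr; apply: filterS => _ [y Ay <-] /=.
  by rewrite addrA subrr add0r.
by apply: filterS => _ [y Ay <-].
Qed.

Lemma scale_near0 (x : E) (U : set E) : nbhs 0 U ->
  exists2 d : R, 0 < d & exists2 B : set E, nbhs x B &
    forall (a : K) y, `|a| < io d -> B y -> U (a *: y).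
Proof.
move=> U0; have := @scale_continuous K E (0, x) U.
rewrite /= scale0r => /(_ U0)[] /= B [/nbhs_ballP[d /= d0 dB] B2] BU.
have [s ds] := rf_ge0 io (ltW d0).
exists s; first by rewrite -(rf_lt io) rmorph0 -ds.
exists B.2 => // a y ad By; apply: (BU (a, y)); split=> //=.
by apply: dB; rewrite -ball_normE /= sub0r normrN ds.
Qed.

Lemma seminorm_in_nbhs0 (U : set E) : nbhs 0 U ->
  exists2 p : seminorm E, (forall x, p x < 1 -> U x) &
    forall e, 0 < e -> nbhs 0 [set x | p x < e].
Proof.
move=> U0; have [B Bconv [Bopen Bbasis]] := @locally_convex K E.
have [b [Bb b0] bU] := Bbasis 0 U U0.
have nb : nbhs 0 b by apply: open_nbhs_nbhs; split=> //; exact: Bopen.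
(* The balanced core of the convex set [b]: absolute homogeneity of the gauge requires balancedness,
   and convexity is inherited. *)
pose W : set E := [set x | forall a : K, `|a| <= 1 -> b (a *: x)].
have W_bal (a : K) x : `|a| <= 1 -> W x -> W (a *: x).
  move=> a1 Wx c c1; rewrite scalerA; apply: Wx.
  by rewrite normrM mulr_ile1.
have bconv (t : K) x y : 0 <= t -> t <= 1 -> b x -> b y -> b (t *: x + (1 - t) *: y).
  move=> t0 t1 bx byy.
  have := Bconv b (mem_set Bb) x y (Itv01 t0 t1) (mem_set bx) (mem_set byy).
  by rewrite inE.
have W_conv (t : K) x y : 0 <= t -> t <= 1 -> W x -> W y -> W (t *: x + (1 - t) *: y).
  move=> t0 t1 Wx Wy a a1; rewrite scalerDr !scalerA ![a * _]mulrC -!scalerA.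
  by apply: bconv => //; [exact: Wx|exact: Wy].
have half (d : R) : 0 < d -> [/\ 0 < d / 2, io (d / 2) != 0 & io (d / 2) < io d].
  move=> d0; have d2 : 0 < d / 2 by rewrite divr_gt0.
  split=> //; first by rewrite fmorph_eq0 gt_eqF.
  by rewrite rf_lt gtr_pMr // invf_lt1 // ltr1n.
have W0 : nbhs 0 W.
  have [d d0 [B1 B0 dB]] := scale_near0 0 nb.
  have [d2 d2_neq0 d2d] := half d d0.
  apply: filterS (nbhs0Z d2_neq0 B0) => _ [y By <-] a a1.
  rewrite scalerA; apply: dB => //; rewrite normrM (le_lt_trans _ d2d) //.
  by rewrite rf_norm (gtr0_norm d2) ler_piMl // rf_pos ltW.
have W_abs x : exists t : R, 0 < t /\ W ((io t)^-1 *: x).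
  have [d d0 [B1 Bx dB]] := scale_near0 x W0.
  have [d2 d2_neq0 d2d] := half d d0.
  exists (d / 2)^-1; split; first by rewrite invr_gt0.
  rewrite fmorphV invrK; apply: dB; last exact: nbhs_singleton.
  by rewrite rf_norm gtr0_norm.
exists (gauge_seminorm W_bal W_conv W_abs).
  move=> x /gauge_seminorm_lt1 Wx; apply: bU; rewrite -[x]scale1r; apply: Wx.
  by rewrite normr1.
move=> e e0; have [d ed] := rf_ge0 io (ltW e0).
have d0 : 0 < d by rewrite -(rf_lt io) rmorph0 -ed.
have [d2 d2_neq0 d2d] := half d d0.
apply: filterS (nbhs0Z d2_neq0 W0) => _ [y Wy <-] /=.
rewrite ed; apply: le_lt_trans d2d.
apply: (gauge_seminorm_le W_bal W_conv W_abs d2).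
by rewrite scalerA mulVf // scale1r.
Qed.

End TvsSeminorms.

Section MetrizableSeminorms.
Variables (R : realType) (K : numFieldType) (io : real_form R K) (E : tvsType K).

Definition seminorm_add (p q : seminorm E) : seminorm E.
Proof.
apply: (@Seminorm K E (fun x => p x + q x)).
- by move=> x; rewrite addr_ge0 ?seminorm_ge0.
- by move=> x y; rewrite addrACA lerD ?seminormD.
- by move=> a x; rewrite !seminormZ mulrDr.
Defined.

Fixpoint partial_sum (r : nat -> seminorm E) n : seminorm E :=
  if n is m.+1 then seminorm_add (partial_sum r m) (r n) else r 0%N.

Lemma partial_sum_incr (r : nat -> seminorm E) n x : partial_sum r n x <= partial_sum r n.+1 x.
Proof. by rewrite /= lerDl seminorm_ge0. Qed.

Lemma le_partial_sum (r : nat -> seminorm E) n x : r n x <= partial_sum r n x.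
Proof. by case: n => //= n; rewrite lerDr seminorm_ge0. Qed.

Lemma metrizable_basis0 : metrizable R E -> exists U : nat -> set E,
  [/\ forall n, nbhs 0 (U n), (forall A, nbhs 0 A -> exists n, U n `<=` A) &
      forall x, (forall n, U n x) -> x = 0].
Proof.
move=> [M [f [g [fK gK fc gc]]]].
exists (fun n => f @^-1` ball (f 0) n.+1%:R^-1); split.
- by move=> n; apply: (fc 0); apply: nbhsx_ballx; rewrite invr_gt0.
- move=> A A0; have := gc (f 0) A; rewrite fK => /(_ A0).
  move=> /nbhs_ballP[e /= e0 eA].
  have [n hn] : exists n, n.+1%:R^-1 < e.
    by exists (Num.truncn e^-1); rewrite invf_plt ?posrE // truncnS_gt.
  exists n => x fx; have /= := eA (f x); rewrite fK; apply.
  by apply: le_ball fx; exact: ltW.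
move=> x hx; apply: (can_inj fK); apply/esym/(@mdist_positivity R M).
apply/eqP; rewrite eq_le mdist_ge0 andbT leNgt; apply/negP => d0.
have [n hn] : exists n, n.+1%:R^-1 < mdist (f 0) (f x).
  by exists (Num.truncn (mdist (f 0) (f x))^-1); rewrite invf_plt ?posrE // truncnS_gt.
by have := hx n; rewrite /= ballEmdist /= ltNge (ltW hn).
Qed.

Lemma metrizable_seminorms : metrizable R E -> exists p : nat -> seminorm E,
  [/\ forall n x, p n x <= p n.+1 x, (forall x, (forall n, p n x = 0) -> x = 0) &
      seminorms_define_topology p].
Proof.
move=> /metrizable_basis0[U [U0 Ub Us]].
have [r hr] : exists r : nat -> seminorm E, forall n,
    (forall x, r n x < 1 -> U n x) /\ forall e, 0 < e -> nbhs 0 [set x | r n x < e].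
  have ex n : exists q : seminorm E, (forall x, q x < 1 -> U n x) /\
      forall e, 0 < e -> nbhs 0 [set x | q x < e].
    by have [q] := seminorm_in_nbhs0 io (U0 n); exists q.
  by have [r hr] := choice ex; exists r.
pose p := partial_sum r.
have p_incr n x : p n x <= p n.+1 x by exact: partial_sum_incr.
have p0 n e : 0 < e -> nbhs 0 [set x | p n x < e].
  elim: n e => [|n IHn] e e0; first by have [_] := hr 0%N; apply.
  have e2 : 0 < e / 2 by rewrite divr_gt0.
  have [_ /(_ _ e2) rn] := hr n.+1.
  apply: filterS (filterI (IHn _ e2) rn) => x [/= h1 h2].
  by rewrite [e]splitr ltrD.
have pU n x : p n x < 1 -> U n x.
  have [h _] := hr n; move=> p1; apply: h; apply: le_lt_trans p1.
  exact: le_partial_sum.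
exists p; split=> // [x px|x A].
  by apply: Us => n; apply: pU; rewrite px.
rewrite nbhs0_translate; split=> [/Ub[n UA]|[s [e [e0 sA]]]].
  exists [:: n], 1; split=> // y /(_ n (mem_head _ _)) /pU /UA /=.
  by rewrite addrC subrK.
suff h : nbhs 0 [set y | forall i, i \in s -> p i y < e].
  by apply: filterS h => y hy; apply: sA => i /hy; rewrite /= addrAC subrr add0r.
elim: (s) => [|i t IHt]; first by apply: filterS filterT => y _ i; rewrite in_nil.
apply: filterS (filterI (p0 i e e0) IHt) => y [/= h1 h2] k.
by rewrite inE => /orP[/eqP -> //|/h2].
Qed.

End MetrizableSeminorms.

(** * From seminorm estimates to the topology *)

Section DefiningSeminorms.
Variables (K : numFieldType) (E : tvsType K) (p : nat -> seminorm E).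
Hypothesis p_incr : forall n x, p n x <= p n.+1 x.
Hypothesis p_top : seminorms_define_topology p.

Lemma seminorm_nbhsP (x : E) (A : set E) : nbhs x A <->
  exists n e, 0 < e /\ forall y, p n (y - x) < e -> A y.
Proof.
rewrite p_top; split=> [[s [e [e0 sA]]]|[n [e [e0 nA]]]].
  have [M hM] := maxn_bound s id.
  exists M, e; split=> // y yM; apply: sA => i /hM iM.
  by apply: le_lt_trans yM; exact: (seminorm_incr p_incr).
by exists [:: n], e; split=> // y /(_ n (mem_head _ _)); exact: nA.
Qed.

Lemma seminorm_continuous (T : {linear E -> E}) :
  (forall n, exists m c, forall u, p n (T u) <= c * p m u) -> continuous T.
Proof.
move=> hT x A /seminorm_nbhsP[n [e [e0 nA]]]; have [m [c mc]] := hT n.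
have c1 : 0 < `|c| + 1 by rewrite ltr_wpDl.
apply/seminorm_nbhsP; exists m, (e / (`|c| + 1)); split; first by rewrite divr_gt0.
move=> y ym; apply: nA; rewrite -linearB.
rewrite (le_lt_trans (le_norm_mul _ _ (mc _))) ?seminorm_ge0 //.
rewrite (@le_lt_trans _ _ ((`|c| + 1) * p m (y - x))) //.
  by rewrite ler_wpM2r ?seminorm_ge0 // lerDl.
by rewrite mulrC -ltr_pdivlMr.
Qed.

(** On [ker (p m)] all multiples of [u] are mapped into the unit ball of [p n], which forces
    [p n (T u)] to vanish. *)
Lemma continuous_seminorm0 (T : {linear E -> E}) n : continuous T ->
  exists m, forall u, p m u = 0 -> p n (T u) = 0.
Proof.
move=> Tc; have := Tc 0 [set y | p n y < 1].
have h0 : nbhs (T 0) [set y | p n y < 1].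
  by rewrite linear0; apply/seminorm_nbhsP; exists n, 1; split=> // y; rewrite subr0.
move=> /(_ h0)/seminorm_nbhsP[m [e [e0 mA]]]; exists m => u u0.
apply/eqP; apply/negPn/negP => Tu.
have := mA ((p n (T u))^-1 *: u); rewrite subr0 seminormZ u0 mulr0 => /(_ e0) /=.
rewrite linearZ seminormZ ger0_norm ?invr_ge0 ?seminorm_ge0 //.
by rewrite mulVf // ltxx.
Qed.

Lemma strongly_cyclic_orbital : strongly_cyclic p -> strongly_orbital E.
Proof.
move=> [T [x [Tc Td Tt]]]; exists T, x; split.
- exact: seminorm_continuous.
- move=> O [z Oz] Oopen.
  have /seminorm_nbhsP[n [e [e0 nO]]] : nbhs z O by apply: open_nbhs_nbhs.
  have [k hk] := Td z n _ (divr_gt0 e0 (ltr0Sn _ 1)).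
  exists (iter k T x); split; last by exists k.
  by apply: nO; apply: le_lt_trans hk _; rewrite gtr_pMr // invf_lt1 ?ltr1n ?ltr0n.
apply/seteqP; split=> // v _; have [m [a ->]] := Tt v.
by exists m, (fun i => a i), (fun i => iter i T x); split=> // i; exists (i : nat).
Qed.

End DefiningSeminorms.

Lemma lspan_orbit_total (K : numFieldType) (E : tvsType K) (T : {linear E -> E}) (x : E) :
  lspan (op_orbit T x) = [set: E] -> total_family (fun n => iter n T x).
Proof.
move=> h v; have : lspan (op_orbit T x) v by rewrite h.
move=> [n [a [w [ws ->]]]]; apply: in_span_sum => i _; apply: in_spanZ.
by have [k _ <-] := ws i; exact: (in_span_mem (fun n => iter n T x)).
Qed.

Lemma countable_dim_basis (K : numFieldType) (E : tvsType K) :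
  countably_infinite_dimensional E -> exists x : nat -> E, total_family x /\
    forall m (a : nat -> K), \sum_(n < m) a n *: x n = 0 ->
      forall n, (n < m)%N -> a n = 0.
Proof.
move=> [B [[Bind Bspan] Bcard]].
have /card_set_bijP[f [_ fI fS]] := Bcard.
  have ex n : exists y, B y /\ f y = n.
    by have [y By <-] := fS n I; exists y.
  have [x hx] := choice ex.
exists x; split=> [v|m a h n nm].
  have : lspan B v by rewrite Bspan.
  move=> [n [a [w [ws ->]]]]; apply: in_span_sum => i _; apply: in_spanZ.
  have -> : w i = x (f (w i)).
    have [xB xf] := hx (f (w i)).
    by apply: fI; rewrite ?xf //; apply: mem_set.
  exact: in_span_mem.
apply: (Bind m (fun i => a i) (fun i => x i) _ _ h (Ordinal nm)).
  by move=> i i' /(congr1 f); rewrite (hx i).2 (hx i').2; apply: val_inj.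
by move=> i; exact: (hx i).1.
Qed.

Lemma free_not_finite_dim (K : numFieldType) (V : lmodType K) (x : nat -> V) :
  (forall m (a : nat -> K), \sum_(n < m) a n *: x n = 0 ->
      forall n, (n < m)%N -> a n = 0) -> ~ finite_dimensional V.
Proof.
move=> xf /finite_dimensionalP[m [b hb]].
have [A hA] := choice (fun i => hb (x i)).
have [c [[i0 i0n ci0] h]] := dependent_family m A.
move: ci0; rewrite (xf m.+1 c _ i0 i0n) ?eqxx //.
under eq_bigr do rewrite hA scaler_sumr.
rewrite exchange_big big1 // => j _.
under eq_bigr do rewrite scalerA.
by rewrite -scaler_suml h // scale0r.
Qed.

(** * M2 excludes orbital operators *)

Section PrefixSpan.
Variables (K : numFieldType) (V : lmodType K) (x : nat -> V).
Implicit Types (p q : seminorm V) (d : nat) (u w z : V).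

Definition prefix_span d u := exists a : nat -> K, u = \sum_(i < d) a i *: x i.

Lemma prefix_span_le d d' u : (d <= d')%N -> prefix_span d u -> prefix_span d' u.
Proof.
move=> dd [a ->]; rewrite (in_span_sum_le x a dd).
by exists (fun k => if (k < d)%N then a k else 0).
Qed.

Lemma prefix_spanD d u w : prefix_span d u -> prefix_span d w -> prefix_span d (u + w).
Proof.
move=> [a ->] [b ->]; exists (fun k => a k + b k).
by rewrite -big_split; apply: eq_bigr => k _; rewrite scalerDl.
Qed.

Lemma prefix_spanZ d c u : prefix_span d u -> prefix_span d (c *: u).
Proof.
move=> [a ->]; exists (fun k => c * a k).
by rewrite scaler_sumr; apply: eq_bigr => k _; rewrite scalerA.
Qed.

Lemma prefix_span0 d : prefix_span d 0.
Proof. by exists (fun _ => 0); rewrite big1 // => i _; rewrite scale0r. Qed.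

Lemma prefix_span_mem d i : (i < d)%N -> prefix_span d (x i).
Proof.
move=> id; exists (fun k => (k == i)%:R).
rewrite (bigD1 (Ordinal id)) //= eqxx scale1r big1 ?addr0 // => k.
by rewrite -val_eqE /= => /negPf ->; rewrite scale0r.
Qed.

(** Equality in [V / ker q] with a prefix combination, expressed in [V] itself. *)
Definition prefix_mod q d u := exists2 z, prefix_span d z & q (u - z) = 0.

Lemma prefix_mod_sum q d (I : Type) (r : seq I) (P : pred I) (a : I -> K) (f : I -> V) :
  (forall i, P i -> prefix_mod q d (f i)) ->
  prefix_mod q d (\sum_(i <- r | P i) a i *: f i).
Proof.
move=> h; apply: (big_ind (prefix_mod q d)) => [|u w [z zd uz] [z' zd' wz]|i /h[z zd iz]].
- by exists 0; [exact: prefix_span0|rewrite subr0 seminorm0].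
- exists (z + z'); first exact: prefix_spanD.
  by rewrite opprD addrACA; exact: seminormD0.
- by exists (a i *: z); [exact: prefix_spanZ|rewrite -scalerBr; exact: seminormZ0].
Qed.

Lemma prefix_modD q d u w : prefix_mod q d u -> prefix_mod q d w -> prefix_mod q d (u + w).
Proof.
move=> [z zd uz] [z' zd' wz]; exists (z + z'); first exact: prefix_spanD.
by rewrite opprD addrACA; exact: seminormD0.
Qed.

Lemma prefix_mod_le q d d' u : (d <= d')%N -> prefix_mod q d u -> prefix_mod q d' u.
Proof. by move=> dd [z zd uz]; exists z => //; exact: prefix_span_le zd. Qed.

Lemma prefix_mod_mem q d i : (i < d)%N -> prefix_mod q d (x i).
Proof. by move=> id; exists (x i); [exact: prefix_span_mem|rewrite subrr seminorm0]. Qed.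

Lemma prefix_mod_ker q d u : q u = 0 -> prefix_mod q d u.
Proof. by exists 0; [exact: prefix_span0|rewrite subr0]. Qed.

Lemma prefix_mod_finite_dim q d :
  (forall u, prefix_mod q d u) -> finite_dimensional (quot_ker q).
Proof.
move=> h; apply/finite_dimensionalP; exists d, (fun i => quot_ker_pi q (x i)) => v.
have [u ->] := quot_ker_pi_surj v; have [z [a ->] uz] := h u.
exists a; transitivity (quot_ker_pi q (\sum_(i < d) a i *: x i)).
  exact/quot_ker_pi_eq.
by rewrite linear_sum; apply: eq_bigr => i _; rewrite linearZ.
Qed.

Hypothesis x_total : total_family x.

Lemma prefix_span_bound n (w : nat -> V) :
  exists d, forall i, (i < n)%N -> prefix_span d (w i).
Proof.
elim: n => [|n [d hd]]; first by exists 0%N.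
have [m wm] := x_total (w n); exists (maxn d m) => i; rewrite ltnS leq_eqVlt.
move=> /orP[/eqP ->|/hd]; first exact: (prefix_span_le (leq_maxr d m)).
exact/prefix_span_le/leq_maxl.
Qed.

Lemma ker_quot_prefix p q : finite_dimensional (ker_quot_ker p q) ->
  exists d, forall u, p u = 0 -> prefix_mod q d u.
Proof.
move=> /finite_dimensionalP[m [b hb]].
have [w hw] : exists w : nat -> kerT p, forall i, b i = quot_ker_pi _ (w i).
  by have [w hw] := choice (fun i => quot_ker_pi_surj (b i)); exists w.
have [d hd] := prefix_span_bound m (fun i => val (w i)).
exists d => u u0; have uk : u \in ker p by rewrite unfold_in u0.
have [a ha] := hb (quot_ker_pi _ (exist _ u uk : kerT p)).
pose s : kerT p := \sum_(i < m) a i *: w i.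
have us : q (u - val s) = 0.
  have /quot_ker_pi_eq // : quot_ker_pi (ker_restr p q) (exist _ u uk) =
    quot_ker_pi (ker_restr p q) s.
  by rewrite ha linear_sum; apply: eq_bigr => i _; rewrite linearZ hw.
exists (val s) => //; rewrite (raddf_sum (val : kerT p -> V)).
apply: (big_ind (prefix_span d)); [exact: prefix_span0|exact: prefix_spanD|].
by move=> i _; change (prefix_span d (a i *: val (w i))); apply/prefix_spanZ/hd.
Qed.

Variable p : nat -> seminorm V.
Hypothesis p_incr : forall n u, p n u <= p n.+1 u.

(** Each finite dimensional step of the chain contributes finitely many lifts, and totality of [x]
    puts these in one prefix span. *)
Lemma ker_chain_prefix M :
  (forall n, finite_dimensional (ker_quot_ker (p n) (p n.+1))) ->
  exists d, forall u, p 0 u = 0 -> prefix_mod (p M) d u.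
Proof.
move=> fin; elim: M => [|M [d hd]].
  by exists 0%N => u; exact: prefix_mod_ker.
have [d' hd'] := ker_quot_prefix (fin M); exists (maxn d d') => u /hd[z zd uz].
rewrite -[u](subrK z); apply: prefix_modD.
  exact: prefix_mod_le (leq_maxr _ _) (hd' _ uz).
exists z; last by rewrite subrr seminorm0.
exact: prefix_span_le (leq_maxl _ _) zd.
Qed.

(** Vectors of [ker (p (s i))] outside [ker (p (s i).+1)] are independent, since [p (s i).+1]
    isolates the first nonzero coefficient of a relation; so no prefix span contains [ker (p 0)]. *)
Lemma ker_not_prefix d :
  (forall N, exists2 n, (N <= n)%N & exists u : ker_quot_ker (p n) (p n.+1), u != 0) ->
  exists2 u, p 0 u = 0 & ~ prefix_span d u.
Proof.
move=> inf; apply: contrapT => hn.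
have sub u : p 0 u = 0 -> prefix_span d u.
  by move=> u0; apply: contrapT => ud; apply: hn; exists u.
have [s [sS hs]] := infinite_subseq inf.
have ex i : exists u, p (s i) u = 0 /\ p (s i).+1 u <> 0.
  have [v v0] := hs i; have [u uv] := quot_ker_pi_surj v; exists (val u).
  split; first by have := valP u; rewrite unfold_in => /eqP.
  move=> h; move/eqP: v0; apply; rewrite uv -(linear0 (quot_ker_pi _)).
  by apply/quot_ker_pi_eq; rewrite subr0.
have [u hu] := choice ex.
have up i : prefix_span d (u i).
  by apply: sub; apply: (seminorm_incr0 p_incr) (leq0n _) (hu i).1.
have [A hA] := choice up.
have [c [[i0 i0d ci0] h]] := dependent_family d A.
have ex_c : exists i, (i <= d)%N && (c i != 0) by exists i0; rewrite i0d.
case: (ex_minnP ex_c) => i /andP[id ci] imin.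
apply: (hu i).2; apply/eqP; have := seminormZ (p (s i).+1) (c i) (u i).
have sum0 : \sum_(k < d.+1) c k *: u k = 0.
  under eq_bigr do rewrite hA scaler_sumr.
  rewrite exchange_big big1 // => j _.
  under eq_bigr do rewrite scalerA.
  by rewrite -scaler_suml h // scale0r.
move: sum0; rewrite (bigD1 (Ordinal (id : (i < d.+1)%N))) //= => /eqP.
rewrite addr_eq0 => /eqP ->.
rewrite seminormN seminorm_sum0; last first.
  move=> k; rewrite -val_eqE /= => ki.
  case: (ltngtP k i) ki => // ki _.
    suff -> : c k = 0 by rewrite scale0r seminorm0.
    apply/eqP; apply: contraTT ki => ck; rewrite -leqNgt; apply: imin.
    by rewrite ck -ltnS ltn_ord.
  by apply: seminormZ0; apply: (seminorm_incr0 p_incr) (hu k).1; exact: sS.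
by move/esym/eqP; rewrite mulf_eq0 normr_eq0 (negPf ci).
Qed.

End PrefixSpan.

(* If [f] in [ker (p 0)] has leading term [T^D x] with [D] beyond the finite
    codimension of the kernels involved, then [T^D x] lies in
    [ker (p 0) + span {T^i x | i < D}], and this subspace is [T]-invariant. *)
Lemma chain_not_orbital (K : numFieldType) (V : lmodType K) (p : nat -> seminorm V)
    (T : {linear V -> V}) (x : V) :
  (forall n u, p n u <= p n.+1 u) ->
  (forall n, finite_dimensional (ker_quot_ker (p n) (p n.+1))) ->
  (forall N, exists2 n, (N <= n)%N & exists u : ker_quot_ker (p n) (p n.+1), u != 0) ->
  (exists m, forall u, p m u = 0 -> p 0 (T u) = 0) ->
  total_family (fun n => iter n T x) -> finite_dimensional (quot_ker (p 0)).
Proof.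
move=> p_incr fin inf [m Tm] tot.
have [d hd] := ker_chain_prefix tot m fin.
have [f f0 fd] := ker_not_prefix (fun n => iter n T x) p_incr d inf.
have [n [a fa]] := tot f.
have ex : exists i, [&& (i < n)%N, (d <= i)%N & a i != 0].
  apply: contrapT => /forallNP h; apply: fd.
  exists (fun i => if (i < n)%N then a i else 0).
  rewrite fa; have [nd|dn] := leqP n d; first exact: in_span_sum_le.
  rewrite (big_ord_widen _ (fun i => (if (i < n)%N then a i else 0) *: iter i T x) (ltnW dn)).
  rewrite [RHS]big_mkcond; apply: eq_bigr => i _; case: ltnP => di; first by rewrite ltn_ord.
  have [->|ai] := eqVneq (a i) 0; first by rewrite scale0r.
  by case: (h i); rewrite ltn_ord di.
case: (ex_maxnP ex (m := n)) => [i /andP[/ltnW //]|D /and3P[Dn dD aD] Dmax].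
have xD : prefix_mod (fun i => iter i T x) (p 0) D (iter D T x).
  rewrite -[iter D T x]scale1r -(mulVf aD) -scalerA.
  suff [z zD hz] : prefix_mod (fun i => iter i T x) (p 0) D (a D *: iter D T x).
    by exists ((a D)^-1 *: z); [exact: prefix_spanZ|rewrite -scalerBr; exact: seminormZ0].
  exists (- \sum_(i < D) a i *: iter i T x).
    by rewrite -scaleN1r; apply: prefix_spanZ; exists a.
  rewrite opprK addrC -(big_ord_recr D (fun i => a (val i) *: iter i T x)) -[RHS]f0 fa.
  rewrite (big_ord_widen _ (fun i => a i *: iter i T x) Dn) big_mkcond.
  congr (p 0 _); apply: eq_bigr => i _; case: ltnP => // Di.
  have [->|ai] := eqVneq (a i) 0; first by rewrite scale0r.
  by have := Dmax i; rewrite ltn_ord (leq_trans dD (ltnW Di)) ai leqNgt Di => /(_ isT).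
have xle i : (i <= D)%N -> prefix_mod (fun i => iter i T x) (p 0) D (iter i T x).
  by rewrite leq_eqVlt => /orP[/eqP -> //|iD]; exact: (prefix_mod_mem (fun i => iter i T x)).
have Tpre u : prefix_span (fun i => iter i T x) D u ->
    prefix_mod (fun i => iter i T x) (p 0) D (T u).
  move=> [b ->]; rewrite linear_sum; under eq_bigr do rewrite linearZ.
  by apply: prefix_mod_sum => i _; exact: (xle i.+1).
have TW u : prefix_mod (fun i => iter i T x) (p 0) D u ->
    prefix_mod (fun i => iter i T x) (p 0) D (T u).
  move=> [z zD uz]; rewrite -[u](subrK z) linearD; apply: prefix_modD; last exact: Tpre.
  have [z' zd' uz'] := hd _ uz.
  rewrite -[u - z](subrK z') linearD; apply: prefix_modD; last first.
    exact/Tpre/(prefix_span_le dD).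
  exact/prefix_mod_ker/Tm.
have xW i : prefix_mod (fun i => iter i T x) (p 0) D (iter i T x).
  elim: i => [|i IHi]; [exact: xle|exact: TW].
apply: (@prefix_mod_finite_dim _ _ (fun i => iter i T x) (p 0) D) => u.
by have [k [b ->]] := tot u; apply: prefix_mod_sum => i _; exact: xW.
Qed.

(** * Assembling the equivalences *)

Lemma M2_not_orbital (R : realType) (K : numFieldType) (E : tvsType K) :
  M2 R E -> ~ orbital E.
Proof.
move=> [_ _ [p [p_incr p_top inf_quot fin inf]]] [T [x [Tc Tx]]]; apply: inf_quot.
apply: (chain_not_orbital p_incr fin inf (T := T) (x := x)).
  exact: continuous_seminorm0.
exact: lspan_orbit_total.
Qed.

Lemma tail_define_topology (K : numFieldType) (E : tvsType K) (p : nat -> seminorm E) N :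
  (forall n x, p n x <= p n.+1 x) -> seminorms_define_topology p ->
  seminorms_define_topology (fun n => p (N + n)%N).
Proof.
move=> p_incr p_top x A; rewrite p_top; split=> [[s [e [e0 sA]]]|[s [e [e0 sA]]]].
  exists s, e; split=> // y hy; apply: sA => i /hy; apply: le_lt_trans.
  exact/(seminorm_incr p_incr)/leq_addl.
exists [seq (N + i)%N | i <- s], e; split=> // y hy; apply: sA => i si.
by apply: hy; exact: map_f.
Qed.

(** In the remaining case the sequence starts at [p N], with [N] the last infinite level: the first
    quotient is infinite dimensional and every later step finite. *)
Lemma strongly_orbital_or_M2 (R : realType) (K : numFieldType) (io : real_form R K)
    (E : tvsType K) :
  metrizable R E -> countably_infinite_dimensional E -> strongly_orbital E \/ M2 R E.
Proof.
move=> mE /countable_dim_basis[x [xt xf]].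
have [p [p_incr p_sep p_top]] := metrizable_seminorms io mE.
have [e [f [l [C data]]]] := level_basis io xt xf p_incr p_sep.
have [|[N [infN finN unb]]] := cyclic_or_tail io p_incr data.
  by left; exact: (strongly_cyclic_orbital p_incr p_top).
right; split=> //; first exact: free_not_finite_dim xf.
exists (fun n => p (N + n)%N); split.
- by move=> n u; rewrite addnS.
- exact: tail_define_topology.
- by rewrite addn0; exact: (infinite_level_quot data infN).
- move=> n; rewrite addnS; apply: (finite_level_ker_quot p_incr data).
  by apply: finN; rewrite ltnS leq_addr.
- move=> M; have [k Mk] := unb (N + M).+1.
  (* Position [n] of the shifted sequence compares [p (N + n)] with [p (N + n).+1], so a vector of
     level [N + n + 1] is the one seen there. *)
  exists (l k - N.+1)%N; first by rewrite leq_subRL ?addSn // (leq_trans _ Mk) // ltnS leq_addr.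
  have lk : l k = (N + (l k - N.+1)).+1.
    by rewrite -addSn subnKC // (leq_trans _ Mk) // ltnS leq_addr.
  by rewrite addnS; exact: (level_ker_quot data lk).
Qed.

Theorem theorem1p7 (R : realType) (K : numFieldType)
    (hK : K = R :> numFieldType \/ K = R[i] :> numFieldType)
    (E : tvsType K) (hmetr : metrizable R E)
    (hdim : countably_infinite_dimensional E) :
  (orbital E <-> strongly_orbital E) /\ (strongly_orbital E <-> ~ M2 R E).
Proof.
have [io] := real_form_exists hK.
have so : strongly_orbital E -> orbital E.
  by move=> [T [x [Tc _ Tx]]]; exists T, x.
have os : ~ M2 R E -> strongly_orbital E.
  by case: (strongly_orbital_or_M2 io hmetr hdim).
have oM : orbital E -> ~ M2 R E by move=> oE /M2_not_orbital.
by split; split=> // ?; [apply/os/oM|apply/oM/so].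
Qed.
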